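(* For $\mathcal L_2$-a.e. $\lambda\in\mathbb C$ with $$|\lambda|\in\bigcup_{k=2}^\infty\big(2^{-1/(2k)},\,(2\cdot5^{-5/8})^{1/k}\big),$$ the measure $\nu_\lambda$ is absolutely continuous with a continuous density; hence $A_\lambda$ has non-empty interior. In particular this holds for $\mathcal L_2$-a.e. $\lambda\in\mathbb D$ with $|\lambda|>2^{-1/20}$.
   Context: $\mathbb D$ is the open unit disc, $\mathcal L_2$ area measure. $\nu_\lambda$ is the distribution of the random series $\sum_{n\ge0}\pm\lambda^n$ with independent fair signs; $A_\lambda=\{\sum_{n\ge0}a_n\lambda^n:a_n\in\{-1,1\}\}$ is its support. *)

(* Defs.v *)
From HB Require Import structures.
From mathcomp Require Import all_boot all_order all_algebra.
From mathcomp Require Import all_classical all_reals all_analysis.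
Set Implicit Arguments. Unset Strict Implicit. Unset Printing Implicit Defensive.
Import Order.TTheory GRing.Theory Num.Theory numFieldNormedType.Exports.
Local Open Scope classical_set_scope.
Local Open Scope ring_scope.

Section Defs.
Variable R : realType.

Definition cmul (z w : R * R) : R * R :=
  (z.1 * w.1 - z.2 * w.2, z.1 * w.2 + z.2 * w.1).

Fixpoint cpow (z : R * R) (n : nat) : R * R :=
  if n is n'.+1 then cmul z (cpow z n') else (1, 0).

Definition cabs (z : R * R) : R := Num.sqrt (z.1 ^+ 2 + z.2 ^+ 2).

Definition sgnb (b : bool) : R := if b then 1 else -1.

Definition signed_series (l : R * R) (a : nat -> bool) : R * R :=
  (limn (fun N => \sum_(0 <= n < N) sgnb (a n) * (cpow l n).1),
   limn (fun N => \sum_(0 <= n < N) sgnb (a n) * (cpow l n).2)).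

Definition Aset (l : R * R) : set (R * R) :=
  [set signed_series l a | a in [set: nat -> bool]].

(* n-th binary digit (after the leading one) of t in [0,1):
   t = sum_n digit n t 2^{-(n+1)}. Under Lebesgue measure on [0,1) these
   digits are i.i.d. fair bits, giving the fair random signs. *)
Definition digit (t : R) (n : nat) : bool := odd (Num.truncn (t * 2 ^+ n.+1)).

(* nu_lambda, the distribution of sum_{n>=0} +-lambda^n with independent fair
   signs: the pushforward of Lebesgue measure on [0,1) by
   t |-> sum_n (2 digit_n(t) - 1) lambda^n *)
Definition nu (l : R * R) (B : set (R * R)) : \bar R :=
  (@lebesgue_measure R) ([set t | 0 <= t < 1] `&` [set t | B (signed_series l (digit t))]).

Definition L2 := ((@lebesgue_measure R) \x (@lebesgue_measure R))%E.

Definition has_continuous_density (l : R * R) : Prop :=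
  exists g : R * R -> R,
    continuous g /\ (forall z, 0 <= g z) /\
    forall B : set (R * R), measurable B ->
      nu l B = (\int[L2]_(z in B) (g z)%:E)%E.

End Defs.

(* Main.v *)
(** Transversality.  Let [f] be a real polynomial with coefficients in [[-1, 1]]
    and constant term [1].  Its squared [l^2]-norm with weights [(4/5)^n] is at
    most [5], and replacing a quadratic factor by its reciprocal preserves that
    norm.  If two conjugate pairs of almost-roots of modulus below
    [2 * 5^(-5/8)] existed, the four replacements would make the constant term
    too large (Jensen's inequality).  Hence, away from the real axis, the
    parameters [z] with [|f z| <= r] lie within [O(r)] of each other up to
    conjugation, and form a set of area [O(r^2)].

    Energy.  Summing over pairs of sign sequences and using Fatou's lemma, for
    almost every [l] with [l^k] in the annulus [1/2 < |z|^2], [|z| < 2 * 5^(-5/8)],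
    the law of [sum +- l^(k n)] has bounded energy at infinitely many dyadic
    scales.  This is transported by [l |-> l^k], which is locally expansive off
    the origin.

    Continuity.  For [k >= 2] the random series contains two independent
    summands distributed as [nu_(l^k)] and [l nu_(l^k)].  Mollify by the product of
    two dyadic tents: the difference [D] of two such mollifiers at different scales is
    a positive semidefinite kernel, because consecutive tents differ by the negative
    of a second difference of a tent.  So energies increase as the tents sharpen,
    hence converge, and by Cauchy-Schwarz for [D] the mollified densities are uniformly Cauchy.  Their
    limit is a continuous density; it is positive on some open set, and the
    closed set [A_l] contains that open set. *)

Require Import Defs.
From HB Require Import structures.
From mathcomp Require Import all_boot all_order all_algebra.
From mathcomp Require Import all_classical all_reals all_analysis.
From mathcomp Require Import measurable_realfun.
From mathcomp Require Import zify ring lra.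
Set Implicit Arguments. Unset Strict Implicit. Unset Printing Implicit Defensive.
Import Order.TTheory GRing.Theory Num.Theory numFieldNormedType.Exports.
Local Open Scope classical_set_scope.
Local Open Scope ring_scope.

(** * Transversality *)

(** The radius [2 * 5^(-5/8)] comes from optimising the weight. With a weight [w < 1], coefficients
    in [-1, 1] give a squared norm of at most [1 / (1 - w)], and two conjugate pairs of roots of
    squared modulus at most [kap] force [w^4 * (1 - w) <= kap^4]. The left side is largest at
    [w = 4/5], with value [2^8 / 5^5]; as [kap] is a squared modulus, the radius is the eighth root
    of this value. The lower radius comes from a recursion for energies: adding one sign changes the
    threshold [t] to [t / rho] on half of the pairs, and a bound of order [4^N * t] survives
    iteration when [2 / rho < 4], where [rho] bounds [|z|^2] from below. No Fourier transform
    occurs. Laws are finite averages over sign vectors and positivity is tested on finite sets of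
    weighted points; a tent measures the overlap of two intervals, which makes it positive
    semidefinite. *)

Section Weighted.
Variables (R : realType) (w : R).
Hypothesis w_gt0 : 0 < w.

Definition wnorm (p : {poly R}) : R := \sum_(i < size p) w ^+ i * p`_i ^+ 2.

Lemma wnorm_wide n (p : {poly R}) : (size p <= n)%N ->
  wnorm p = \sum_(i < n) w ^+ i * p`_i ^+ 2.
Proof.
move=> pn; rewrite /wnorm (big_ord_widen n (fun i => w ^+ i * p`_i ^+ 2) pn).
rewrite big_mkcond; apply: eq_bigr => i _; case: ltnP => // pi.
by rewrite nth_default // expr0n mulr0.
Qed.

Lemma wnorm_ge_coef (p : {poly R}) n : w ^+ n * p`_n ^+ 2 <= wnorm p.
Proof.
rewrite (@wnorm_wide (maxn (size p) n.+1)) ?leq_maxl//.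
rewrite (bigD1 (Ordinal (leq_maxr (size p) n.+1)))//= lerDl.
by apply: sumr_ge0 => i _; rewrite mulr_ge0 ?sqr_ge0 ?exprn_ge0 ?ltW.
Qed.

Lemma wnormN p : wnorm (- p) = wnorm p.
Proof.
by rewrite /wnorm size_polyN; apply: eq_bigr => i _; rewrite coefN sqrrN.
Qed.

(** The defect is the explicit square [s^-1 * (s * a - b)^2]. For small [s] the main summand keeps a
    constant near 1 while a tiny remainder is split off. *)
Lemma wnormD_le (s : R) p q : 0 < s ->
  wnorm (p + q) <= (1 + s) * wnorm p + (1 + s^-1) * wnorm q.
Proof.
move=> s0; pose n := maxn (size p) (size q).
rewrite (@wnorm_wide n (p + q)) ?size_polyD//.
rewrite (@wnorm_wide n p) ?leq_maxl// (@wnorm_wide n q) ?leq_maxr//.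
rewrite !mulr_sumr -big_split/=; apply: ler_sum => i _; rewrite coefD.
set a := p`_i; set b := q`_i; set e := w ^+ i.
have e0 : 0 <= e by rewrite exprn_ge0// ltW.
have -> : (1 + s) * (e * a ^+ 2) + (1 + s^-1) * (e * b ^+ 2) =
   e * ((a + b) ^+ 2 + s^-1 * (s * a - b) ^+ 2) by field; lra.
by rewrite ler_wpM2l// lerDl mulr_ge0 ?sqr_ge0// invr_ge0 ltW.
Qed.

Let sh (h : nat -> R) n := if n is m.+1 then h m else 0.

(** Parseval on the circle [|z|^2 = w] in algebraic form: there [quadr] is [z^2 / w] times the
    conjugate of [quad], so both have the same modulus. Cut off at [N], the two sums differ by a
    quadratic form in the last two coefficients, found by telescoping. *)
Lemma quad_isometry_partial (p q : R) (h : nat -> R) N :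
  \sum_(n < N) w ^+ n * (sh (sh h) n - p * sh h n + q * h n) ^+ 2 =
  \sum_(n < N) w ^+ n * (q / w * sh (sh h) n - p * sh h n + w * h n) ^+ 2
  - w ^+ N * ((1 - q ^+ 2 / w ^+ 2) * sh (sh h) N ^+ 2
     - 2 * p * (1 - q / w) * sh (sh h) N * sh h N
     + (w - q ^+ 2 / w) * sh h N ^+ 2).
Proof.
elim: N => [|N IH]; first by rewrite !big_ord0/=; ring.
rewrite !big_ord_recr/= IH.
rewrite (exprS w N); set a := sh h N; set b := sh _ N; set c := h N.
by field; rewrite gt_eqF.
Qed.

Definition quad (p q : R) : {poly R} := 'X^2 - p *: 'X + q%:P.
(** For [q != 0] its roots are [w / z] for the roots [z] of [quad p q], that is, their reflections
    in the circle [|z|^2 = w] when they form a conjugate pair. *)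
Definition quadr (p q : R) : {poly R} := (q / w) *: 'X^2 - p *: 'X + w%:P.

Lemma wnorm_quad (p q : R) (h : {poly R}) :
  wnorm (quad p q * h) = wnorm (quadr p q * h).
Proof.
have cX (n : nat) (g : {poly R}) : ('X * g)`_n = sh (fun i => g`_i) n.
  by rewrite coefXM; case: n.
have cX2 n : ('X^2 * h)`_n = sh (sh (fun i => h`_i)) n.
  by rewrite expr2 -mulrA !cX; case: n => // n; rewrite /= cX.
set N := (size (quad p q * h)%R + size (quadr p q * h)%R + size h + 3)%N.
rewrite (@wnorm_wide N); last by rewrite /N; lia.
rewrite (@wnorm_wide N (quadr p q * h)); last by rewrite /N; lia.
under eq_bigr => i _ do rewrite /quad !mulrDl coefD coefD mulNr coefN
  -scalerAl coefZ coefCM cX cX2.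
rewrite quad_isometry_partial.
have h0 n : (size h <= n)%N -> h`_n = 0 by move=> ?; rewrite nth_default.
have [M EN hM] : exists2 M, N = M.+2 & (size h <= M)%N.
  by exists (size (quad p q * h)%R + size (quadr p q * h)%R + size h).+1;
    rewrite /N; [rewrite addn3 | rewrite leqW// leq_addl].
have -> : sh (sh (fun i => h`_i)) N = 0 by rewrite EN /= h0.
have -> : sh (fun i => h`_i) N = 0 by rewrite EN /= h0// leqW.
rewrite !(expr0n, mulr0, mul0r, addr0, subr0)/=.
apply: eq_bigr => i _; rewrite /quadr !mulrDl coefD coefD mulNr coefN
  -!scalerAl !coefZ coefCM cX cX2.
by rewrite scalerAl.
Qed.

Lemma coef0_quad p q h : (quad p q * h)`_0 = q * h`_0.
Proof. by rewrite coef0M /quad !coefD coefN coefZ coefX coefXn coefC/=; ring. Qed.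

Lemma coef0_quadr p q h : (quadr p q * h)`_0 = w * h`_0.
Proof. by rewrite coef0M /quadr !(coefD,coefN,coefZ,coefX,coefXn,coefC)/=; ring. Qed.

Definition lin (a b : R) : {poly R} := a%:P + b *: 'X.

Lemma size_lin a b : (size (lin a b) <= 2)%N.
Proof.
rewrite (leq_trans (size_polyD _ _))// geq_max (leq_trans (size_polyC_leq1 _))//.
by rewrite (leq_trans (size_scale_leq _ _))// size_polyX.
Qed.

Lemma wnorm_lin a b : wnorm (lin a b) = a ^+ 2 + w * b ^+ 2.
Proof.
rewrite (wnorm_wide (size_lin a b)) !big_ord_recl big_ord0/= /bump/=.
by rewrite !(coefD,coefZ,coefX,coefC)/=; ring.
Qed.

Lemma wnorm_quadr_lin p q a b :
  wnorm (quadr p q * lin a b) = (w * a) ^+ 2 + w * (w * b - p * a) ^+ 2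
   + w ^+ 2 * (q / w * a - p * b) ^+ 2 + w ^+ 3 * (q / w * b) ^+ 2.
Proof.
have E : quadr p q * lin a b = (q / w * b) *: 'X^3 + (q / w * a - p * b) *: 'X^2
    + (w * b - p * a) *: 'X + (w * a)%:P.
  rewrite /quadr /lin -!mul_polyC !(polyCM,polyCB,polyCD); ring.
rewrite E (@wnorm_wide 4).
  rewrite !big_ord_recl big_ord0/= /bump/=.
  by rewrite !(coefD,coefZ,coefX,coefC,coefXn)/=; ring.
apply/leq_sizeP => j; case: j => [|[|[|[|j]]]]// _.
by rewrite !(coefD,coefZ,coefX,coefC,coefXn)/=; ring.
Qed.

End Weighted.

(** * Jensen's inequality with remainders *)

Section Gap.
Variable R : realType.
Notation w := (4 / 5 : R).

Lemma wnorm_le5 (f : {poly R}) : (forall i, `|f`_i| <= 1) -> wnorm w f <= 5.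
Proof.
move=> f1; apply: (@le_trans _ _ (\sum_(i < size f) w ^+ i)).
  apply: ler_sum => i _; apply: ler_piMr; first by rewrite exprn_ge0//; lra.
  by rewrite -real_normK ?num_real// exprn_ile1.
elim: (size f) => [|n IH]; first by rewrite big_ord0 ler0n.
rewrite big_ord_recl expr0; under eq_bigr => i _ do rewrite /= exprS.
by rewrite -mulr_sumr; lra.
Qed.

(* Dividing out a conjugate pair of approximate roots [quad p q] and replacing
   it by its reciprocal [quadr w p q] keeps the weighted norm, which is at most
   [5 = 1 / (1 - w)], but multiplies the constant term by [w / q]: this is
   Jensen's inequality for two pairs of roots. *)
Lemma remainders_not_small (kap : R) : 0 < kap < 1 -> 5 * kap ^+ 4 < w ^+ 4 ->
  exists2 d : R, 0 < d & forall (f h1 h2 : {poly R}) (p1 q1 p2 q2 a1 b1 a2 b2 : R),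
    (forall i, `|f`_i| <= 1) -> f`_0 = 1 ->
    f = quad p1 q1 * h1 + lin a1 b1 -> h1 = quad p2 q2 * h2 + lin a2 b2 ->
    0 <= q1 <= kap -> 0 <= q2 <= kap -> `|p1| <= 2 ->
    [|| d <= `|a1|, d <= `|b1|, d <= `|a2| | d <= `|b2|].
Proof.
(* The slack in the hypothesis is [60 * s]; the errors below cost at most [4 * s * w^4] and
   [53 * s * kap^4], and [4 + 53 < 60]. *)
move=> /andP[k0 k1] kw; set s := (w ^+ 4 - 5 * kap ^+ 4) / 60.
have w0 : 0 < w by lra.
have K0 : 0 <= kap ^+ 4 <= 1 by rewrite exprn_ge0 ?exprn_ile1 ?ltW.
have w4 : w ^+ 4 <= 1 by rewrite exprn_ile1//; lra.
have s0 : 0 < s by rewrite /s; lra.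
have s1 : s <= 1/60 by rewrite /s; lra.
have sE : w ^+ 4 - 5 * kap ^+ 4 = 60 * s by rewrite /s; field.
(* Remainders of size [d] enter as [(1 + s^-1) * d^2]; for [d = s^2] this is [(1 + s) * s^3], of
   higher order than the slack. *)
exists (s ^+ 2); first by rewrite exprn_gt0.
set d := s ^+ 2; move=> f h1 h2 p1 q1 p2 q2 a1 b1 a2 b2 f1 f0 Ef Eh.
move=> /andP[q10 q1k] /andP[q20 q2k] p12.
apply/negPn/negP; rewrite !negb_or -!ltNge => /and4P[a1d b1d a2d b2d].
have d0 : 0 < d by rewrite exprn_gt0.
have ds : d <= s by rewrite /d expr2 ger_pMr//; lra.
have f00 : 1 = q1 * (q2 * h2`_0 + a2) + a1.
  rewrite -f0 Ef coefD coef0_quad Eh coefD coef0_quad.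
  by rewrite !(coefD,coefC,coefZ,coefX)/= !mulr0 !addr0.
set H := h2`_0 in f00.
have sqd (a : R) : `|a| < d -> a ^+ 2 <= d ^+ 2.
  by move=> ad; rewrite -real_normK ?num_real// lerXn2r ?nnegrE// ltW.
have mulP := @wnormD_le R w w0 s _ _ s0.
have e1 : wnorm w (quad p1 q1 * h1) <= (1 + s) * 5 + (1 + s^-1) * (2 * d ^+ 2).
  have -> : quad p1 q1 * h1 = f + - lin a1 b1 by rewrite Ef addrK.
  apply: (le_trans (mulP _ _)); rewrite wnormN wnorm_lin//.
  apply: lerD; first by rewrite ler_wpM2l ?wnorm_le5//; lra.
  rewrite ler_wpM2l ?addr_ge0 ?invr_ge0//; first lra.
  by have := sqd _ a1d; have := sqd _ b1d; have := sqr_ge0 d; lra.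
have e2 : wnorm w (quadr w p1 q1 * lin a2 b2) <= 15 * d ^+ 2.
  rewrite wnorm_quadr_lin//.
  have := ltW a2d; have := ltW b2d; move: p12.
  rewrite !ler_norml => /andP[p1l p1u] /andP[b2l b2u] /andP[a2l a2u].
  have sqn (x c : R) : - (c * d) <= x -> x <= c * d -> x ^+ 2 <= c ^+ 2 * d ^+ 2.
    move=> xl xu; rewrite -exprMn -real_normK ?num_real// lerXn2r ?nnegrE//.
      by rewrite (le_trans (normr_ge0 x))// ler_norml; apply/andP; split.
    by rewrite ler_norml; apply/andP; split.
  have qq : 0 <= q1 / w <= 5 / 4.
    by apply/andP; split; [rewrite divr_ge0//; lra | rewrite ler_pdivrMr//; lra].
  have pa (x : R) : - d <= x -> x <= d -> - (2 * d) <= p1 * x /\ p1 * x <= 2 * d.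
    move=> xl xu; apply/andP; rewrite -ler_norml normrM ler_pM// ?ler_norml.
      by apply/andP; split.
    by apply/andP; split.
  have qa (x : R) : - d <= x -> x <= d ->
      - (5 / 4 * d) <= q1 / w * x /\ q1 / w * x <= 5 / 4 * d.
    move=> xl xu; case/andP: qq => ? ?.
    apply/andP; rewrite -ler_norml normrM ler_pM// ?ler_norml; apply/andP; split => //.
    lra.
  have [? ?] := pa _ a2l a2u; have [? ?] := pa _ b2l b2u.
  have [? ?] := qa _ a2l a2u; have [? ?] := qa _ b2l b2u.
  clear kw K0 w4 s1 sE ds f00 f1 f0 e1 sqd q10 q1k q20 q2k qq pa qa mulP k0 k1 s0.
  have t1 : (w * a2) ^+ 2 <= (4 / 5) ^+ 2 * d ^+ 2 by apply: sqn; lra.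
  have t2 : (w * b2 - p1 * a2) ^+ 2 <= (14 / 5) ^+ 2 * d ^+ 2 by apply: sqn; lra.
  have t3 : (q1 / w * a2 - p1 * b2) ^+ 2 <= (13 / 4) ^+ 2 * d ^+ 2.
    by apply: sqn; lra.
  have t4 : (q1 / w * b2) ^+ 2 <= (5 / 4) ^+ 2 * d ^+ 2 by apply: sqn; lra.
  by have := sqr_ge0 d; lra.
have e3 : w ^+ 4 * H ^+ 2 <= (1 + s) * ((1 + s) * 5 + (1 + s^-1) * (2 * d ^+ 2))
     + (1 + s^-1) * (15 * d ^+ 2).
  apply: (@le_trans _ _ (wnorm w (quadr w p2 q2 * (quadr w p1 q1 * h2)))).
    have := wnorm_ge_coef w0 (quadr w p2 q2 * (quadr w p1 q1 * h2)) 0.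
    by rewrite expr0 !coef0_quadr mul1r -/H; lra.
  rewrite -wnorm_quad//.
  have -> : quad p2 q2 * (quadr w p1 q1 * h2) =
      quadr w p1 q1 * h1 + - (quadr w p1 q1 * lin a2 b2).
    by rewrite Eh mulrDr addrK mulrCA.
  apply: (le_trans (mulP _ _)); rewrite wnormN -wnorm_quad//.
  by rewrite lerD// ler_wpM2l// ?addr_ge0 ?invr_ge0//; lra.
clear e1 e2 sqd.
have dinv : (1 + s^-1) * d ^+ 2 = (1 + s) * s ^+ 3 by rewrite /d; field; lra.
have s3 : s ^+ 3 <= s.
  by rewrite exprS ger_pMr// exprn_ile1//; lra.
have s2 : s ^+ 2 <= s by [].
have s30 : 0 <= s ^+ 3 by rewrite exprn_ge0// ltW.
have e4 : w ^+ 4 * H ^+ 2 <= 5 + 53 * s.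
  apply: (le_trans e3); rewrite mulrCA [X in _ + X <= _]mulrCA dinv.
  have : (1 + s) * s ^+ 3 <= 2 * s by rewrite ler_pM//; lra.
  have : 0 <= (1 + s) * s ^+ 3 by rewrite mulr_ge0//; lra.
  set X := _ * s ^+ 3; move=> X0 X2.
  have : s * X <= X by rewrite ler_piMl//; lra.
  nra.
clear e3 dinv s3 s30.
have e5 : (1 - 2 * d) ^+ 2 <= kap ^+ 4 * H ^+ 2.
  have l1 : 1 - 2 * d <= q1 * q2 * H.
    have : `|q1 * a2| <= d.
      by rewrite normrM -[d]mul1r ler_pM// ?(ltW a2d)// ger0_norm//; lra.
    move: a1d; rewrite ltr_norml ler_norml => /andP[? ?] /andP[? ?]; lra.
  have l2 : (1 - 2 * d) ^+ 2 <= (q1 * q2 * H) ^+ 2 by rewrite lerXn2r ?nnegrE//; lra.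
  apply: (le_trans l2); rewrite exprMn ler_wpM2r ?sqr_ge0//.
  rewrite (exprM kap 2 2) lerXn2r ?nnegrE ?mulr_ge0 ?exprn_ge0// ?(ltW k0)//.
  by rewrite expr2 ler_pM.
have e6 : w ^+ 4 * (1 - 4 * s) <= kap ^+ 4 * (5 + 53 * s).
  apply: (@le_trans _ _ (w ^+ 4 * (kap ^+ 4 * H ^+ 2))).
    rewrite ler_wpM2l ?exprn_ge0 ?(ltW w0)//; apply: le_trans e5.
    have := sqr_ge0 d; lra.
  by rewrite mulrCA; apply: ler_wpM2l => //; case/andP: K0.
have : kap ^+ 4 * s <= s by rewrite ger_pMl//; lra.
have : w ^+ 4 * s <= s by rewrite ger_pMl//; lra.
move: e6 sE; set W := w ^+ 4; set KK := kap ^+ 4; lra.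
Qed.

End Gap.

(** * Complex evaluation and separation of almost-roots *)

Section Eval.
Variable R : realType.
Implicit Types (l m z : R * R) (p f h : {poly R}).

Definition n2 z : R := z.1 ^+ 2 + z.2 ^+ 2.

Lemma n2_ge0 z : 0 <= n2 z. Proof. by rewrite addr_ge0 ?sqr_ge0. Qed.

Lemma n2M z l : n2 (cmul z l) = n2 z * n2 l.
Proof. by rewrite /n2 /cmul/=; ring. Qed.

Lemma cmul0l z : cmul 0 z = 0 :> R * R.
Proof. by rewrite /cmul/= !mul0r subr0 addr0. Qed.

Lemma n2D_le z l : n2 (z + l) <= 2 * n2 z + 2 * n2 l.
Proof.
rewrite /n2/=; have := sqr_ge0 (z.1 - l.1); have := sqr_ge0 (z.2 - l.2); nra.
Qed.

Lemma n2N z : n2 (- z) = n2 z.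
Proof. by rewrite /n2/= !sqrrN. Qed.

Lemma n2_pow l k : n2 (cpow l k) = n2 l ^+ k.
Proof.
elim: k => [|k IH]; first by rewrite /n2/=; ring.
by rewrite /= n2M IH exprS.
Qed.

Definition ceval l p : R * R :=
  (\sum_(i < size p) p`_i * (cpow l i).1, \sum_(i < size p) p`_i * (cpow l i).2).

Lemma ceval_wide n l p : (size p <= n)%N -> ceval l p =
  (\sum_(i < n) p`_i * (cpow l i).1, \sum_(i < n) p`_i * (cpow l i).2).
Proof.
move=> pn; rewrite /ceval.
rewrite (big_ord_widen n (fun i => p`_i * (cpow l i).1) pn).
rewrite (big_ord_widen n (fun i => p`_i * (cpow l i).2) pn).
congr pair; rewrite big_mkcond; apply: eq_bigr => i _; case: ltnP => // pi;
  by rewrite nth_default // mul0r.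
Qed.

Lemma cevalD l p f : ceval l (p + f) = ceval l p + ceval l f.
Proof.
set n := maxn (size p) (size f).
rewrite (@ceval_wide n l (p + f)) ?size_polyD//.
rewrite (@ceval_wide n l p) ?leq_maxl// (@ceval_wide n l f) ?leq_maxr//.
by congr pair; rewrite /= -big_split/=; apply: eq_bigr => i _;
  rewrite coefD mulrDl.
Qed.

Lemma cevalZ l a p : ceval l (a *: p) = (a * (ceval l p).1, a * (ceval l p).2).
Proof.
rewrite (@ceval_wide (size p)) ?size_scale_leq//.
by congr pair; rewrite mulr_sumr; apply: eq_bigr => i _; rewrite coefZ mulrA.
Qed.

Lemma cevalN l p : ceval l (- p) = - ceval l p.
Proof. by rewrite -scaleN1r cevalZ !mulN1r. Qed.

Lemma cevalB l p f : ceval l (p - f) = ceval l p - ceval l f.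
Proof. by rewrite cevalD cevalN. Qed.

Lemma cevalC l a : ceval l a%:P = (a, 0).
Proof.
rewrite (@ceval_wide 1) ?size_polyC_leq1// !big_ord_recl !big_ord0/= !coefC/=.
by rewrite mulr1 mulr0 !addr0.
Qed.

Lemma cevalX l p : ceval l ('X * p) = cmul l (ceval l p).
Proof.
rewrite (@ceval_wide (size p).+1); last first.
  by rewrite (leq_trans (size_polyMleq _ _))// size_polyX.
rewrite !big_ord_recl/= !coefXM/= !mul0r !add0r /cmul/=; congr pair.
  by rewrite !mulr_sumr -sumrB; apply: eq_bigr => i _; rewrite coefXM/=; ring.
by rewrite !mulr_sumr -big_split; apply: eq_bigr => i _; rewrite coefXM/=; ring.
Qed.

Definition conjp l : R * R := (l.1, - l.2).

Definition rootquad l := quad (2 * l.1) (n2 l).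

Lemma ceval_rootquad l m h :
  ceval m (rootquad l * h) = cmul (cmul (m - l) (m - conjp l)) (ceval m h).
Proof.
have -> : rootquad l * h = 'X * ('X * h) - (2 * l.1) *: ('X * h) + (n2 l) *: h.
  by rewrite /rootquad /quad -!mul_polyC; ring.
rewrite !cevalD cevalN !cevalZ !cevalX; move: (ceval m h).
case: m l => m1 m2 [l1 l2] [e1 e2]; rewrite /cmul /conjp /n2/=.
by congr pair => /=; ring.
Qed.

Lemma ceval_lin l a b : ceval l (lin a b) = (a + b * l.1, b * l.2).
Proof.
by rewrite /lin cevalD cevalC cevalZ -['X]mulr1 cevalX (cevalC l 1) /cmul/=;
  congr pair; rewrite /=; ring.
Qed.

Lemma quad_division (p q : R) f : exists h a b, f = quad p q * h + lin a b.
Proof.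
exists (f %/ quad p q), (f %% quad p q)`_0, (f %% quad p q)`_1.
have sq : size (quad p q) = 3%N.
  rewrite /quad -addrA size_polyDl size_polyXn//.
  by rewrite -scaleNr addrC ltnS size_lin.
rewrite {1}(divp_eq f (quad p q)) mulrC; congr (_ + _).
have : (size (f %% quad p q)%R < 3)%N by rewrite -sq ltn_modp -size_poly_gt0 sq.
move: (f %% quad p q) => r sr; apply/polyP => i.
rewrite coefD coefC coefZ coefX; case: i => [|[|i]]/=; rewrite ?mulr0 ?mulr1 ?addr0 ?add0r//.
by rewrite nth_default// (@leq_trans 2).
Qed.

(** Divide [f] by the quadratic of [l], and the quotient by that of [m]. As the imaginary part of
    [l] is bounded away from 0, a small value at [l] makes the first linear remainder small, so the
    second one is not small and is bounded below at [m]. Up to the first remainder, [f] at [m] is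
    [m - l] times [m - conjp l] times the second remainder, and [m] is far from [conjp l] because
    the imaginary parts of [l] and [m] have the same sign. *)
Lemma approx_zeros_close (kap eta : R) :
  0 < kap < 1 -> 5 * kap ^+ 4 < (4 / 5) ^+ 4 -> 0 < eta <= 1 ->
  exists2 C : R, 0 < C & forall f l m t,
    (forall i, `|f`_i| <= 1) -> f`_0 = 1 ->
    0 < l.2 * m.2 -> eta <= `|l.2| -> eta <= `|m.2| -> n2 l <= kap -> n2 m <= kap ->
    n2 (ceval l f) <= t -> n2 (ceval m f) <= t -> n2 (l - m) <= C * t.
Proof.
move=> k01 kw /andP[e0 e1].
have [d d0 gap] := remainders_not_small k01 kw.
case/andP: k01 => k0 k1.
have eta2 : 0 < eta ^+ 2 by rewrite exprn_gt0.
have eta21 : eta ^+ 2 <= 1 by rewrite exprn_ile1// ltW.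
have d2 : 0 < d ^+ 2 by rewrite exprn_gt0.
(* Below [t0] the first remainder has coefficients less than [d], and [t0] also bounds the second
   one from below at [m]. For [t >= t0] the crude bound [n2 (l - m) <= 4] is enough. *)
set t0 := eta ^+ 2 * d ^+ 2 / 4.
have t00 : 0 < t0 by rewrite divr_gt0// mulr_gt0.
exists (44 / (eta ^+ 2 * eta ^+ 2 * eta ^+ 2 * d ^+ 2) + 4 / t0).
  by rewrite addr_gt0// divr_gt0// !mulr_gt0.
move=> f l m t f1 f0 lm el em lk mk fl fm.
have sqe (x : R) : eta <= `|x| -> eta ^+ 2 <= x ^+ 2.
  by move=> ex; rewrite -(real_normK (num_real x)) lerXn2r ?nnegrE// ltW.
have tt0 : 0 <= t := le_trans (n2_ge0 _) fl.
rewrite mulrDl; have [t0t|tt] := leP t0 t.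
  apply: (@le_trans _ _ (4 / t0 * t)); last first.
    by rewrite lerDr mulr_ge0// divr_ge0// !mulr_ge0 ?ltW.
  apply: (@le_trans _ _ 4).
    by apply: (le_trans (n2D_le _ _)); rewrite n2N; lra.
  by rewrite mulrAC ler_pdivlMr//; lra.
apply: (@le_trans _ _ (44 / (eta ^+ 2 * eta ^+ 2 * eta ^+ 2 * d ^+ 2) * t)); last first.
  by rewrite lerDl mulr_ge0// divr_ge0// ltW.
have [h1 [a1 [b1 E1]]] := quad_division (2 * l.1) (n2 l) f.
have [h2 [a2 [b2 E2]]] := quad_division (2 * m.1) (n2 m) h1.
have fl_lin : ceval l f = (a1 + b1 * l.1, b1 * l.2).
  by rewrite E1 cevalD -/(rootquad l) ceval_rootquad subrr !cmul0l add0r ceval_lin.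
have b1t : b1 ^+ 2 * eta ^+ 2 <= t.
  apply: le_trans fl; rewrite fl_lin /n2/= exprMn.
  apply: (@le_trans _ _ (b1 ^+ 2 * l.2 ^+ 2)).
    by rewrite ler_wpM2l ?sqr_ge0 ?sqe.
  by rewrite lerDr sqr_ge0.
have absx z : n2 z <= kap -> z.1 ^+ 2 <= 1 /\ z.2 ^+ 2 <= 1.
  by rewrite /n2 => zk; have := sqr_ge0 z.1; have := sqr_ge0 z.2; lra.
have [l11 l21] := absx _ lk; have [m11 m21] := absx _ mk.
have a1t : a1 ^+ 2 * eta ^+ 2 <= 4 * t.
  have : a1 ^+ 2 <= 2 * t + 2 * b1 ^+ 2.
    move: fl; rewrite fl_lin /n2/=.
    have : (b1 * l.1) ^+ 2 <= b1 ^+ 2 by rewrite exprMn ler_piMr ?sqr_ge0.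
    have := sqr_ge0 (b1 * l.2); have := sqr_ge0 (a1 + 2 * (b1 * l.1)).
    by rewrite !sqrrD; nra.
  move=> a1b; apply: (@le_trans _ _ ((2 * t + 2 * b1 ^+ 2) * eta ^+ 2)).
    by rewrite ler_wpM2r// ltW.
  have : t * eta ^+ 2 <= t by rewrite ler_piMr.
  by lra.
have small (x : R) : x ^+ 2 * eta ^+ 2 <= 4 * t -> `|x| < d.
  move=> xt; rewrite -(@ltr_pXn2r _ 2) ?nnegrE ?(ltW d0)// real_normK ?num_real//.
  rewrite -(ltr_pM2r eta2) (le_lt_trans xt)//.
  by move: tt; rewrite /t0; lra.
have a1d := small _ a1t.
have b1d : `|b1| < d by apply: small; lra.
have := gap f h1 h2 _ _ _ _ a1 b1 a2 b2 f1 f0 E1 E2.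
rewrite !n2_ge0 lk mk => /(_ isT isT).
have l1n : `|2 * l.1| <= 2.
  rewrite normrM [`|2|]ger0_norm// ler_piMr//.
  by rewrite -(@expr_le1 _ 2)// real_normK ?num_real.
move=> /(_ l1n); rewrite !leNgt a1d b1d/= -!leNgt => r2big.
have r2m : t0 <= n2 (ceval m (lin a2 b2)).
  rewrite ceval_lin /n2/= /t0.
  have [b2d|b2d] := leP (d ^+ 2 / 4) (b2 ^+ 2).
    have : d ^+ 2 / 4 * eta ^+ 2 <= b2 ^+ 2 * m.2 ^+ 2.
      by apply: ler_pM; rewrite ?sqr_ge0 ?sqe// divr_ge0 ?sqr_ge0.
    have := sqr_ge0 (a2 + b2 * m.1); rewrite exprMn; lra.
  have sqd (x : R) : d <= `|x| -> d ^+ 2 <= x ^+ 2.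
    by move=> dx; rewrite -(real_normK (num_real x)) lerXn2r ?nnegrE// ltW.
  have a2d : d ^+ 2 <= a2 ^+ 2.
    case/orP: r2big => /sqd//; lra.
  have bm : (b2 * m.1) ^+ 2 <= d ^+ 2 / 4.
    by rewrite exprMn (le_trans _ (ltW b2d))// ler_piMr ?sqr_ge0.
  have : eta ^+ 2 * d ^+ 2 <= d ^+ 2 by rewrite ler_piMl// ltW.
  have := sqr_ge0 (b2 * m.2); have := sqr_ge0 (a2 + 2 * (b2 * m.1)).
  by rewrite !sqrrD; nra.
have Em : ceval m f = cmul (cmul (m - l) (m - conjp l)) (ceval m (lin a2 b2))
    + ceval m (lin a1 b1).
  rewrite E1 cevalD -/(rootquad l) ceval_rootquad E2 cevalD.
  by rewrite -/(rootquad m) ceval_rootquad subrr !cmul0l add0r.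
have r1m : n2 (ceval m (lin a1 b1)) * eta ^+ 2 <= 10 * t.
  have : n2 (ceval m (lin a1 b1)) <= 2 * a1 ^+ 2 + 2 * b1 ^+ 2.
    rewrite ceval_lin /n2/=.
    have : b1 ^+ 2 * (m.1 ^+ 2 + m.2 ^+ 2) <= b1 ^+ 2.
      by rewrite ler_piMr ?sqr_ge0//; move: mk; rewrite /n2; lra.
    have := sqr_ge0 (b1 * m.2).
    have := sqr_ge0 (a1 - b1 * m.1); rewrite !exprMn; nra.
  move=> r1; apply: (@le_trans _ _ ((2 * a1 ^+ 2 + 2 * b1 ^+ 2) * eta ^+ 2)).
    by rewrite ler_wpM2r// ltW.
  by lra.
have prod_le : n2 (m - l) * n2 (m - conjp l) * n2 (ceval m (lin a2 b2)) * eta ^+ 2 <= 22 * t.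
  rewrite -!n2M.
  have -> : cmul (cmul (m - l) (m - conjp l)) (ceval m (lin a2 b2)) =
     ceval m f + - ceval m (lin a1 b1) by rewrite Em addrK.
  apply: (@le_trans _ _ ((2 * t + 2 * n2 (ceval m (lin a1 b1))) * eta ^+ 2)).
    rewrite ler_wpM2r ?(ltW eta2)// (le_trans (n2D_le _ _))// n2N; lra.
  have : t * eta ^+ 2 <= t by rewrite ler_piMr.
  by lra.
have conj_far : 2 * eta ^+ 2 <= n2 (m - conjp l).
  have := sqe _ el; have := sqe _ em; rewrite /n2 /conjp/= opprK.
  by have := sqr_ge0 (m.1 - l.1); rewrite [(m.2 + l.2) ^+ 2]sqrrD; lra.
have lower : n2 (l - m) * (2 * eta ^+ 2) * t0 * eta ^+ 2 <= 22 * t.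
  apply: le_trans prod_le; rewrite -n2N opprB ler_wpM2r ?(ltW eta2)//.
  apply: ler_pM => //; first by apply: mulr_ge0; [exact: n2_ge0 | lra].
    exact: ltW.
  by apply: ler_wpM2l => //; exact: n2_ge0.
rewrite mulrAC ler_pdivlMr ?mulr_gt0//.
by move: lower; rewrite /t0; lra.
Qed.

End Eval.

(** * Energy *)

Section Measurability.
Variable R : realType.

Lemma measurable_cpow k :
  measurable_fun [set: R * R] (fun l : R * R => (cpow l k).1) /\
  measurable_fun [set: R * R] (fun l : R * R => (cpow l k).2).
Proof.
elim: k => [|k [IH1 IH2]]; first by split; exact: measurable_cst.
by split => /=; [apply: measurable_funB | apply: measurable_funD];
  apply: measurable_funM => //; (exact: measurable_fst || exact: measurable_snd).
Qed.

Lemma measurable_ceval_aux (p : {poly R}) (n : nat) :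
  measurable_fun [set: R * R] (fun l : R * R => (ceval (cpow l n) p).1) /\
  measurable_fun [set: R * R] (fun l : R * R => (ceval (cpow l n) p).2).
Proof.
have [m1 m2] := measurable_cpow n.
elim/poly_ind: p => [|p c [IH1 IH2]].
  by split; under eq_fun => l do rewrite -(polyC0 R) cevalC; exact: measurable_cst.
by split; under eq_fun => l do rewrite mulrC cevalD cevalX cevalC /cmul /=;
  apply: measurable_funD => //=;
  [apply: measurable_funB | apply: measurable_funD]; exact: measurable_funM.
Qed.

Lemma measurable_n2_ceval (p : {poly R}) k :
  measurable_fun [set: R * R] (fun l : R * R => n2 (ceval (cpow l k) p)).
Proof.
have [m1 m2] := measurable_ceval_aux p k.
by rewrite /n2; apply: measurable_funD; exact: measurable_funX.
Qed.

Lemma L2_square_le (E : set (R * R)) (a b s : R) : 0 <= s -> measurable E ->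
  (forall l, E l -> `|l.1 - a| <= s /\ `|l.2 - b| <= s) ->
  (L2 E <= ((2 * s) ^+ 2)%:E)%E.
Proof.
move=> s0 mE Es.
have itvE (c : R) : lebesgue_measure (`[c - s, c + s]%classic : set R) = (2 * s)%:E.
  rewrite lebesgue_measure_itv/= lte_fin; case: ltP => h.
    by rewrite -EFinB; congr EFin; ring.
  by congr EFin; lra.
apply: (@le_trans _ _ (L2 (`[a - s, a + s]%classic `*` `[b - s, b + s]%classic))).
  apply: le_measure; rewrite ?inE//; first exact: measurableX.
  move=> l /Es [la lb]; split; rewrite /= in_itv/=.
    by move: la; rewrite ler_norml; lra.
  by move: lb; rewrite ler_norml; lra.
rewrite /L2 product_measure1E// expr2 EFinM.
by apply: lee_pmul; rewrite ?measure_ge0// le_eqVlt; apply/orP; left; apply/eqP;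
  exact: itvE.
Qed.

End Measurability.

Lemma sum2_cat_map (R : nmodType) (T : Type) (s : seq T) (f g : T -> T)
    (F : T -> T -> R) :
  let D (u v : T -> T) := \sum_(p <- s) \sum_(q <- s) F (u p) (v q) in
  \sum_(p <- map f s ++ map g s) \sum_(q <- map f s ++ map g s) F p q =
  D f f + D f g + (D g f + D g g).
Proof.
move=> D; rewrite big_cat/= !big_map.
by congr (_ + _); rewrite -big_split; apply: eq_bigr => p _; rewrite big_cat/= !big_map.
Qed.

(** * Energy over one piece of the parameter plane *)

Section Energy.
Variables (R : realType) (k : nat) (K : set (R * R)) (rho kap eta A : R).
Notation th l := (cpow l k).
Hypothesis mK : measurable K.
Hypothesis rho2 : 1 / 2 < rho.
Hypothesis kap01 : 0 < kap < 1.
Hypothesis kapJ : 5 * kap ^+ 4 < (4 / 5) ^+ 4.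
Hypothesis eta01 : 0 < eta <= 1.
Hypothesis A0 : 0 <= A.
Hypothesis K1 : forall l, K l -> n2 l <= 1.
Hypothesis Kth : forall l, K l -> rho <= n2 (th l) <= kap.
Hypothesis Keta : forall l, K l -> eta <= `|(th l).2|.
Hypothesis Ksgn : forall l m, K l -> K m -> 0 < (th l).2 * (th m).2.
Hypothesis Kexp : forall l m, K l -> K m -> n2 (l - m) <= A * n2 (th l - th m).

Definition sublevel (f : {poly R}) (t : R) : set (R * R) :=
  K `&` [set l | n2 (ceval (th l) f) <= t].

Lemma measurable_sublevel f t : measurable (sublevel f t).
Proof.
apply: measurableI => //; rewrite -[X in measurable X]setTI.
apply: measurable_fun_le => //; exact: measurable_n2_ceval.
Qed.

Lemma n2_coord_le (l : R * R) (s : R) : 0 <= s -> n2 l <= s ^+ 2 ->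
  `|l.1| <= s /\ `|l.2| <= s.
Proof.
move=> s0 ls.
have h (x : R) : x ^+ 2 <= s ^+ 2 -> `|x| <= s.
  by move=> xs; rewrite -(@ler_pXn2r _ 2)// ?nnegrE// real_normK ?num_real.
have := sqr_ge0 l.1; have := sqr_ge0 l.2; move: ls; rewrite /n2 => ls ? ?.
by split; apply: h; lra.
Qed.

Lemma L2_sublevel_le4 f t : (L2 (sublevel f t) <= 4%:E)%E.
Proof.
have -> : 4 = (2 * 1) ^+ 2 :> R by lra.
apply: (@L2_square_le _ _ 0 0) => //; first exact: measurable_sublevel.
move=> l [/K1 l1 _]; rewrite !subr0; apply: n2_coord_le => //.
by rewrite expr1n.
Qed.

Definition area f t : R := fine (L2 (sublevel f t)).

Lemma areaE f t : (area f t)%:E = L2 (sublevel f t).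
Proof.
rewrite /area fineK//; rewrite ge0_fin_numE ?measure_ge0//.
exact: le_lt_trans (L2_sublevel_le4 f t) (ltry _).
Qed.

Lemma area_le4 f t : area f t <= 4.
Proof. by rewrite -lee_fin areaE L2_sublevel_le4. Qed.

Lemma area_le f g t s : (forall l, K l -> n2 (ceval (th l) f) <= t ->
  n2 (ceval (th l) g) <= s) -> area f t <= area g s.
Proof.
move=> fg; rewrite -lee_fin !areaE; apply: le_measure;
  rewrite ?inE; try exact: measurable_sublevel.
by move=> l [Kl /= /(fg _ Kl)].
Qed.

(** Two points of a sublevel set have powers at squared distance at most [C * t], which [Kexp] pulls
    back to [K]; a square around any one point then contains the set. The summand 1 only keeps the
    constant positive. *)
Lemma area_transversal : exists2 C : R, 0 < C & forall (f : {poly R}) (t : R),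
  (forall i, `|f`_i| <= 1) -> f`_0 = 1 -> 0 <= t -> area f t <= C * t.
Proof.
have [C C0 Cs] := approx_zeros_close kap01 kapJ eta01.
exists (4 * A * C + 1); first by rewrite ltr_wpDl// !mulr_ge0// ltW.
move=> f t f1 f0 t0; rewrite -lee_fin areaE.
have Ct0 : 0 <= A * (C * t) by rewrite !mulr_ge0// ltW.
apply: (@le_trans _ _ ((2 * Num.sqrt (A * (C * t))) ^+ 2)%:E); last first.
  by rewrite lee_fin exprMn sqr_sqrtr//; nra.
have [->|/set0P[l0 [Kl0 fl0]]] := eqVneq (sublevel f t) set0.
  by rewrite /L2 measure0 lee_fin sqr_ge0.
apply: (@L2_square_le _ _ l0.1 l0.2); first exact: sqrtr_ge0.
  exact: measurable_sublevel.
move=> l [Kl fl]; apply: (@n2_coord_le (l - l0)); first exact: sqrtr_ge0.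
rewrite sqr_sqrtr// (le_trans (Kexp Kl Kl0))// ler_wpM2l//.
have [/andP[_ k1] /andP[_ k2]] := (Kth Kl, Kth Kl0).
exact: (Cs f _ _ t f1 f0 (Ksgn Kl Kl0) (Keta Kl) (Keta Kl0)).
Qed.

(** The constant sign is split off first, so that two members with equal constant terms differ by
    ['X] times a shorter difference. *)
Fixpoint sgnpoly (N : nat) : seq {poly R} :=
  if N is n.+1 then [seq 1 + 'X * p | p <- sgnpoly n] ++ [seq - 1 + 'X * p | p <- sgnpoly n]
  else [:: 0].

Lemma size_sgnpoly N : size (sgnpoly N) = (2 ^ N)%N.
Proof. by elim: N => //= N IH; rewrite size_cat !size_map IH expnS; lia. Qed.

Lemma sgnpoly_coef N p i : p \in sgnpoly N -> `|p`_i| <= 1.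
Proof.
elim: N p i => [|N IH] p i /=.
  by rewrite inE => /eqP ->; rewrite coef0 normr0.
by rewrite mem_cat => /orP[] /mapP[q qN ->]; rewrite coefD ?coefN coefC coefXM;
  case: i => [|i]/=; rewrite ?addr0 ?oppr0 ?add0r ?normrN ?normr1// IH.
Qed.

Definition pair_energy N (t : R) : R :=
  \sum_(p <- sgnpoly N) \sum_(q <- sgnpoly N) area (p - q) t.

Lemma area_X p t : 0 <= t -> area ('X * p) t <= area p (t / rho).
Proof.
move=> t0; apply: area_le => l Kl; rewrite cevalX n2M => h.
have rho0 : 0 < rho by apply: lt_trans rho2; rewrite divr_gt0.
rewrite ler_pdivlMr// (le_trans _ h)// mulrC ler_wpM2r ?n2_ge0//.
by have /andP[] := Kth Kl.
Qed.

(** Equal constant terms leave ['X * (p - q)], and removing ['X] divides the threshold by [rho].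
    Opposite ones leave [2 + 'X * (p - q)] up to sign; half of it has constant term 1 and
    coefficients in [-1, 1], so the transversality bound applies. *)
Lemma pair_energyS N (t : R) (C : R) : 0 <= t ->
  (forall (f : {poly R}) (t : R), (forall i, `|f`_i| <= 1) -> f`_0 = 1 -> 0 <= t -> area f t <= C * t) ->
  pair_energy N.+1 t <= 2 * pair_energy N (t / rho) + 2 * (4 ^+ N * (C * t)).
Proof.
move=> t0 Ct.
have sum_le (F : {poly R} -> {poly R} -> R) :
    {in sgnpoly N &, forall p q, F p q <= C * t} ->
    \sum_(p <- sgnpoly N) \sum_(q <- sgnpoly N) F p q <= 4 ^+ N * (C * t).
  move=> FC; have -> : 4 ^+ N * (C * t) =
      \sum_(p <- sgnpoly N) \sum_(q <- sgnpoly N) (C * t).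
    rewrite !big_const_seq !count_predT size_sgnpoly !iter_addr_0 -!mulrnA.
    by rewrite -[RHS]mulr_natl -expnMn natrX.
  rewrite big_seq [leRHS]big_seq; apply: ler_sum => p pN.
  by rewrite big_seq [leRHS]big_seq; apply: ler_sum => q qN; exact: FC.
have diff : {in sgnpoly N &, forall p q, area (2%:P + 'X * (p - q)) t <= C * t}.
  move=> p q pN qN.
  apply: (@le_trans _ _ (area (1 + 'X * (2^-1 *: (p - q))) t)).
    apply: area_le => l Kl.
    have -> : 2%:P + 'X * (p - q) = 2 *: (1 + 'X * (2^-1 *: (p - q))).
      by rewrite scalerDr -scalerAr scalerA mulfV ?pnatr_eq0// scale1r -alg_polyC.
    set g := 1 + _; rewrite cevalZ => h; apply: le_trans h.
    case: (ceval (th l) g) => u v; rewrite /n2/= !exprMn.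
    by have := sqr_ge0 u; have := sqr_ge0 v; lra.
  apply: Ct => //; last by rewrite coefD coefC coefXM/= addr0.
  case=> [|i]; rewrite coefD coefC coefXM/= ?addr0 ?normr1// add0r coefZ coefB.
  have := sgnpoly_coef i pN; have := sgnpoly_coef i qN.
  by rewrite !ler_norml => /andP[? ?] /andP[? ?]; apply/andP; split; lra.
have area_eq f g s : f = g -> area g t <= s -> area f t <= s by move=> ->.
rewrite {1}/pair_energy /= sum2_cat_map mulrDl !mul1r.
rewrite [leRHS](_ : _ = (pair_energy N (t / rho) + 4 ^+ N * (C * t)) +
   (4 ^+ N * (C * t) + pair_energy N (t / rho))); last by ring.
apply: lerD; apply: lerD.
- apply: ler_sum => p _; apply: ler_sum => q _.
  by apply: (@area_eq _ ('X * (p - q))); [ring | exact: area_X].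
- apply: sum_le => p q pN qN.
  by apply: (@area_eq _ (2%:P + 'X * (p - q))); [ring | exact: diff].
- apply: sum_le => p q pN qN.
  apply: (@area_eq _ (- (2%:P + 'X * (q - p)))); first by ring.
  apply: le_trans (diff _ _ qN pN); apply: area_le => l _.
  by rewrite cevalN n2N.
- apply: ler_sum => p _; apply: ler_sum => q _.
  by apply: (@area_eq _ ('X * (p - q))); [ring | exact: area_X].
Qed.

Lemma pair_energy_le : exists2 C : R, 0 <= C & forall N t, 0 <= t ->
  pair_energy N t <= 4 ^+ N * (C * t) + 2 ^+ N * 4.
Proof.
have [C C0 Ct] := area_transversal.
have rho0 : 0 < rho by apply: lt_trans rho2; rewrite divr_gt0.
have r0 : 0 < 2 * rho - 1 by move: rho2; lra.
(* The solution [D] of [4 * D = 2 * D / rho + 2 * C], for which the recursion reproduces the bound;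
   it is positive because [rho > 1/2]. The term [2^N * 4] carries the initial area through the
   doublings. *)
exists (C * rho / (2 * rho - 1)).
  by rewrite divr_ge0// ltW// mulr_gt0.
elim=> [|N IH] t t0.
  rewrite /pair_energy/= !big_seq1 !expr0 !mul1r.
  by rewrite ler_wpDl ?area_le4// mulr_ge0// ?divr_ge0 ?mulr_ge0 ?ltW.
apply: (le_trans (pair_energyS _ t0 Ct)).
have := IH (t / rho) (divr_ge0 t0 (ltW rho0)).
set P := pair_energy N _.
have -> : 4 ^+ N.+1 * (C * rho / (2 * rho - 1) * t) + 2 ^+ N.+1 * 4 =
  2 * (4 ^+ N * (C * rho / (2 * rho - 1) * (t / rho)) + 2 ^+ N * 4) + 2 * (4 ^+ N * (C * t)).
  by rewrite !exprS; field; rewrite !gt_eqF.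
lra.
Qed.

Definition close_pairs N (t : R) (z : R * R) : R :=
  \sum_(p <- sgnpoly N) \sum_(q <- sgnpoly N) (n2 (ceval z (p - q)) <= t)%R%:R.

Lemma integral_close_pairs N (t : R) :
  (\int[@L2 R]_(l in K) (close_pairs N t (th l))%:E)%E = (pair_energy N t)%:E.
Proof.
have E p q l : K l -> ((n2 (ceval (th l) (p - q)) <= t)%R%:R)%:E =
    (\1_(sublevel (p - q) t) l)%:E :> \bar R.
  move=> Kl; rewrite indicE; congr ((nat_of_bool _)%:R%:E); rewrite /sublevel; apply/idP/idP => h.
    by rewrite mem_set.
  by have := set_mem h => -[].
under eq_integral => l /set_mem Kl.
  rewrite /close_pairs -sumEFin; under eq_bigr => p _.
    rewrite -sumEFin; under eq_bigr => q _ do rewrite E//.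
  over.
over.
have mS p q : measurable_fun K (fun l => (\1_(sublevel (p - q) t) l)%:E : \bar R).
  apply/measurable_EFinP; apply: measurable_indic; exact: measurable_sublevel.
rewrite ge0_integral_sum//; last first.
- by move=> p l _; apply: sume_ge0 => q _; rewrite lee_fin.
- by move=> p; apply: emeasurable_sum => q; exact: mS.
rewrite /pair_energy -sumEFin; apply: eq_bigr => p _.
rewrite ge0_integral_sum//.
  rewrite -sumEFin; apply: eq_bigr => q _.
  rewrite integral_indic//; last exact: measurable_sublevel.
  by rewrite areaE setIC setIA setIid.
by move=> q; exact: mS.
Qed.

Lemma measurable_close_pairs N (t : R) :
  measurable_fun K (fun l => (close_pairs N t (th l))%:E).
Proof.
apply/measurable_EFinP; apply: measurable_sum => p; apply: measurable_sum => q.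
have -> : (fun l : R * R => (n2 (ceval (th l) (p - q)) <= t)%R%:R) =
    \1_[set l | n2 (ceval (th l) (p - q)) <= t] :> (R * R -> R).
  apply/funext => l; rewrite indicE; congr ((nat_of_bool _)%:R); apply/idP/idP => h.
    by rewrite mem_set.
  exact: (set_mem h).
apply: measurable_indic; rewrite -[X in measurable X]setTI.
apply: measurable_fun_le => //; exact: measurable_n2_ceval.
Qed.

(** At scale [2^-n] a proportion of order [4^-n] of the [16^n] pairs of length [2 * n] may be close;
    the [4^n] diagonal pairs fit into the same budget at this length. Only infinitely many [n] are
    asked for, since Fatou's lemma controls a lower limit. *)
Definition bounded_energy (z : R * R) :=
  exists M : R, forall n0, exists2 n : nat, (n0 <= n)%N &
    close_pairs (2 * n) (4 / 4 ^+ n) z <= M * 4 ^+ n.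

Local Notation leb2 := ((@lebesgue_measure R) \x (@lebesgue_measure R))%E.

Lemma ae_bounded_energy : {ae @L2 R, forall l, K l -> bounded_energy (th l)}.
Proof.
rewrite /L2; have [C C0 EC] := pair_energy_le.
pose f n l := ((close_pairs (2 * n) (4 / 4 ^+ n) (th l)) / 4 ^+ n)%:E.
have f0 n l : (0 <= f n l)%E.
  rewrite lee_fin divr_ge0 ?exprn_ge0//.
  by apply: sumr_ge0 => p _; apply: sumr_ge0.
have mf n : measurable_fun K (f n).
  apply/measurable_EFinP; apply: measurable_funM; last exact: measurable_cst.
  by apply/measurable_EFinP; exact: measurable_close_pairs.
have intf n : (\int[leb2]_(l in K) f n l <= (4 * C + 4)%:E)%E.
  rewrite /f; under eq_integral do rewrite mulrC EFinM.
  rewrite ge0_integralZl//; last first.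
  - by move=> l _; rewrite lee_fin; apply: sumr_ge0 => p _; apply: sumr_ge0.
  - exact: measurable_close_pairs.
  rewrite (integral_close_pairs (2 * n)) -EFinM lee_fin ler_pdivrMl ?exprn_gt0//.
  apply: (le_trans (EC _ _ _)); first by rewrite divr_ge0// exprn_ge0.
  rewrite !exprM; have -> : 2 ^+ 2 = 4 :> R by lra.
  have -> : (4 ^+ 2) ^+ n = 4 ^+ n * 4 ^+ n :> R by rewrite -exprM mulnC exprM expr2.
  have q0 : 4 ^+ n != 0 :> R by rewrite expf_neq0.
  by rewrite le_eqVlt; apply/orP; left; apply/eqP; field.
have Fatou := fatou (leb2) mK mf (fun n x _ => f0 n x).
have lim_le : (limn_einf (fun n => \int[leb2]_(l in K) f n l) <= (4 * C + 4)%:E)%E.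
  rewrite limn_einf_lim; apply: lime_le; first exact: is_cvg_einfs.
  apply: nearW => n; apply: le_trans (intf n).
  by apply: ereal_inf_lbound; exists n => //=.
have int_li : (leb2).-integrable K (fun l => limn_einf (f^~ l)).
  apply/integrableP.
  have li0 l : (0 <= limn_einf (f^~ l))%E.
    rewrite limn_einf_lim; apply: lime_ge; first exact: is_cvg_einfs.
    by apply: nearW => n; apply: le_ereal_inf_tmp => _ [m _ <-].
  split; last first.
    under eq_integral do rewrite gee0_abs//.
    by apply: le_lt_trans (le_trans Fatou lim_le) _; exact: ltry.
  apply: (emeasurable_fun_cvg (fun n l => einfs (f^~ l) n)).
    by move=> n; exact: measurable_fun_einfs.
  by move=> l _; rewrite limn_einf_lim; exact: is_cvg_einfs.
have := integrable_ae (_ : measurable _) int_li => /(_ mK).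
apply: negligibleS => l /= + fin; apply => Kl; have {fin} := fin Kl.
(* If every bound [M] fails from some level on, then [f n l] tends to infinity, against the
   finiteness of the lower limit. *)
apply: contraPP => nb; suff -> : limn_einf (f^~ l) = +oo%E by [].
apply: (cvg_limn_einf_sup _).1; apply/cvgeyPge => M.
move/forallNP : nb => /(_ M) /existsNP[n0 h].
exists n0 => // n n0n; rewrite /f lee_fin ler_pdivlMr ?exprn_gt0//.
rewrite leNgt; apply/negP => lt; apply: h; exists n => //; exact: ltW.
Qed.

End Energy.

(** * Local expansion of the power map; powers with zero imaginary part *)

Section PowerMap.
Variable R : realType.
Implicit Types l m : R * R.

(** The quotient of [l^k - m^k] by [l - m], written without division. *)
Fixpoint powdiff l m k : R * R :=
  if k is n.+1 then cmul l (powdiff l m n) + cpow m n else 0.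

Lemma cpow_sub l m k : cpow l k - cpow m k = cmul (l - m) (powdiff l m k).
Proof.
elim: k => [|k IH]; first by rewrite subrr /cmul/= !mulr0 subr0 addr0.
move: IH => /=; case: (cpow l k) (cpow m k) (powdiff l m k) => a b [c d] [e f].
case: l m => l1 l2 [m1 m2]; rewrite /cmul/= => -[E1 E2]; congr pair => /=.
  have -> : a = (l1 - m1) * e - (l2 - m2) * f + c by rewrite -E1; ring.
  have -> : b = (l1 - m1) * f + (l2 - m2) * e + d by rewrite -E2; ring.
  ring.
have -> : a = (l1 - m1) * e - (l2 - m2) * f + c by rewrite -E1; ring.
have -> : b = (l1 - m1) * f + (l2 - m2) * e + d by rewrite -E2; ring.
ring.
Qed.

Lemma powdiff_step l m (u c : R * R) (n : R) :
  cmul l u + cmul m c - ((n + 1) * (cmul m c).1, (n + 1) * (cmul m c).2) =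
  cmul l (u - (n * c.1, n * c.2)) + cmul (l - m) (n * c.1, n * c.2).
Proof.
case: l m u c => l1 l2 [m1 m2] [u1 u2] [c1 c2]; rewrite /cmul/=.
by congr pair => /=; ring.
Qed.

(** The quotient is close to the derivative [(k + 1) * m^k]: each step of its recursion adds an
    error that is a bounded multiple of [l - m]. *)
Lemma powdiff_near k : exists2 E : R, 0 <= E & forall l m, n2 l <= 1 -> n2 m <= 1 ->
  n2 (powdiff l m k.+1 - (k.+1%:R * (cpow m k).1, k.+1%:R * (cpow m k).2))
  <= E * n2 (l - m).
Proof.
elim: k => [|k [E E0 IH]].
  exists 0 => // l m _ _; rewrite mul0r /n2 /cmul/=.
  by rewrite le_eqVlt; apply/orP; left; apply/eqP; ring.
exists (2 * E + 2 * k.+1%:R ^+ 2).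
  by rewrite addr_ge0// mulr_ge0// sqr_ge0.
move=> l m l1 m1; have := IH l m l1 m1.
set u := powdiff l m k.+1; set v := (_, _) => h.
have -> : powdiff l m k.+2 - (k.+2%:R * (cpow m k.+1).1, k.+2%:R * (cpow m k.+1).2)
    = cmul l (u - v) + cmul (l - m) v.
  rewrite /v -(natr1 k.+1); exact: powdiff_step.
apply: (le_trans (n2D_le _ _)); rewrite !n2M [leRHS]mulrDl; apply: lerD.
  rewrite -mulrA ler_wpM2l// (le_trans _ h)// ler_piMl ?n2_ge0//.
rewrite -mulrA ler_wpM2l// mulrC ler_wpM2r ?n2_ge0//.
have -> : n2 v = k.+1%:R ^+ 2 * n2 (cpow m k) by rewrite /n2/=; ring.
by rewrite ler_piMr ?sqr_ge0// n2_pow exprn_ile1 ?n2_ge0.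
Qed.

(** The derivative at [m] has squared modulus at least [|m|^(2k + 2) >= 1/2], so the difference
    quotient keeps squared modulus at least 1/8 for [l] near [m]. *)
Lemma cpow_expansive k : exists2 d : R, 0 < d & forall l m,
  n2 l <= 1 -> n2 m <= 1 -> 1 / 2 <= n2 (cpow m k.+1) ->
  `|l.1 - m.1| <= d -> `|l.2 - m.2| <= d ->
  n2 (l - m) <= 8 * n2 (cpow l k.+1 - cpow m k.+1).
Proof.
have [E E0 H] := powdiff_near k.
have d0 : 0 < (4 * (E + 1))^-1 by rewrite invr_gt0; lra.
exists (4 * (E + 1))^-1 => // l m l1 m1 mk lm1 lm2.
set d := _^-1 in d0 lm1 lm2.
have sq (x : R) : `|x| <= d -> x ^+ 2 <= d ^+ 2.
  by move=> xd; rewrite -real_normK ?num_real// lerXn2r ?nnegrE// ltW.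
have Elm : E * n2 (l - m) <= 1 / 8.
  apply: (@le_trans _ _ (E * (2 * d ^+ 2))).
    by rewrite ler_wpM2l// /n2/=; have := sq _ lm1; have := sq _ lm2; lra.
  have dE : d * (4 * (E + 1)) = 1 by rewrite /d mulVf// gt_eqF//; lra.
  have Ed : 0 <= E * d by rewrite mulr_ge0// ltW.
  have Ed4 : E * d <= 1 / 4 by move: dE; lra.
  have d4 : d <= 1 / 4 by move: dE; lra.
  have -> : E * (2 * d ^+ 2) = 2 * ((E * d) * d) by ring.
  have : E * d * d <= 1 / 4 * (1 / 4) by rewrite ler_pM// ltW.
  lra.
have := H l m l1 m1; rewrite cpow_sub n2M.
set v := (_, _); set S := powdiff _ _ _ => h.
have vge : 1 / 2 <= n2 v.
  have -> : n2 v = k.+1%:R ^+ 2 * n2 (cpow m k) by rewrite /n2/=; ring.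
  apply: (le_trans mk); rewrite !n2_pow exprS.
  rewrite ler_wpM2r ?exprn_ge0 ?n2_ge0//.
  by rewrite (le_trans m1)// exprn_ege1// ler1n.
have : n2 v <= 2 * n2 S + 2 * n2 (S - v).
  by rewrite -{1}[v](subKr S) (le_trans (n2D_le _ _))// n2N.
have lm0 := n2_ge0 (l - m).
move=> vS; have S8 : 1 / 8 <= n2 S by lra.
have : n2 (l - m) * (1 / 8) <= n2 (l - m) * n2 S by rewrite ler_wpM2l.
lra.
Qed.

Lemma poly_roots_finite (p : {poly R}) : p != 0 ->
  exists s : seq R, forall y, root p y -> y \in s.
Proof.
move: {2}(size p) (leqnn (size p)) => n; elim: n p => [|n IH] p.
  by rewrite leqn0 size_poly_eq0 => /eqP ->; rewrite eqxx.
move=> pn p0; have [[y0 ry0]|nr] := pselect (exists y, root p y); last first.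
  by exists [::] => y ry; exfalso; apply: nr; exists y.
have /factor_theorem[q Eq] := ry0.
have q0 : q != 0 by apply: contraNneq p0 => q0; rewrite Eq q0 mul0r.
have qn : (size q <= n)%N.
  by move: pn; rewrite Eq size_Mmonic ?monicXsubC// size_XsubC addn2.
have [s sP] := IH q qn q0; exists (y0 :: s) => y.
by rewrite Eq rootM root_XsubC inE => /orP[/sP ->|->//]; rewrite orbT.
Qed.

(** Real and imaginary parts of [(x + i y)^k] as polynomials in [y], for fixed [x]. *)
Fixpoint vertical_pow (x : R) k : {poly R} * {poly R} :=
  if k is n.+1 then
    let: (a, b) := vertical_pow x n in (x *: a - 'X * b, x *: b + 'X * a)
  else (1, 0).

Lemma vertical_powE x y k :
  cpow (x, y) k = ((vertical_pow x k).1.[y], (vertical_pow x k).2.[y]).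
Proof.
elim: k => [|k IH] /=; first by rewrite hornerC horner0.
rewrite IH /cmul; case: (vertical_pow x k) => a b /=.
by rewrite !(hornerD,hornerN,hornerZ,hornerM,hornerX); congr pair; ring.
Qed.

Lemma vertical_pow_coef x k :
  (vertical_pow x k).1`_0 = x ^+ k /\ (vertical_pow x k).2`_1 = k%:R * x ^+ k.-1.
Proof.
elim: k => [|k] /=; first by rewrite coef1 coef0 mul0r.
case: (vertical_pow x k) => a b /= [a0 b1].
rewrite !(coefD,coefN,coefZ,coefXM)/= a0 b1 subr0 exprS; split=> //.
by case: k {a0 b1} => [|k] /=; rewrite -?natr1 ?exprS; ring.
Qed.

Local Notation leb2 := ((@lebesgue_measure R) \x (@lebesgue_measure R))%E.

Lemma vertical_axis_null : (leb2).-negligible [set l : R * R | l.1 = 0].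
Proof.
exists ([set 0] `*` setT); split.
- exact: measurableX.
- rewrite product_measure1E//.
  transitivity (0 * lebesgue_measure [set: R] : \bar R)%E; last exact: mul0e.
  by congr (_ * _)%E; exact: lebesgue_measure_set1.
- by move=> l /=.
Qed.

(** Integrate over vertical lines. For [x != 0] the coefficient of [y] is [(k + 1) * x^k], so the
    line carries finitely many zeros. On the line [x = 0] the imaginary part may vanish identically;
    that line is excluded here and is itself null. *)
Lemma imaginary_part_vanishes_null k :
  (leb2).-negligible [set l : R * R | (cpow l k.+1).2 = 0 /\ l.1 != 0].
Proof.
set Z := [set l | _].
have mZ : measurable Z.
  have -> : Z = [set l : R * R | (cpow l k.+1).2 = 0] `&` ~` [set l | l.1 = 0].
    by apply/seteqP; split => l /= [? /eqP].
  have me (f : R * R -> R) : measurable_fun setT f -> measurable [set l | f l = 0].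
    move=> mf; rewrite -[X in measurable X]setTI.
    have -> : [set l | f l = 0] = f @^-1` [set 0] by [].
    exact: mf.
  apply: measurableI; first by apply: me; exact: (measurable_cpow _ _).2.
  by apply: measurableC; apply: me; exact: measurable_fst.
exists Z; split => //; rewrite /= /product_measure1; apply: integral0_eq => x _ /=.
have mZx : measurable (xsection Z x) by exact: measurable_xsection.
have [x0|x0] := eqVneq x 0.
  suff -> : xsection Z x = set0 by rewrite measure0.
  by rewrite -subset0 => y /xsectionP[_ /=]; rewrite x0 eqxx.
have b0 : (vertical_pow x k.+1).2 != 0.
  apply/eqP => b0; have := (vertical_pow_coef x k.+1).2; rewrite b0 coef0 => /esym/eqP.
  by rewrite mulf_eq0 pnatr_eq0/= expf_eq0 (negbTE x0) andbF.
have [s sP] := poly_roots_finite b0.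
apply: countable_lebesgue_measure0; apply: finite_set_countable.
apply: (sub_finite_set _ (finite_seq s)) => y /xsectionP[yr _].
have {yr} : (cpow (x, y) k.+1).2 = 0 by [].
by rewrite vertical_powE => yr; apply: sP; apply/eqP.
Qed.

Lemma ae_im_pow_neq0 k : {ae @L2 R, forall l, (cpow l k.+1).2 != 0}.
Proof.
rewrite /L2; apply: (negligibleS _ (negligibleU (imaginary_part_vanishes_null k) vertical_axis_null)).
move=> l /= /negP; rewrite negbK => /eqP l0.
by have [l10|l10] := eqVneq l.1 0; [right|left].
Qed.

End PowerMap.

(** * Countable cover of an annulus by pieces *)

Section Cover.
Variable R : realType.
Notation leb2 := ((@lebesgue_measure R) \x (@lebesgue_measure R))%E.

(** Rational data make the family countable. The sign [s] keeps the powers on one side of the real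
    axis, and the half-width [d / 2] puts any two points within the reach of [cpow_expansive]. *)
Definition piece (k : nat) (d : R) (i : rat * rat * rat * (bool * rat * rat)) :
    set (R * R) :=
  let: (rho, kap, eta, (s, a, b)) := i in
  [set l | [/\ n2 l <= 1, ratr rho <= n2 (cpow l k) <= ratr kap,
     ratr eta <= (-1) ^+ s * (cpow l k).2,
     `|l.1 - ratr a| <= d / 2 & `|l.2 - ratr b| <= d / 2]].

Lemma measurable_piece k d i : measurable (piece k d i).
Proof.
case: i => [[[rho kap] eta] [[s a] b]] /=.
have [m1 m2] := measurable_cpow R k.
have mn : measurable_fun [set: R * R] (fun l : R * R => n2 l).
  by apply: measurable_funD; apply: measurable_funX; [exact: measurable_fst|exact: measurable_snd].
have mnk : measurable_fun [set: R * R] (fun l : R * R => n2 (cpow l k)).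
  by apply: measurable_funD; exact: measurable_funX.
have le (f g : R * R -> R) : measurable_fun setT f -> measurable_fun setT g ->
    measurable [set l | f l <= g l].
  by move=> mf mg; rewrite -[X in measurable X]setTI; exact: measurable_fun_le.
set A := [set l : R * R | _].
have -> : A = [set l | n2 l <= 1] `&` ([set l | ratr rho <= n2 (cpow l k)] `&`
   ([set l | n2 (cpow l k) <= ratr kap] `&`
   ([set l | ratr eta <= (-1) ^+ s * (cpow l k).2] `&`
   ([set l | `|l.1 - ratr a| <= d / 2] `&` [set l | `|l.2 - ratr b| <= d / 2])))).
  apply/seteqP; split => l /=.
    by move=> [? /andP[? ?] ? ? ?].
  by move=> [? [? [? [? []]]]]; split => //; apply/andP; split.
have mabs (f : R * R -> R) (c : R) : measurable_fun setT f ->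
    measurable_fun setT (fun l => `|f l - c|).
  move=> mf; apply: (measurableT_comp (@normr_measurable R setT)).
  exact: measurable_funB.
do 5 ?apply: measurableI; apply: le => //; try exact: mabs.
exact: measurable_funM.
Qed.

Lemma ae_bounded_energy_annulus k : {ae @L2 R, forall l : R * R,
  1 / 2 < n2 l ^+ k.+1 -> 5 * n2 l ^+ (4 * k.+1) < (4 / 5) ^+ 4 ->
  bounded_energy (cpow l k.+1)}.
Proof.
have [d d0 dE] := cpow_expansive R k.
pose good i := let: (rho, kap, eta, _) := i : rat * rat * rat * (bool * rat * rat) in
  [/\ 1 / 2 < (ratr rho : R), 0 < (ratr kap : R) < 1,
      5 * (ratr kap : R) ^+ 4 < (4 / 5) ^+ 4 & 0 < (ratr eta : R) <= 1].
have piece_ae i : good i -> leb2.-negligible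
    [set l | piece k.+1 d i l /\ ~ bounded_energy (cpow l k.+1)].
  case: i => [[[rho kap] eta] [[s a] b]] [rho2 kap01 kapJ eta01].
  have mK := measurable_piece k.+1 d (rho, kap, eta, (s, a, b)).
  have := @ae_bounded_energy R k.+1 _ (ratr rho) (ratr kap) (ratr eta) 8 mK rho2 kap01
    kapJ eta01.
  have Keta l : piece k.+1 d (rho, kap, eta, (s, a, b)) l ->
      ratr eta <= `|(cpow l k.+1).2|.
    move=> [_ _ + _ _]; case: (s); rewrite ?expr1 ?expr0 ?mul1r ?mulN1r => h.
      by rewrite -normrN (le_trans h)// ler_norm.
    by rewrite (le_trans h)// ler_norm.
  have Ksgn l m : piece k.+1 d (rho, kap, eta, (s, a, b)) l ->
     piece k.+1 d (rho, kap, eta, (s, a, b)) m -> 0 < (cpow l k.+1).2 * (cpow m k.+1).2.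
    case/andP: eta01 => e0 _.
    move=> [_ _ + _ _] [_ _ + _ _] => /(lt_le_trans e0) hl /(lt_le_trans e0) hm.
    have := mulr_gt0 hl hm.
    by case: (s); rewrite ?expr1 ?expr0 ?mul1r ?mulN1r ?mulrNN.
  have Kexp l m : piece k.+1 d (rho, kap, eta, (s, a, b)) l ->
     piece k.+1 d (rho, kap, eta, (s, a, b)) m ->
     n2 (l - m) <= 8 * n2 (cpow l k.+1 - cpow m k.+1).
    move=> [l1 _ _ la lb] [m1 /andP[mr _] _ ma mb].
    apply: dE => //; first by apply: le_trans mr; exact: ltW.
      move: la ma; rewrite !ler_norml => /andP[? ?] /andP[? ?].
      by apply/andP; split; lra.
    move: lb mb; rewrite !ler_norml => /andP[? ?] /andP[? ?].
    by apply/andP; split; lra.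
  move=> /(_ (ler0n _ _)) H.
  have := H (fun l h => let: And5 h1 _ _ _ _ := h in h1)
    (fun l h => let: And5 _ h1 _ _ _ := h in h1) Keta Ksgn Kexp.
  by rewrite /L2; apply: negligibleS => l /= [Kl nb] /(_ Kl).
pose N n := if unpickle n is Some i then
   [set l | good i /\ piece k.+1 d i l /\ ~ bounded_energy (cpow l k.+1)] else set0.
have N0 : leb2.-negligible (\bigcup_n N n).
  apply: negligible_bigcup => n; rewrite /N; case: unpickle => [i|]; last first.
    exact: negligible_set0.
  have [gi|ngi] := pselect (good i).
    by apply: negligibleS (piece_ae i gi) => l /= [].
  rewrite [X in negligible _ X](_ : _ = set0); first exact: negligible_set0.
  by rewrite -subset0 => l [].
have := ae_im_pow_neq0 R k; rewrite /L2 => im0.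
apply: (negligibleS _ (negligibleU im0 N0)).
move=> l /= /not_implyP[l2 /not_implyP[l5 nb]].
have [im|im] := eqVneq (cpow l k.+1).2 0; [left|right].
  by apply/negP; rewrite negbK; apply/eqP.
have [rho /andP[rho2 rhol]] : exists r : rat, 1 / 2 < (ratr r : R) < n2 l ^+ k.+1.
  by have [r] := rat_in_itvoo l2; rewrite in_itv/= => ?; exists r.
pose q : R := (4 / 5) ^+ 4 / 5.
have q01 : 0 < q < 1.
  by apply/andP; split; [rewrite divr_gt0// exprn_gt0 |]; rewrite /q; lra.
case/andP: (q01) => q0 q1.
(* The fourth root of [q]: a rational [kap] between [|l|^(2k + 2)] and [c] satisfies
   [5 * kap^4 < (4/5)^4]. *)
pose c : R := Num.sqrt (Num.sqrt q).
have c4 : c ^+ 4 = q.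
  have -> : c ^+ 4 = (c ^+ 2) ^+ 2 by rewrite -exprM.
  by rewrite /c sqr_sqrtr ?sqrtr_ge0// sqr_sqrtr// ltW.
have c0 : 0 <= c by exact: sqrtr_ge0.
have lc : n2 l ^+ k.+1 < c.
  rewrite -(@ltr_pXn2r _ 4)// ?nnegrE ?exprn_ge0 ?n2_ge0// c4.
  by rewrite -exprM mulnC /q; lra.
have c1 : c < 1.
  by rewrite -(@ltr_pXn2r _ 4)// ?nnegrE// c4 expr1n.
have [kap /andP[lkap kapc]] : exists r : rat, n2 l ^+ k.+1 < (ratr r : R) < c.
  by have [r] := rat_in_itvoo lc; rewrite in_itv/= => ?; exists r.
have kap4 : (ratr kap : R) ^+ 4 < q.
  rewrite -c4 ltr_pXn2r// ?nnegrE//.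
  by rewrite ltW// (le_lt_trans _ lkap)// exprn_ge0// n2_ge0.
have [eta /andP[eta0 etam]] : exists r : rat,
    0 < (ratr r : R) < Num.min 1 `|(cpow l k.+1).2|.
  have m0 : 0 < Num.min 1 `|(cpow l k.+1).2| by rewrite lt_min ltr01 normr_gt0.
  by have [r] := rat_in_itvoo m0; rewrite in_itv/= => ?; exists r.
have near (x : R) : exists r : rat, `|x - ratr r| <= d / 2.
  have h : x - d / 2 < x + d / 2 by lra.
  have [r] := rat_in_itvoo h; rewrite in_itv/= => /andP[? ?]; exists r.
  by rewrite ler_norml; apply/andP; split; lra.
have [a la] := near l.1; have [b lb] := near l.2.
move: etam; rewrite lt_min => /andP[eta1 etal].
pose i := (rho, kap, eta, ((cpow l k.+1).2 < 0, a, b)).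
suff Ni : N (pickle i) l by exact: (ex_intro2 _ _ (pickle i) I Ni).
rewrite /N pickleK; split; last (split; last exact: nb).
  split=> //; last by rewrite eta0 ltW.
    apply/andP; split; last exact: lt_trans c1.
    by rewrite (le_lt_trans _ lkap)// exprn_ge0// n2_ge0.
  by move: kap4; rewrite /q; lra.
have l1 : n2 l <= 1.
  rewrite leNgt; apply/negP => l1; move: l5; apply/negP; rewrite -leNgt.
  have : 1 <= n2 l ^+ (4 * k.+1) by rewrite exprn_ege1// ltW.
  by lra.
split => //; first by rewrite n2_pow !ltW.
rewrite (le_trans (ltW etal))//.
have [im_lt0|im_ge0] := ltP (cpow l k.+1).2 0.
  by rewrite expr1 mulN1r ltr0_norm.
by rewrite expr0 mul1r ger0_norm.
Qed.

End Cover.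

(** * Positive semidefinite kernels *)

Section SignSums.
Variable R : realType.
Implicit Types (v w : seq (R * R)) (F G : R * R -> R) (z : R * R).

Fixpoint sign_sums v : seq (R * R) :=
  if v is a :: v' then
    [seq a + x | x <- sign_sums v'] ++ [seq - a + x | x <- sign_sums v']
  else [:: 0].

(** The expectation of [F] at the sum of the vectors of [v] with independent fair signs; the list
    keeps repetitions, so coinciding sums retain their weight. *)
Definition avg v F : R := (\sum_(x <- sign_sums v) F x) / 2 ^+ size v.

Lemma avg_nil F : avg [::] F = F 0.
Proof. by rewrite /avg big_seq1 expr0 divr1. Qed.

Lemma avg_cons a v F :
  avg (a :: v) F = (avg v (fun x => F (a + x)) + avg v (fun x => F (- a + x))) / 2.
Proof.
rewrite /avg big_cat !big_map exprS invfM.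
by rewrite -mulrDl -[RHS]mulrA; congr (_ * _); rewrite mulrC.
Qed.

Lemma eq_avg v F G : F =1 G -> avg v F = avg v G.
Proof. by move=> FG; rewrite /avg; congr (_ / _); apply: eq_bigr => x _; rewrite FG. Qed.

Lemma avgZ v c F : avg v (fun x => c * F x) = c * avg v F.
Proof. by rewrite /avg -mulr_sumr mulrA. Qed.

Lemma avgB v F G : avg v (fun x => F x - G x) = avg v F - avg v G.
Proof. by rewrite /avg sumrB mulrBl. Qed.

Lemma size_sign_sums v : size (sign_sums v) = (2 ^ size v)%N.
Proof. by elim: v => //= a v IH; rewrite size_cat !size_map IH expnS; lia. Qed.

Lemma avg_cst v c : avg v (fun=> c) = c.
Proof.
rewrite /avg big_const_seq count_predT size_sign_sums iter_addr_0.
by rewrite -[_ *+ (2 ^ _)]mulr_natr natrX mulfK// expf_neq0.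
Qed.

Lemma avg_le_mem v F G : {in sign_sums v, forall x, F x <= G x} -> avg v F <= avg v G.
Proof.
move=> FG; rewrite /avg ler_wpM2r ?invr_ge0 ?exprn_ge0//.
by rewrite big_seq [leRHS]big_seq; apply: ler_sum => x /FG.
Qed.

Lemma avg_le v F G : (forall x, F x <= G x) -> avg v F <= avg v G.
Proof. by move=> FG; apply: avg_le_mem => x _; exact: FG. Qed.

Lemma avg_norm_le v F (c : R) :
  {in sign_sums v, forall x, `|F x| <= c} -> `|avg v F| <= c.
Proof.
move=> Fc; have -> : c = avg v (fun=> c) by rewrite avg_cst.
rewrite ler_norml; apply/andP; split; last first.
  by apply: avg_le_mem => x /Fc; rewrite ler_norml => /andP[].
rewrite -mulN1r -avgZ; apply: avg_le_mem => x /Fc.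
by rewrite mulN1r ler_norml => /andP[].
Qed.

Lemma avg_cat v w F : avg (v ++ w) F = avg v (fun x => avg w (fun y => F (x + y))).
Proof.
elim: v F => [|a v IH] F /=.
  by rewrite avg_nil; apply: eq_avg => y; rewrite add0r.
rewrite !avg_cons !IH; congr ((_ + _) / _); apply: eq_avg => x;
  by apply: eq_avg => y; rewrite addrA.
Qed.

Lemma avg_exchange v w (F : R * R -> R * R -> R) :
  avg v (fun x => avg w (F x)) = avg w (fun y => avg v (fun x => F x y)).
Proof.
rewrite /avg -!mulr_suml exchange_big/=.
by rewrite mulrAC.
Qed.

Lemma avg_catC v w F : avg (v ++ w) F = avg (w ++ v) F.
Proof.
rewrite !avg_cat avg_exchange; apply: eq_avg => x; apply: eq_avg => y.
by rewrite addrC.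
Qed.

Lemma avg_perm v w F : perm_eq v w -> avg v F = avg w F.
Proof.
elim: v w F => [|a v IH] w F pvw.
  by have /perm_size/= := pvw; case: w {pvw}.
have aw : a \in w by rewrite -(perm_mem pvw) mem_head.
move: pvw; case/splitPr: aw => w1 w2 pvw.
rewrite avg_catC /= !avg_cons.
have p : perm_eq v (w2 ++ w1).
  rewrite -(perm_cons a) (perm_trans pvw)// -cat_cons.
  by rewrite perm_catC.
by rewrite !(IH _ _ p).
Qed.

Lemma avg_opp v F : avg v (fun x => F (- x)) = avg v F.
Proof.
elim: v F => [|a v IH] F; first by rewrite !avg_nil oppr0.
rewrite !avg_cons -(IH (fun x => F (a + x))) -(IH (fun x => F (- a + x))).
rewrite addrC; congr ((_ + _) / _); apply: eq_avg => x.
  by rewrite opprD opprK.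
by rewrite opprD.
Qed.

Lemma sign_sums_norm v x : x \in sign_sums v -> `|x| <= \sum_(a <- v) `|a|.
Proof.
elim: v x => [|a v IH] x /=.
  by rewrite inE => /eqP ->; rewrite normr0 big_nil.
rewrite mem_cat big_cons => /orP[] /mapP[y /IH yv ->];
  by rewrite (le_trans (ler_normD _ _))// ?normrN lerD2l.
Qed.

Definition lip (L : R) F := forall x y, `|F x - F y| <= L * `|x - y|.

Lemma avg_cat_lip v w F L : 0 <= L -> lip L F ->
  `|avg (v ++ w) F - avg v F| <= L * \sum_(a <- w) `|a|.
Proof.
move=> L0 FL; rewrite avg_cat -avgB; apply: avg_norm_le => x _.
rewrite -[X in _ - X](avg_cst w) -avgB; apply: avg_norm_le => y /sign_sums_norm yw.
apply: (le_trans (FL _ _)); rewrite ler_wpM2l//.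
by rewrite addrAC subrr add0r.
Qed.

Lemma map_cmul_sign_sums l v :
  map (cmul l) (sign_sums v) = sign_sums (map (cmul l) v).
Proof.
elim: v => [|a v IH] /=; first by rewrite /cmul/= !mulr0 subr0 addr0.
rewrite map_cat -!map_comp -IH -!map_comp; congr (_ ++ _); apply: eq_map => x /=.
  by rewrite /cmul /=; congr pair => /=; ring.
by rewrite /cmul /=; congr pair => /=; ring.
Qed.

(** Both lists split off the constant sign first, so they agree even in order; counts of polynomial
    pairs thereby become averages over sign sums. *)
Lemma ceval_sgnpoly z N :
  map (ceval z) (sgnpoly R N) = sign_sums (mkseq (cpow z) N).
Proof.
elim: N => [|N IH]; first by rewrite /= -(polyC0 R) cevalC.
have -> : mkseq (cpow z) N.+1 = (1, 0) :: map (cmul z) (mkseq (cpow z) N).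
  rewrite /mkseq /=; congr (_ :: _).
  by have := iotaDl 1 0 N; rewrite addn0 => ->; rewrite -!map_comp.
rewrite /= -map_cmul_sign_sums -IH map_cat -!map_comp.
congr (_ ++ _); apply: eq_map => p /=; rewrite cevalD cevalX.
  by rewrite (cevalC z 1).
by rewrite cevalN (cevalC z 1).
Qed.

End SignSums.

(** * Tents and the calculus of positive semidefinite kernels *)

Section Kernel.
Variable R : realType.
Implicit Types (k F : R * R -> R) (z h : R * R).

Definition tri (y : R) : R := Num.max 0 (1 - `|y|).

Lemma tri_ge0 y : 0 <= tri y. Proof. by rewrite /tri le_max lexx. Qed.

Lemma triN y : tri (- y) = tri y. Proof. by rewrite /tri normrN. Qed.

Lemma tri_le1 y : tri y <= 1.
Proof. by rewrite /tri ge_max ler01/= lerBlDr lerDl. Qed.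

Lemma tri_eq0 y : 1 <= `|y| -> tri y = 0.
Proof. by move=> y1; rewrite /tri; apply/max_idPl; rewrite subr_le0. Qed.

(** The two-scale relation of the hat function: both sides are even, linear between consecutive
    integers, and equal at the integers. *)
Lemma tri_refine y : tri (y / 2) = (tri (y - 1) + 2 * tri y + tri (y + 1)) / 2.
Proof.
have triE (u : R) : 0 <= u <= 1 -> tri u = 1 - u.
  by move=> /andP[u0 u1]; rewrite /tri ger0_norm//; apply/max_idPr; rewrite subr_ge0.
have tri0 (u : R) : 1 <= u -> tri u = 0.
  by move=> u1; apply: tri_eq0; rewrite ger0_norm//; lra.
wlog y0 : y / 0 <= y => [hw|].
  have [/hw//|y0] := leP 0 y.
  have := hw (- y); rewrite oppr_ge0 ltW// => /(_ isT).
  have -> : - y - 1 = - (y + 1) by ring.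
  have -> : - y + 1 = - (y - 1) by ring.
  by rewrite mulNr !triN => ->; congr (_ / _); ring.
have [y1|y1] := leP y 1.
  by rewrite -(triN (y - 1)) opprB (tri0 (y + 1)) ?lerDr// !triE; lra.
rewrite (tri0 (y + 1)) ?lerDr// (tri0 y) ?ltW//.
have [y2|y2] := leP y 2.
  rewrite !triE; [lra| |]; apply/andP; split; lra.
by rewrite !tri0; lra.
Qed.

Lemma tri_lip x y : `|tri x - tri y| <= `|x - y|.
Proof.
have maxl (a b : R) : `|Num.max 0 a - Num.max 0 b| <= `|a - b|.
  rewrite ler_norml; case: (ger0P (a - b)) => ab;
    case: (ltP 0 a) => a0; case: (ltP 0 b) => b0; apply/andP; split; lra.
apply: (le_trans (maxl _ _)).
have -> : 1 - `|x| - (1 - `|y|) = `|y| - `|x| by ring.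
by rewrite distrC ler_dist_dist.
Qed.

Definition tent n (x : R) : R := 2 ^+ n * tri (2 ^+ n * x).

Lemma tent_refine n x : tent n.+1 x - tent n x =
  (2 * tent n.+1 x - tent n.+1 (x - 2 ^- n.+1) - tent n.+1 (x + 2 ^- n.+1)) / 4.
Proof.
have n0 : 2 ^+ n.+1 != 0 :> R by rewrite expf_neq0.
have E : 2 ^+ n * x = 2 ^+ n.+1 * x / 2 by rewrite exprS; field.
have e1 : 2 ^+ n.+1 * (x - 2 ^- n.+1) = 2 ^+ n.+1 * x - 1 by rewrite mulrBr mulfV.
have e2 : 2 ^+ n.+1 * (x + 2 ^- n.+1) = 2 ^+ n.+1 * x + 1 by rewrite mulrDr mulfV.
rewrite /tent e1 e2 E tri_refine; set X := 2 ^+ n.+1 * x.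
by rewrite exprS; field.
Qed.

Lemma tentN n x : tent n (- x) = tent n x.
Proof. by rewrite /tent mulrN triN. Qed.

Lemma tent_ge0 n x : 0 <= tent n x.
Proof. by rewrite mulr_ge0 ?tri_ge0 ?exprn_ge0. Qed.

Lemma tent_le n x : tent n x <= 2 ^+ n.
Proof. by rewrite ler_piMr ?tri_le1 ?exprn_ge0. Qed.

Lemma tent_eq0 n x : 2 ^- n <= `|x| -> tent n x = 0.
Proof.
move=> nx; rewrite /tent tri_eq0 ?mulr0// normrM ger0_norm ?exprn_ge0//.
by rewrite mulrC -ler_pdivrMr ?exprn_gt0// mul1r.
Qed.

Lemma tent_lip n x y : `|tent n x - tent n y| <= 4 ^+ n * `|x - y|.
Proof.
rewrite /tent -mulrBr normrM [`|2 ^+ n|]ger0_norm ?exprn_ge0//.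
have -> : 4 ^+ n = 2 ^+ n * 2 ^+ n :> R by rewrite -exprMn; congr (_ ^+ _); lra.
rewrite -mulrA ler_wpM2l ?exprn_ge0// (le_trans (tri_lip _ _))//.
by rewrite -mulrBr normrM ger0_norm ?exprn_ge0.
Qed.

Definition tent_prod n m z : R := tent n z.1 * tent m z.2.

Definition psd k := forall s : seq (R * (R * R)),
  0 <= \sum_(a <- s) \sum_(b <- s) a.1 * b.1 * k (a.2 - b.2).

Lemma eq_psd k F : k =1 F -> psd k -> psd F.
Proof.
move=> kF pk s; rewrite [leRHS](_ : _ = \sum_(a <- s) \sum_(b <- s) a.1 * b.1 * k (a.2 - b.2)) //.
by apply: eq_bigr => a _; apply: eq_bigr => b _; rewrite kF.
Qed.

Lemma psdD k F : psd k -> psd F -> psd (fun z => k z + F z).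
Proof.
move=> pk pF s; under eq_bigr => a _ do under eq_bigr => b _ do rewrite mulrDr.
by under eq_bigr => a _ do rewrite big_split/=; rewrite big_split addr_ge0.
Qed.

Lemma psdZ (c : R) k : 0 <= c -> psd k -> psd (fun z => c * k z).
Proof.
move=> c0 pk s; under eq_bigr => a _ do under eq_bigr => b _ do rewrite mulrCA.
by under eq_bigr => a _ do rewrite -mulr_sumr; rewrite -mulr_sumr mulr_ge0.
Qed.

(** Test [k] on the weighted points minus their translates by [h]; the four blocks of the form add
    up to the second difference. *)
Lemma psd_second_difference k h : psd k ->
  psd (fun z => 2 * k z - k (z - h) - k (z + h)).
Proof.
move=> pk s.
have := pk ([seq id a | a <- s] ++ [seq (- a.1, a.2 + h) | a <- s]).
rewrite sum2_cat_map/= -!big_split/=.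
congr (_ <= _); apply: eq_bigr => a _; rewrite -!big_split/=; apply: eq_bigr => b _.
have -> : a.2 - (b.2 + h) = a.2 - b.2 - h by rewrite opprD addrA.
have -> : a.2 + h - b.2 = a.2 - b.2 + h by rewrite addrAC.
have -> : a.2 + h - (b.2 + h) = a.2 - b.2 by rewrite opprD addrACA subrr addr0.
ring.
Qed.

(** A nonnegative step function has a nonnegative integral; the positive and negative parts of the
    coefficients are integrated separately and compared. *)
Lemma indic_combination_ge0 (I : Type) (t : seq I) (c m : I -> R) (A : I -> set R) :
  (forall i, measurable (A i)) -> (forall i, lebesgue_measure (A i) = (m i)%:E) ->
  (forall s, 0 <= \sum_(i <- t) c i * \1_(A i) s) ->
  0 <= \sum_(i <- t) c i * m i.
Proof.
move=> mA mE pos.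
pose cp i := Num.max 0 (c i); pose cm i := Num.max 0 (- c i).
have cpm i : c i = cp i - cm i.
  by rewrite /cp /cm /Num.max; do ! case: ltP => ?; lra.
have cp0 i : 0 <= cp i by rewrite /cp le_max lexx.
have cm0 i : 0 <= cm i by rewrite /cm le_max lexx.
have int_comb (d : I -> R) : (forall i, 0 <= d i) ->
   (\int[@lebesgue_measure R]_s (\sum_(i <- t) d i * \1_(A i) s)%:E =
     (\sum_(i <- t) d i * m i)%:E)%E.
  move=> d0; under eq_integral do rewrite -sumEFin.
  rewrite ge0_integral_sum//.
  - rewrite -sumEFin; apply: eq_bigr => i _.
    under eq_integral do rewrite EFinM.
    rewrite ge0_integralZl// ?lee_fin//; last first.
      by apply/measurable_EFinP; apply: measurable_indic; exact: mA.
    rewrite integral_indic//; last exact: mA.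
    by rewrite setIT EFinM; congr (_ * _)%E; exact: mE.
  - move=> i; apply/measurable_EFinP; apply: measurable_funM => //.
    by apply: measurable_indic; exact: mA.
  - by move=> i s _; rewrite lee_fin mulr_ge0.
have : ((\sum_(i <- t) cm i * m i)%:E <= (\sum_(i <- t) cp i * m i)%:E)%E.
  rewrite -!int_comb//; apply: ge0_le_integral => //.
  - by move=> s _; rewrite lee_fin; apply: sumr_ge0 => i _; rewrite mulr_ge0.
  - apply/measurable_EFinP; apply: measurable_sum => i; apply: measurable_funM => //.
    by apply: measurable_indic; exact: mA.
  - apply/measurable_EFinP; apply: measurable_sum => i; apply: measurable_funM => //.
    by apply: measurable_indic; exact: mA.
  - move=> s _; rewrite lee_fin -subr_ge0 -sumrB; have := pos s.
    congr (_ <= _); apply: eq_bigr => i _; rewrite -mulrBl; congr (_ * _); exact: cpm.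
rewrite lee_fin -subr_ge0 -sumrB; congr (_ <= _).
by apply: eq_bigr => i _; rewrite -mulrBl; congr (_ * _); rewrite -cpm.
Qed.

Lemma length_unit_itvI (x y : R) :
  lebesgue_measure (`[x, x + 1] `&` `[y, y + 1] : set R) = (tri (x - y))%:E.
Proof.
wlog xy : x y / x <= y => [hw|].
  have [/hw//|/ltW yx] := leP x y; by rewrite setIC -triN opprB hw.
have -> : (`[x, x + 1] `&` `[y, y + 1] : set R) = `[y, x + 1]%classic.
  apply/seteqP; split => z /=; rewrite !in_itv/=.
    by move=> [/andP[? ?] /andP[? ?]]; apply/andP; split.
  by move=> /andP[? ?]; split; apply/andP; split => //; lra.
rewrite lebesgue_measure_itv/= lte_fin /tri ler0_norm ?subr_le0// opprB.
have -> : 1 - (y - x) = x + 1 - y by ring.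
by rewrite /Num.max subr_gt0; case: ifP => // _; rewrite -EFinB.
Qed.

(* [tri (x - y)] is the length of [[x, x + 1] `&` [y, y + 1]], so multiplying by
   it writes a kernel as an integral of positive semidefinite ones. *)
Lemma psd_tri (phi : R * R -> R) k : (forall x y, phi (x - y) = phi x - phi y) ->
  psd k -> psd (fun z => tri (phi z) * k z).
Proof.
move=> phiB pk s.
pose A (p : (R * (R * R)) * (R * (R * R))) : set R :=
  `[phi p.1.2, phi p.1.2 + 1] `&` `[phi p.2.2, phi p.2.2 + 1].
pose c (p : (R * (R * R)) * (R * (R * R))) := p.1.1 * p.2.1 * k (p.1.2 - p.2.2).
have := @indic_combination_ge0 _ [seq (a, b) | a <- s, b <- s] c
  (fun p => tri (phi (p.1.2 - p.2.2))) A.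
rewrite !big_allpairs.
have -> : \sum_(a <- s) \sum_(b <- s) c (a, b) * tri (phi ((a, b).1.2 - (a, b).2.2)) =
   \sum_(a <- s) \sum_(b <- s) a.1 * b.1 * (tri (phi (a.2 - b.2)) * k (a.2 - b.2)).
  by apply: eq_bigr => a _; apply: eq_bigr => b _; rewrite /c/=; ring.
apply.
- by move=> p; apply: measurableI.
- by move=> [a b]; rewrite /A/= phiB length_unit_itvI.
- move=> u; rewrite big_allpairs.
  (* At a fixed [u] only the points whose interval contains [u] keep their weight. *)
  have := pk [seq (a.1 * \1_(`[phi a.2, phi a.2 + 1]%classic : set R) u, a.2) | a <- s].
  rewrite big_map; under eq_bigr => a _ do rewrite big_map/=.
  congr (_ <= _); apply: eq_bigr => a _; apply: eq_bigr => b _.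
  by rewrite /c/= /A/= indicI/=; ring.
Qed.

End Kernel.

Lemma sum2_cat (R : nmodType) (T : Type) (s t : seq T) (F : T -> T -> R) :
  \sum_(p <- s ++ t) \sum_(q <- s ++ t) F p q =
  \sum_(p <- s) \sum_(q <- s) F p q + \sum_(p <- s) \sum_(q <- t) F p q +
  (\sum_(p <- t) \sum_(q <- s) F p q + \sum_(p <- t) \sum_(q <- t) F p q).
Proof.
by rewrite big_cat/=; congr (_ + _); rewrite -big_split; apply: eq_bigr => p _;
  rewrite big_cat.
Qed.

Section SquareTent.
Variable R : realType.
Implicit Types (D F : R * R -> R) (z h : R * R) (v w : seq (R * R)).

Lemma psd_tent_prod n m : psd (@tent_prod R n m).
Proof.
have psd1 : psd (fun _ : R * R => 1).
  move=> s; rewrite [leRHS](_ : _ = (\sum_(a <- s) a.1) ^+ 2) ?sqr_ge0//.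
  rewrite expr2 mulr_suml; apply: eq_bigr => a _; rewrite mulr_sumr.
  by apply: eq_bigr => b _; rewrite mulr1.
have p2 := psdZ (exprn_ge0 m (ler0n R 2))
  (@psd_tri R (fun z => 2 ^+ m * z.2) _ (fun x y => mulrBr _ _ _) psd1).
have p1 := psdZ (exprn_ge0 n (ler0n R 2))
  (@psd_tri R (fun z => 2 ^+ n * z.1) _ (fun x y => mulrBr _ _ _) p2).
by apply: eq_psd p1 => z; rewrite /tent_prod /tent mulr1 !mulrA.
Qed.

Lemma psd_tent_prod_diff1 n m : psd (fun z : R * R => tent_prod n.+1 m z - tent_prod n m z).
Proof.
have q0 : 0 <= 4^-1 :> R by rewrite invr_ge0.
have := psdZ q0 (psd_second_difference (2 ^- n.+1, 0) (psd_tent_prod n.+1 m)).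
apply: eq_psd => z; rewrite /tent_prod -mulrBl tent_refine /= subr0 addr0.
by field.
Qed.

Lemma psd_tent_prod_diff2 n m : psd (fun z : R * R => tent_prod n m.+1 z - tent_prod n m z).
Proof.
have q0 : 0 <= 4^-1 :> R by rewrite invr_ge0.
have := psdZ q0 (psd_second_difference (0, 2 ^- m.+1) (psd_tent_prod n m.+1)).
apply: eq_psd => z; rewrite /tent_prod -mulrBr tent_refine /= subr0 addr0.
by field.
Qed.

Definition sq_tent n z : R := tent_prod n n z.

(** Each step up sharpens the first coordinate and then the second; either half step adds a positive
    semidefinite kernel. *)
Lemma psd_sq_tent_diff n m : (m <= n)%N -> psd (fun z => sq_tent n z - sq_tent m z).
Proof.
elim: n => [|n IH]; first by rewrite leqn0 => /eqP -> s; apply: sumr_ge0 => a _;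
  apply: sumr_ge0 => b _; rewrite subrr mulr0.
rewrite leq_eqVlt => /orP[/eqP -> s|].
  by apply: sumr_ge0 => a _; apply: sumr_ge0 => b _; rewrite subrr mulr0.
rewrite ltnS => /IH p; apply: eq_psd (psdD p (psdD (psd_tent_prod_diff1 n n) (psd_tent_prod_diff2 n.+1 n))).
by move=> z; rewrite /sq_tent; ring.
Qed.

Lemma sq_tentN n z : sq_tent n (- z) = sq_tent n z.
Proof. by rewrite /sq_tent /tent_prod/= !tentN. Qed.

Lemma sq_tent_ge0 n z : 0 <= sq_tent n z.
Proof. by rewrite mulr_ge0 ?tent_ge0. Qed.

Lemma exprn4 n : 4 ^+ n = 2 ^+ n * 2 ^+ n :> R.
Proof. by rewrite -exprMn; congr (_ ^+ _); lra. Qed.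

(** The supporting square of half-side [2^-n] lies in the disc of squared radius [2 / 4^n]. This is
    the link from kernels to [close_pairs]. *)
Lemma sq_tent_le n z : sq_tent n z <= 4 ^+ n * (n2 z <= 2 / 4 ^+ n)%R%:R.
Proof.
have [zn|zn] := leP (n2 z) (2 / 4 ^+ n); rewrite ?mulr1 ?mulr0.
  by rewrite exprn4 ler_pM ?tent_ge0 ?tent_le.
rewrite le_eqVlt; apply/orP; left; apply/eqP.
have sq (x : R) : ~ (2 ^- n <= `|x|) -> x ^+ 2 < 1 / 4 ^+ n.
  move=> /negP; rewrite -ltNge => xn.
  have -> : 1 / 4 ^+ n = (2 ^- n) ^+ 2 :> R.
    by rewrite exprn4 div1r expr2 invfM.
  by rewrite -real_normK ?num_real// ltr_pXn2r ?nnegrE// invr_ge0 exprn_ge0.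
rewrite /sq_tent /tent_prod; have [h1|/sq h1] := pselect (2 ^- n <= `|z.1|).
  by rewrite tent_eq0// mul0r.
have [h2|/sq h2] := pselect (2 ^- n <= `|z.2|).
  by rewrite (tent_eq0 h2) mulr0.
by move: zn; rewrite /n2 => zn; exfalso; lra.
Qed.

Lemma norm_fst_le z : `|z.1| <= `|z|.
Proof. by rewrite prod_normE le_max lexx. Qed.

Lemma norm_snd_le z : `|z.2| <= `|z|.
Proof. by rewrite prod_normE le_max lexx orbT. Qed.

Lemma norm_le_n2 z (s : R) : 0 <= s -> n2 z <= s ^+ 2 -> `|z| <= s.
Proof.
move=> s0 zs; have [h1 h2] := n2_coord_le s0 zs.
by rewrite prod_normE ge_max h1 h2.
Qed.

Lemma sq_tent_lip n : lip (2 * 8 ^+ n) (sq_tent n).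
Proof.
move=> x y; have -> : sq_tent n x - sq_tent n y =
   tent n x.1 * (tent n x.2 - tent n y.2) + (tent n x.1 - tent n y.1) * tent n y.2.
  by rewrite /sq_tent /tent_prod; ring.
have E : 8 ^+ n = 2 ^+ n * 4 ^+ n :> R by rewrite -exprMn; congr (_ ^+ _); lra.
apply: (le_trans (ler_normD _ _)); rewrite (normrM (tent n x.1)) (normrM (_ - _)) E.
have b1 : `|tent n x.2 - tent n y.2| <= 4 ^+ n * `|x - y|.
  rewrite (le_trans (tent_lip _ _ _))// ler_wpM2l ?exprn_ge0//.
  exact: (norm_snd_le (x - y)).
have b2 : `|tent n x.1 - tent n y.1| <= 4 ^+ n * `|x - y|.
  rewrite (le_trans (tent_lip _ _ _))// ler_wpM2l ?exprn_ge0//.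
  exact: (norm_fst_le (x - y)).
have b3 (u : R) : `|tent n u| <= 2 ^+ n by rewrite ger0_norm ?tent_ge0 ?tent_le.
have t1 : `|tent n x.1| * `|tent n x.2 - tent n y.2| <= 2 ^+ n * (4 ^+ n * `|x - y|).
  by rewrite ler_pM.
have t2 : `|tent n x.1 - tent n y.1| * `|tent n y.2| <= 4 ^+ n * `|x - y| * 2 ^+ n.
  by rewrite ler_pM.
by apply: (le_trans (lerD t1 t2)); rewrite le_eqVlt; apply/orP; left; apply/eqP; ring.
Qed.

Lemma avg2E v w (F : R * R -> R * R -> R) : avg v (fun x => avg w (F x)) =
  \sum_(x <- sign_sums v) \sum_(y <- sign_sums w) 2 ^- size v * 2 ^- size w * F x y.
Proof.
rewrite /avg -mulr_suml -mulrA mulr_suml; apply: eq_bigr => x _.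
rewrite mulr_suml; apply: eq_bigr => y _; ring.
Qed.

(** Sign sums are symmetric, so sums and differences of two independent copies have the same law. An
    energy is thus an average over [v ++ v], to which tail estimates apply. *)
Lemma avg_double v D : (forall z, D (- z) = D z) ->
  avg (v ++ v) D = avg v (fun x => avg v (fun y => D (x - y))).
Proof.
move=> evD; rewrite avg_cat; apply: eq_avg => x.
by rewrite -(avg_opp v); apply: eq_avg => y.
Qed.

Lemma psd_avg_ge0 v D : psd D -> (forall z, D (- z) = D z) -> 0 <= avg (v ++ v) D.
Proof.
move=> pD evD; rewrite avg_double// avg2E.
have := pD [seq (2 ^- size v, x) | x <- sign_sums v].
by rewrite big_map; under eq_bigr => a _ do rewrite big_map/=.
Qed.

(* The polarised form of positive semidefiniteness, applied to the laws of the
   two sums, the second one being translated by [z]. *)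
Lemma psd_cross_le v w D z : psd D -> (forall u, D (- u) = D u) ->
  `|avg v (fun x => avg w (fun y => D (z - x - y)))| <=
  (avg (v ++ v) D + avg (w ++ w) D) / 2.
Proof.
move=> pD evD; rewrite !avg_double//; set X := avg v (fun x => avg w _).
suff H (e : R) : e ^+ 2 = 1 -> 0 <= avg v (fun x => avg v (fun y => D (x - y)))
   + 2 * e * X + avg w (fun x => avg w (fun y => D (x - y))).
  have := H 1 (expr1n _ _); have := H (-1) (sqrr_sign R 1).
  by rewrite ler_norml => ? ?; apply/andP; split; lra.
move=> e1.
have := pD ([seq (2 ^- size v, x) | x <- sign_sums v] ++
   [seq (e * 2 ^- size w, z - y) | y <- sign_sums w]).
rewrite sum2_cat !big_map.
under eq_bigr => a _ do rewrite big_map/=.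
under [X in _ + X + _]eq_bigr => a _ do rewrite big_map/=.
under [X in _ + (X + _)]eq_bigr => a _ do rewrite big_map/=.
under [X in _ + (_ + X)]eq_bigr => a _ do rewrite big_map/=.
rewrite [X in _ + (X + _)]exchange_big/=.
have -> : \sum_(x <- sign_sums v) \sum_(y <- sign_sums w)
    2 ^- size v * (e * 2 ^- size w) * D (x - (z - y)) = e * X.
  rewrite /X avg2E mulr_sumr; apply: eq_bigr => x _.
  rewrite mulr_sumr; apply: eq_bigr => y _.
  have -> : D (x - (z - y)) = D (z - x - y).
    by rewrite -evD; congr D; rewrite !opprB addrAC.
  ring.
have -> : \sum_(x <- sign_sums v) \sum_(y <- sign_sums w)
    e * 2 ^- size w * 2 ^- size v * D (z - y - x) = e * X.
  rewrite /X avg2E mulr_sumr; apply: eq_bigr => x _.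
  rewrite mulr_sumr; apply: eq_bigr => y _; rewrite (addrAC z).
  ring.
have -> : \sum_(y <- sign_sums w) \sum_(y' <- sign_sums w)
    e * 2 ^- size w * (e * 2 ^- size w) * D (z - y - (z - y')) =
    avg w (fun x => avg w (fun y => D (x - y))).
  rewrite avg2E; apply: eq_bigr => x _; apply: eq_bigr => y _.
  have -> : D (z - x - (z - y)) = D (x - y).
    by rewrite -evD; congr D; rewrite opprB opprB addrC addrA subrK.
  have -> : e * 2 ^- size w * (e * 2 ^- size w) = e ^+ 2 * (2 ^- size w * 2 ^- size w).
    by ring.
  by rewrite e1 mul1r.
have -> : \sum_(x <- sign_sums v) \sum_(y <- sign_sums v)
    2 ^- size v * 2 ^- size v * D (x - y) = avg v (fun x => avg v (fun y => D (x - y))).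
  by rewrite avg2E.
by congr (_ <= _); ring.
Qed.

End SquareTent.

(** * Mollified laws *)

Section Limits.
Variable R : realType.

(** The pairs [e], [N0] of the Cauchy condition serve unchanged for the limit, so that estimates
    uniform in a further parameter survive. *)
Lemma cauchy_limit (u : nat -> R) :
  (forall e, 0 < e -> exists N0, forall N N', (N0 <= N)%N -> (N0 <= N')%N ->
     `|u N - u N'| <= e) ->
  exists l, forall e N0, (forall N N', (N0 <= N)%N -> (N0 <= N')%N ->
     `|u N - u N'| <= e) -> forall N, (N0 <= N)%N -> `|u N - l| <= e.
Proof.
move=> cu.
have cvu : cvgn u.
  apply/cauchy_cvgP/cauchyP => e e0.
  have e2 : 0 < e / 2 by rewrite divr_gt0.
  have [N0 H] := cu _ e2.
  exists (u N0); exists N0 => // N /= N0N; rewrite /ball/= distrC.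
  by apply: le_lt_trans (H _ _ N0N (leqnn _)) _; lra.
exists (limn u) => e N0 H N N0N.
have c : (fun M => `|u N - u M|) @ \oo --> `|u N - limn u|.
  by apply: cvg_norm; apply: cvgB => //; exact: cvg_cst.
rewrite -(cvg_lim _ c)//; apply: limr_le; first by apply/cvg_ex; eexists; exact: c.
by exists N0 => // M /= N0M; exact: H.
Qed.

Lemma mono_bounded_cauchy (u : nat -> R) (M : R) :
  (forall n m, (n <= m)%N -> u n <= u m) -> (forall n, u n <= M) ->
  forall e, 0 < e -> exists n0, forall n m, (n0 <= n)%N -> (n0 <= m)%N ->
    `|u n - u m| <= e.
Proof.
move=> mu uM e e0.
have ub : has_sup (range u).
  split; first by exists (u 0%N); exists 0%N.
  by exists M => _ [n _ <-].
have [_ [n0 _ <-] hn0] := sup_adherent e0 ub.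
have le_sup n : u n <= sup (range u) by apply: ub_le_sup; [case: ub | exists n].
exists n0 => n m n0n n0m; rewrite ler_norml; have := mu _ _ n0n; have := mu _ _ n0m.
by have := le_sup n; have := le_sup m => ? ? ? ?; apply/andP; split; lra.
Qed.

Lemma geometric_tail_le (r : R) N m : 0 <= r -> r < 1 ->
  \sum_(i < m) r ^+ (N + i) <= r ^+ N / (1 - r).
Proof.
move=> r0 r1; rewrite ler_pdivlMr ?subr_gt0//.
have -> : (\sum_(i < m) r ^+ (N + i)) * (1 - r) = r ^+ N - r ^+ (N + m).
  elim: m => [|m IH]; first by rewrite big_ord0 mul0r addn0 subrr.
  by rewrite big_ord_recr mulrDl IH /= addnS exprS; ring.
by rewrite lerBlDr lerDl exprn_ge0.
Qed.

Lemma geometric_small (r c e : R) : 0 <= r -> r < 1 -> 0 <= c -> 0 < e ->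
  exists N0, forall N, (N0 <= N)%N -> c * r ^+ N <= e.
Proof.
move=> r0 r1 c0 e0.
have cv : (fun n => c * r ^+ n) @ \oo --> (0 : R).
  rewrite -[X in _ --> X](mulr0 c); apply: cvgMr; apply: cvg_expr.
  by rewrite ger0_norm.
have /cvgrPdist_le/(_ e e0)[N0 _ H] := cv.
exists N0 => N NN; have := H N NN; rewrite /= sub0r normrN.
by apply: le_trans; exact: ler_norm.
Qed.

Variables (a : nat -> R * R) (r : R).
Hypothesis r0 : 0 <= r.
Hypothesis r1 : r < 1.
Hypothesis ar : forall i, `|a i| <= r ^+ i.

Lemma mkseq_cat N m : mkseq a (N + m) = mkseq a N ++ mkseq (fun i => a (N + i)%N) m.
Proof.
by rewrite /mkseq iotaD map_cat add0n -{2}[N]addn0 iotaDl -map_comp.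
Qed.

Lemma tail_sum_le N m : \sum_(x <- mkseq (fun i => a (N + i)%N) m) `|x| <= r ^+ N / (1 - r).
Proof.
rewrite big_map -{1}[m]subn0 -/(index_iota 0 m) big_mkord.
by apply: le_trans (geometric_tail_le N m r0 r1); apply: ler_sum.
Qed.

Lemma avg_tail L F N N' : 0 <= L -> lip L F -> (N <= N')%N ->
  `|avg (mkseq a N') F - avg (mkseq a N) F| <= L * (r ^+ N / (1 - r)).
Proof.
move=> L0 LF NN'; rewrite -(subnKC NN') mkseq_cat.
by rewrite (le_trans (avg_cat_lip _ _ L0 LF))// ler_wpM2l// tail_sum_le.
Qed.

Lemma avg_double_tail L F N N' : 0 <= L -> lip L F -> (N <= N')%N ->
  `|avg (mkseq a N' ++ mkseq a N') F - avg (mkseq a N ++ mkseq a N) F| <=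
  2 * L * (r ^+ N / (1 - r)).
Proof.
move=> L0 LF NN'; rewrite -(subnKC NN') mkseq_cat.
set v := mkseq a N; set w := mkseq _ _.
have -> : avg ((v ++ w) ++ v ++ w) F = avg ((v ++ v) ++ (w ++ w)) F.
  by apply: avg_perm; apply/permP => p; rewrite !count_cat addnACA.
apply: (le_trans (avg_cat_lip _ _ L0 LF)); rewrite big_cat/=.
have -> : 2 * L * (r ^+ N / (1 - r)) = L * (r ^+ N / (1 - r) + r ^+ N / (1 - r)) by ring.
by rewrite ler_wpM2l// lerD// tail_sum_le.
Qed.

Lemma avg_cauchy L e : 0 <= L -> 0 < e -> exists N0, forall N N' F,
  (N0 <= N)%N -> (N0 <= N')%N -> lip L F ->
  `|avg (mkseq a N) F - avg (mkseq a N') F| <= e.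
Proof.
move=> L0 e0.
have c0 : 0 <= L / (1 - r) by rewrite divr_ge0// subr_ge0 ltW.
have [N0 H] := geometric_small r0 r1 c0 e0.
exists N0 => N N' F N0N N0N' LF.
have E n : (N0 <= n)%N -> L * (r ^+ n / (1 - r)) <= e.
  by move=> /H; rewrite mulrAC mulrA.
have [NN|/ltnW NN] := leqP N' N.
  exact: le_trans (avg_tail L0 LF NN) (E _ N0N').
by rewrite distrC; exact: le_trans (avg_tail L0 LF NN) (E _ N0N).
Qed.

Lemma avg_double_cauchy L F e : 0 <= L -> lip L F -> 0 < e -> exists N0, forall N N',
  (N0 <= N)%N -> (N0 <= N')%N ->
  `|avg (mkseq a N ++ mkseq a N) F - avg (mkseq a N' ++ mkseq a N') F| <= e.
Proof.
move=> L0 LF e0.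
have c0 : 0 <= 2 * L / (1 - r) by rewrite divr_ge0 ?mulr_ge0// subr_ge0 ltW.
have [N0 H] := geometric_small r0 r1 c0 e0.
exists N0 => N N' N0N N0N'.
have E n : (N0 <= n)%N -> 2 * L * (r ^+ n / (1 - r)) <= e.
  by move=> /H; rewrite [in leLHS]mulrAC [in X in _ -> X]mulrA.
have [NN|/ltnW NN] := leqP N' N.
  exact: le_trans (avg_double_tail L0 LF NN) (E _ N0N').
by rewrite distrC; exact: le_trans (avg_double_tail L0 LF NN) (E _ N0N).
Qed.

(* Frequent boundedness of the diagonal energies is enough, since for fixed
   length they increase with the level. *)
Lemma energy_cauchy (M : R) :
  (forall n0, exists2 n : nat, (n0 <= n)%N &
     avg (mkseq a (2 * n) ++ mkseq a (2 * n)) (@sq_tent R n) <= M) ->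
  forall e, 0 < e -> exists n0, forall n m, (n0 <= n)%N -> (n0 <= m)%N ->
    exists N0, forall N, (N0 <= N)%N ->
    `|avg (mkseq a N ++ mkseq a N) (@sq_tent R n) - avg (mkseq a N ++ mkseq a N) (@sq_tent R m)| <= e.
Proof.
move=> freq.
pose ph n N := avg (mkseq a N ++ mkseq a N) (@sq_tent R n).
have L0 n : 0 <= 2 * 8 ^+ n :> R by rewrite mulr_ge0// exprn_ge0.
have [Ph PhP] : exists Ph : nat -> R, forall n e, 0 < e ->
    exists N0, forall N, (N0 <= N)%N -> `|ph n N - Ph n| <= e.
  have : forall n, exists l, forall e, 0 < e ->
      exists N0, forall N, (N0 <= N)%N -> `|ph n N - l| <= e.
    move=> n; have [|l lP] := @cauchy_limit (ph n).
      by move=> e e0; exact: avg_double_cauchy (L0 n) (@sq_tent_lip R n) e0.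
    exists l => e e0; have [N0 H] := avg_double_cauchy (L0 n) (@sq_tent_lip R n) e0.
    by exists N0; exact: lP H.
  by move=> /choice[Ph PhP]; exists Ph.
have mono n m N : (n <= m)%N -> ph n N <= ph m N.
  move=> nm; rewrite -subr_ge0 /ph -avgB; apply: psd_avg_ge0.
    exact: psd_sq_tent_diff.
  by move=> z; rewrite !sq_tentN.
have Phm n m : (n <= m)%N -> Ph n <= Ph m.
  move=> nm; apply/ler_addgt0Pr => e e0.
  have e2 : 0 < e / 2 by rewrite divr_gt0.
  have [N1 H1] := PhP n _ e2; have [N2 H2] := PhP m _ e2.
  have := H1 (maxn N1 N2) (leq_maxl _ _); have := H2 (maxn N1 N2) (leq_maxr _ _).
  have := mono n m (maxn N1 N2) nm.
  by rewrite !ler_norml => ? /andP[? ?] /andP[? ?]; lra.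
have PhM n : Ph n <= M.
  apply/ler_addgt0Pr => e e0; have [N0 H] := PhP n _ e0.
  (* A level of bounded energy beyond both [n] and [N0]: the length [2 * m] is long enough to
     approximate [Ph n], and at this length level [n] lies below level [m]. *)
  have [m nm hm] := freq (maxn n N0).
  have [nm1 nm2] : (n <= m)%N /\ (N0 <= 2 * m)%N by lia.
  have := H _ nm2; have := mono n m (2 * m)%N nm1.
  by rewrite ler_norml => ? /andP[? ?]; move: hm; rewrite -/(ph m (2 * m)%N); lra.
move=> e e0; have e3 : 0 < e / 3 by rewrite divr_gt0.
have [n0 H] := mono_bounded_cauchy Phm PhM e3.
exists n0 => n m n0n n0m.
have [N1 H1] := PhP n _ e3; have [N2 H2] := PhP m _ e3.
exists (maxn N1 N2) => N NN; rewrite -/(ph n N) -/(ph m N).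
have := H1 N (leq_trans (leq_maxl _ _) NN); have := H2 N (leq_trans (leq_maxr _ _) NN).
have := H _ _ n0n n0m.
rewrite !ler_norml => /andP[? ?] /andP[? ?] /andP[? ?].
by apply/andP; split; lra.
Qed.

End Limits.

(** * Uniform convergence of the mollified densities *)

Section UniformDensity.
Variables (R : realType) (l : R * R) (k : nat).
Hypothesis l1 : n2 l < 1.
Hypothesis l2 : 1 / 2 <= n2 l.
Notation K := k.+2.
Notation th := (cpow l K).
Hypothesis energy : bounded_energy th.

(** The density at [z] of the law of the partial sum of [N] terms convolved with [sq_tent n]. *)
Definition smoothed n N (z : R * R) : R :=
  avg (mkseq (cpow l) N) (fun x => sq_tent n (z - x)).

Lemma cpow_mul (z : R * R) i j : cpow z (i + j) = cmul (cpow z i) (cpow z j).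
Proof.
elim: i => [|i IH]; first by rewrite add0n /= /cmul/= !mul1r !mul0r subr0 addr0 -surjective_pairing.
by rewrite addSn /= IH /cmul/=; congr pair => /=; ring.
Qed.

Lemma cpow_cpow (z : R * R) i j : cpow (cpow z i) j = cpow z (i * j).
Proof. by elim: j => [|j IH]; rewrite ?muln0// mulnS cpow_mul /= IH. Qed.

(** Exponents congruent to 0 and to 1 modulo [K] give the two independent summands; [rest] holds the
    other residue classes. *)
Lemma residue_split N : exists rest, perm_eq (mkseq (cpow l) (K * N))
  (mkseq (cpow th) N ++ map (cmul l) (mkseq (cpow th) N) ++ rest).
Proof.
elim: N => [|N [rest IH]]; first by exists [::]; rewrite muln0.
exists (mkseq (fun i => cpow l (K * N + i.+2)) k ++ rest).
rewrite mulnS addnC mkseq_cat (mkseqS _ N) map_rcons.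
have -> : mkseq (fun i => cpow l (K * N + i)) K =
   cpow th N :: cmul l (cpow th N) :: mkseq (fun i => cpow l (K * N + i.+2)) k.
  rewrite cpow_cpow /mkseq /= addn0 addn1 /=; congr [:: _, _ & _].
  by have := iotaDl 2 0 k; rewrite addn0 => ->; rewrite -map_comp.
move/permP: IH => IH; apply/permP => p.
by rewrite -!cats1 !count_cat IH !count_cat /=; lia.
Qed.

Let r : R := Num.sqrt (n2 th).

Let r0 : 0 <= r. Proof. exact: sqrtr_ge0. Qed.

Let r1 : r < 1.
Proof.
rewrite -(@ltr_pXn2r _ 2)// ?nnegrE// expr1n sqr_sqrtr ?n2_ge0// n2_pow.
by rewrite exprn_ilt1 ?n2_ge0.
Qed.

Lemma norm_cpow_le (z : R * R) i : `|cpow z i| <= Num.sqrt (n2 z) ^+ i.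
Proof.
apply: norm_le_n2; first by rewrite exprn_ge0// sqrtr_ge0.
by rewrite n2_pow exprAC sqr_sqrtr ?n2_ge0.
Qed.

Let a2 i := cmul l (cpow th i).

Let a2r i : `|a2 i| <= r ^+ i.
Proof.
apply: norm_le_n2; first by rewrite exprn_ge0.
rewrite n2M n2_pow exprAC sqr_sqrtr ?n2_ge0//.
by rewrite ler_piMl ?exprn_ge0 ?n2_ge0// ltW.
Qed.

Lemma map_mkseq_a2 N : map (cmul l) (mkseq (cpow th) N) = mkseq a2 N.
Proof. by rewrite /mkseq -map_comp. Qed.

(** Serves both summands, with [F] the identity or multiplication by [l]. In the second case
    [|l|^2 >= 1/2] turns the squared radius [2 / 4^n] of the tents into [4 / 4^n], whence the
    constant 4 in [bounded_energy]. *)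
Lemma avg_pair_le (v : seq (R * R)) F (n : nat) (M : R) N :
  sign_sums v = map F (sign_sums (mkseq (cpow th) N)) ->
  size v = N ->
  (forall x y, F x - F y = F (x - y)) ->
  (forall z, n2 (F z) <= 2 / 4 ^+ n -> n2 z <= 4 / 4 ^+ n) ->
  close_pairs N (4 / 4 ^+ n) th <= M * 4 ^+ N / 4 ^+ n ->
  avg (v ++ v) (@sq_tent R n) <= M.
Proof.
move=> Ev sv FB Fn cp.
rewrite avg_double; last exact: sq_tentN.
rewrite avg2E sv Ev -ceval_sgnpoly -!map_comp !big_map.
under eq_bigr => p _ do rewrite -mulr_sumr big_map.
rewrite -mulr_sumr.
have N0 : 0 < 4 ^+ N :> R by rewrite exprn_gt0.
have n0 : 0 < 4 ^+ n :> R by rewrite exprn_gt0.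
have -> : 2 ^- N * 2 ^- N = (4 ^+ N)^-1 :> R by rewrite exprn4 invfM.
rewrite ler_pdivrMl// [leRHS]mulrC.
apply: (@le_trans _ _ (4 ^+ n * close_pairs N (4 / 4 ^+ n) th)).
  rewrite /close_pairs mulr_sumr; apply: ler_sum => p _.
  rewrite mulr_sumr; apply: ler_sum => q _ /=.
  rewrite FB -cevalB (le_trans (sq_tent_le _ _))// ler_wpM2l ?(ltW n0)//.
  case: (leP (n2 (F _))) => // h.
  by rewrite Fn.
by rewrite [leLHS]mulrC -ler_pdivlMr.
Qed.

Lemma energies_frequently_bounded : exists M : R, forall n0, exists2 n : nat, (n0 <= n)%N &
  avg (mkseq (cpow th) (2 * n) ++ mkseq (cpow th) (2 * n)) (@sq_tent R n) <= M /\
  avg (mkseq a2 (2 * n) ++ mkseq a2 (2 * n)) (@sq_tent R n) <= M.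
Proof.
have [M HM] := energy; exists M => n0; have [n n0n h] := HM n0; exists n => //.
have n4 : 0 < 4 ^+ n :> R by rewrite exprn_gt0.
have h' : close_pairs (2 * n) (4 / 4 ^+ n) th <= M * 4 ^+ (2 * n) / 4 ^+ n.
  have -> : 4 ^+ (2 * n) = 4 ^+ n * 4 ^+ n :> R by rewrite mul2n -addnn exprD.
  by rewrite mulrA mulfK// gt_eqF.
split.
- apply: (@avg_pair_le _ id n M (2 * n)) => //; rewrite ?map_id ?size_mkseq//.
  move=> z zn; apply: (le_trans zn); rewrite ler_wpM2r ?invr_ge0 ?(ltW n4)//; lra.
- apply: (@avg_pair_le _ (cmul l) n M (2 * n)) => //; rewrite ?size_mkseq//.
  + by rewrite -map_mkseq_a2 map_cmul_sign_sums.
  + by move=> x y; rewrite /cmul/=; congr pair => /=; ring.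
  + move=> z; rewrite n2M => h2.
    have : 1 / 2 * n2 z <= n2 l * n2 z by rewrite ler_wpM2r ?n2_ge0.
    move: h2; set q := _ ^+ n; have -> : 2 / q = 1 / 2 * (4 / q) by field; rewrite gt_eqF.
    lra.
Qed.

(** Once the signs of [rest] are fixed, their sum [u] only translates the kernel, and [psd_cross_le]
    gives a bound free of [z] and [u]. *)
Lemma smoothed_diff_le n m N z : (m <= n)%N ->
  `|smoothed n (K * N) z - smoothed m (K * N) z| <=
  (avg (mkseq (cpow th) N ++ mkseq (cpow th) N) (fun u => sq_tent n u - sq_tent m u) +
   avg (mkseq a2 N ++ mkseq a2 N) (fun u => sq_tent n u - sq_tent m u)) / 2.
Proof.
move=> mn; pose D (u : R * R) : R := sq_tent n u - sq_tent m u; rewrite /smoothed -avgB.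
have [rest p] := residue_split N; rewrite (avg_perm _ p) map_mkseq_a2 catA avg_catC avg_cat.
apply: avg_norm_le => u _; rewrite avg_cat.
have evD (w : R * R) : sq_tent n (- w) - sq_tent m (- w) = sq_tent n w - sq_tent m w :> R.
  by rewrite !sq_tentN.
apply: le_trans (psd_cross_le (mkseq (cpow th) N) (mkseq a2 N) (z - u)
  (psd_sq_tent_diff mn) evD).
rewrite le_eqVlt; apply/orP; left; apply/eqP; congr (`|_|).
apply: eq_avg => x; apply: eq_avg => y; rewrite /D.
by have -> : z - (u + (x + y)) = z - u - x - y by rewrite !opprD !addrA.
Qed.

Lemma sq_tent_shift_lip n z : lip (2 * 8 ^+ n) (fun x => @sq_tent R n (z - x)).
Proof.
move=> x y; apply: (le_trans (sq_tent_lip _ _ _)).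
by rewrite opprB addrC addrA subrK distrC.
Qed.

Lemma smoothed_cauchy_length n e : 0 < e -> exists N0, forall N N' z,
  (N0 <= N)%N -> (N0 <= N')%N -> `|smoothed n N z - smoothed n N' z| <= e.
Proof.
move=> e0; have L0 : 0 <= 2 * 8 ^+ n :> R by rewrite mulr_ge0// exprn_ge0.
have s1 : Num.sqrt (n2 l) < 1.
  by rewrite -(@ltr_pXn2r _ 2)// ?nnegrE ?sqrtr_ge0// expr1n sqr_sqrtr ?n2_ge0.
have [N0 H] := avg_cauchy (sqrtr_ge0 _) s1 (norm_cpow_le l) L0 e0.
by exists N0 => N N' z NN NN'; apply: H => //; exact: sq_tent_shift_lip.
Qed.

Lemma smoothed_cauchy_level e : 0 < e -> exists n0, forall n m, (n0 <= n)%N ->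
  (n0 <= m)%N -> exists N0, forall N z, (N0 <= N)%N ->
  `|smoothed n N z - smoothed m N z| <= e.
Proof.
move=> e0; have e2 : 0 < e / 2 by rewrite divr_gt0.
have e4 : 0 < e / 4 by rewrite divr_gt0.
have [M HM] := energies_frequently_bounded.
have [n1 H1] := energy_cauchy r0 r1 (norm_cpow_le th) (M := M)
  (fun n0 => let: ex_intro2 n a (conj b c) := HM n0 in ex_intro2 _ _ n a b) e2.
have [n2' H2] := energy_cauchy r0 r1 a2r (M := M)
  (fun n0 => let: ex_intro2 n a (conj b c) := HM n0 in ex_intro2 _ _ n a c) e2.
exists (maxn n1 n2').
suff main n m : (m <= n)%N -> (maxn n1 n2' <= n)%N -> (maxn n1 n2' <= m)%N ->
    exists N0, forall N z, (N0 <= N)%N -> `|smoothed n N z - smoothed m N z| <= e.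
  move=> n m hn hm; have [mn|/ltnW nm] := leqP m n; first exact: main.
  have [N0 H] := main m n nm hm hn; exists N0 => N z NN; rewrite distrC; exact: H.
rewrite !geq_max => mn /andP[n1n n2n] /andP[n1m n2m].
have [N1 G1] := H1 n m n1n n1m; have [N2 G2] := H2 n m n2n n2m.
(* The kernel estimate is made at the single length [K * N0], with error [e / 2]; passing from [N]
   to that length costs [e / 4] at each of the two levels. *)
have [N3 G3] := smoothed_cauchy_length n e4.
have [N4 G4] := smoothed_cauchy_length m e4.
pose N0 := maxn (maxn N1 N2) (maxn N3 N4).
exists N0 => N z NN.
have [N1N0 N2N0 N3N0 N4N0] : [/\ (N1 <= N0)%N, (N2 <= N0)%N, (N3 <= N0)%N & (N4 <= N0)%N].
  by split; rewrite !leq_max leqnn ?orbT.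
have KN : (N0 <= K * N0)%N by rewrite leq_pmull.
have := smoothed_diff_le N0 z mn; rewrite /= !avgB.
have := G1 N0 N1N0; have := G2 N0 N2N0.
have := G3 N (K * N0)%N z (leq_trans N3N0 NN) (leq_trans N3N0 KN).
have := G4 N (K * N0)%N z (leq_trans N4N0 NN) (leq_trans N4N0 KN).
rewrite !ler_norml => /andP[? ?] /andP[? ?] /andP[? ?] /andP[? ?] /andP[? ?].
by apply/andP; split; lra.
Qed.

(** The length goes to infinity before the level, because the cut-off error grows with the Lipschitz
    constant of the tent. Both limits are uniform in [z]. *)
Lemma smoothed_limit : exists g : R * R -> R, forall e, 0 < e -> exists n0, forall n,
  (n0 <= n)%N -> exists N0, forall N z, (N0 <= N)%N -> `|smoothed n N z - g z| <= e.
Proof.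
have [gn gnP] : exists gn : nat -> R * R -> R, forall n e, 0 < e -> exists N0,
    forall N z, (N0 <= N)%N -> `|smoothed n N z - gn n z| <= e.
  have : forall p : nat * (R * R), exists y, forall e N0,
     (forall N N', (N0 <= N)%N -> (N0 <= N')%N ->
        `|smoothed p.1 N p.2 - smoothed p.1 N' p.2| <= e) ->
     forall N, (N0 <= N)%N -> `|smoothed p.1 N p.2 - y| <= e.
    move=> p; apply: (@cauchy_limit R (fun N => smoothed p.1 N p.2)) => e e0.
    have [N0 H] := smoothed_cauchy_length p.1 e0.
    by exists N0 => N N'; exact: H.
  move=> /choice[y yP]; exists (fun n z => y (n, z)) => n e e0.
  have [N0 H] := smoothed_cauchy_length n e0; exists N0 => N z NN.
  by apply: (yP (n, z) e N0) => // N1 N2; exact: H.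
have gc e : 0 < e -> exists n0, forall n m z, (n0 <= n)%N -> (n0 <= m)%N ->
    `|gn n z - gn m z| <= e.
  move=> e0; have e3 : 0 < e / 3 by rewrite divr_gt0.
  have [n0 H] := smoothed_cauchy_level e3; exists n0 => n m z hn hm.
  have [N1 H1] := H n m hn hm.
  have [N2 H2] := gnP n _ e3; have [N3 H3] := gnP m _ e3.
  pose N := maxn N1 (maxn N2 N3).
  have [i1 i2 i3] : [/\ (N1 <= N)%N, (N2 <= N)%N & (N3 <= N)%N] by rewrite /N; split; lia.
  have := H1 N z i1; have := H2 N z i2; have := H3 N z i3.
  rewrite !ler_norml => /andP[? ?] /andP[? ?] /andP[? ?].
  by apply/andP; split; lra.
have : forall z, exists y, forall e n0,
     (forall n m, (n0 <= n)%N -> (n0 <= m)%N -> `|gn n z - gn m z| <= e) ->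
     forall n, (n0 <= n)%N -> `|gn n z - y| <= e.
  move=> z; apply: (@cauchy_limit R (fun n => gn n z)) => e e0.
  by have [n0 H] := gc e e0; exists n0 => n m; exact: H.
move=> /choice[g gP]; exists g => e e0; have e2 : 0 < e / 2 by rewrite divr_gt0.
have [n0 H] := gc _ e2; exists n0 => n hn.
have [N0 HN] := gnP n _ e2; exists N0 => N z NN.
have := HN N z NN; have := gP z (e / 2) n0 (fun n m => H n m z) n hn.
rewrite !ler_norml => /andP[? ?] /andP[? ?].
by apply/andP; split; lra.
Qed.

End UniformDensity.

(** * Identification of the law *)

Section Digits.
Variables (R : realType) (a : nat -> R * R).
Implicit Types (t : R) (B : set (R * R)).

Definition signed_sum (b : nat -> bool) m N : R * R :=
  \sum_(m <= n < m + N) (if b n then a n else - a n).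

Lemma signed_sumS b m N :
  signed_sum b m N.+1 = (if b m then a m else - a m) + signed_sum b m.+1 N.
Proof. by rewrite /signed_sum addnS -addSn big_ltn // addSn ltnS leq_addr. Qed.

Definition dyadic (m j : nat) : set R := `[j%:R / 2 ^+ m, j.+1%:R / 2 ^+ m[%classic.

Lemma digit_dyadic m j t : dyadic m.+1 j t -> digit t m = odd j.
Proof.
rewrite /dyadic /= in_itv/= => /andP[t1 t2]; rewrite /digit; congr odd.
apply: truncn_def; apply/andP; split.
  by rewrite -ler_pdivrMr ?exprn_gt0.
by rewrite -ltr_pdivlMr ?exprn_gt0.
Qed.

Lemma dyadic_split m j : dyadic m j = dyadic m.+1 j.*2 `|` dyadic m.+1 j.*2.+1.
Proof.
have E (i : nat) : i%:R / 2 ^+ m = i.*2%:R / 2 ^+ m.+1 :> R.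
  by rewrite -mul2n natrM exprS; field; rewrite expf_neq0.
rewrite /dyadic !E doubleS; apply/seteqP; split => t /=; rewrite !in_itv/=.
  case/andP => t1 t2; have [t3|t3] := ltP t (j.*2.+1%:R / 2 ^+ m.+1); [left|right].
    by rewrite t1.
  by rewrite t2.
have lt01 (i : nat) : i%:R / 2 ^+ m.+1 <= i.+1%:R / 2 ^+ m.+1 :> R.
  by rewrite ler_wpM2r ?invr_ge0 ?exprn_ge0// ler_nat.
move=> [] /andP[t1 t2]; apply/andP; split=> //.
  exact: lt_le_trans (lt01 _).
exact: le_trans (lt01 _) t1.
Qed.

Lemma dyadic_disjoint m j : dyadic m.+1 j.*2 `&` dyadic m.+1 j.*2.+1 = set0.
Proof.
rewrite /dyadic -subset0 => t [] /=; rewrite !in_itv/= => /andP[_ t1] /andP[t2 _].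
by have := lt_le_trans t1 t2; rewrite ltxx.
Qed.

(** Halving the interval fixes digit [m]: it is 0 on the left half and 1 on the right, which shifts
    [c] by [- a m] or [a m]. The event is a finite union of dyadic intervals, whatever [B] is. *)
Lemma dyadic_law N m j c B :
  let E := dyadic m j `&` [set t | B (c + signed_sum (digit t) m N)] in
  measurable E /\ lebesgue_measure E =
    (2 ^- m * avg (mkseq (fun i => a (m + i)%N) N) (fun x => \1_B (c + x)))%:E.
Proof.
elim: N m j c => [|N IH] m j c /=.
  have -> : [set t | B (c + signed_sum (digit t) m 0)] = [set t : R | B c].
    apply/funext => t /=; rewrite /signed_sum addn0 big_geq// addr0.
    by [].
  rewrite avg_nil addr0 indicE; have [Bc|nBc] := pselect (B c).
    have -> : [set t : R | B c] = setT by apply/seteqP; split.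
    rewrite setIT mem_set// mulr1; split; first exact: measurable_itv.
    rewrite lebesgue_measure_itv/= lte_fin ltr_pM2r ?invr_gt0 ?exprn_gt0// ltr_nat ltnSn.
    by rewrite -EFinB -mulrBl -natr1 addrAC subrr add0r mul1r.
  have -> : [set t : R | B c] = set0 by rewrite -subset0.
  by rewrite setI0 memNset// mulr0 measure0; split.
set E := _ `&` _.
pose E0 := dyadic m.+1 j.*2 `&` [set t | B ((c - a m) + signed_sum (digit t) m.+1 N)].
pose E1 := dyadic m.+1 j.*2.+1 `&` [set t | B ((c + a m) + signed_sum (digit t) m.+1 N)].
have EE : E = E0 `|` E1.
  rewrite /E dyadic_split setIUl; congr (_ `|` _); apply/seteqP; split => t [td] /=;
    rewrite signed_sumS (digit_dyadic td) /= odd_double/= addrA; by split.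
have [m0 l0] := IH m.+1 j.*2 (c - a m); have [m1 l1] := IH m.+1 j.*2.+1 (c + a m).
split; first by rewrite EE; exact: measurableU.
have dis : E0 `&` E1 = set0.
  by rewrite -subset0 => t [[t1 _] [t2 _]]; rewrite -(dyadic_disjoint m j).
rewrite EE measureU//; rewrite /= in l0 l1; rewrite -/E0 in l0; rewrite -/E1 in l1.
transitivity (lebesgue_measure E0 + lebesgue_measure E1)%E; first by [].
rewrite l0 l1 -EFinD; congr EFin.
have -> : mkseq (fun i => a (m + i)%N) N.+1 = a m :: mkseq (fun i => a (m.+1 + i)%N) N.
  rewrite /mkseq /= addn0; congr (_ :: _); have := iotaDl 1 0 N; rewrite addn0 => ->.
  by rewrite -map_comp; apply: eq_map => i /=; rewrite addnA addn1.
rewrite avg_cons -mulrDr addrC exprSr invfM -mulrA; congr (_ * _).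
rewrite mulrC; congr (_ / _).
by congr (_ + _); apply: eq_avg => x; rewrite addrA.
Qed.

End Digits.

(** * The series as a limit of partial sums *)

Section Law.
Variables (R : realType) (l : R * R).
Hypothesis l1 : n2 l < 1.
Let s : R := Num.sqrt (n2 l).

Let s0 : 0 <= s. Proof. exact: sqrtr_ge0. Qed.

Let s1 : s < 1.
Proof. by rewrite -(@ltr_pXn2r _ 2)// ?nnegrE// expr1n sqr_sqrtr ?n2_ge0. Qed.

Definition tail N : R := s ^+ N / (1 - s).

Lemma tail_small e : 0 < e -> exists N0, forall N, (N0 <= N)%N -> tail N <= e.
Proof.
move=> e0; have c0 : 0 <= (1 - s)^-1 by rewrite invr_ge0 subr_ge0 ltW.
have [N0 H] := geometric_small s0 s1 c0 e0.
by exists N0 => N /H; rewrite /tail mulrC.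
Qed.

Lemma geometric_series_limit (c : nat -> R) : (forall n, `|c n| <= s ^+ n) ->
  (fun N => \sum_(0 <= n < N) c n) @ \oo --> limn (fun N => \sum_(0 <= n < N) c n) /\
  forall N, `|\sum_(0 <= n < N) c n - limn (fun N => \sum_(0 <= n < N) c n)| <= tail N.
Proof.
move=> cs; set u := fun N => _.
have ut N N' : (N <= N')%N -> `|u N - u N'| <= tail N.
  move=> NN; rewrite distrC /u (big_cat_nat _ NN)//= addrAC subrr add0r.
  rewrite (le_trans (ler_norm_sum _ _ _))// -{1}[N]add0n big_addn big_mkord.
  apply: le_trans (geometric_tail_le N (N' - N) s0 s1).
  by apply: ler_sum => i _; rewrite addnC.
have uc e N0 : tail N0 <= e / 2 -> forall N N', (N0 <= N)%N -> (N0 <= N')%N ->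
    `|u N - u N'| <= e.
  move=> te N N' NN NN'; have := ut _ _ NN; have := ut _ _ NN'.
  by rewrite !ler_norml => /andP[? ?] /andP[? ?]; apply/andP; split; lra.
have [y yP] : exists y, forall e N0, (forall N N', (N0 <= N)%N -> (N0 <= N')%N ->
     `|u N - u N'| <= e) -> forall N, (N0 <= N)%N -> `|u N - y| <= e.
  apply: cauchy_limit => e e0; have e2 : 0 < e / 2 by rewrite divr_gt0.
  by have [N0 H] := tail_small e2; exists N0; apply: uc; exact: H.
have cv : u @ \oo --> y.
  apply/cvgrPdist_le => e e0; have e2 : 0 < e / 2 by rewrite divr_gt0.
  have [N0 H] := tail_small e2; exists N0 => // N /= NN.
  rewrite distrC; apply: yP NN; apply: uc; exact: H.
rewrite (cvg_lim _ cv)//; split=> // N.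
have cvN : (fun M => `|u N - u M|) @ \oo --> `|u N - y|.
  by apply: cvg_norm; apply: cvgB => //; exact: cvg_cst.
rewrite -(cvg_lim _ cvN)//; apply: limr_le; first by apply/cvg_ex; eexists; exact: cvN.
by exists N => // M /= NM; exact: ut.
Qed.

Definition partial_series (b : nat -> bool) N := signed_sum (cpow l) b 0 N.

Lemma partial_seriesE b N : partial_series b N =
  (\sum_(0 <= n < N) sgnb R (b n) * (cpow l n).1,
   \sum_(0 <= n < N) sgnb R (b n) * (cpow l n).2).
Proof.
rewrite /partial_series /signed_sum add0n; elim: N => [|N IH].
  by rewrite !big_geq.
rewrite !big_nat_recr//= IH; congr pair => /=; rewrite /sgnb;
  by case: (b N); rewrite ?mul1r ?mulN1r.
Qed.

Let coord_le (b : nat -> bool) n : `|sgnb R (b n) * (cpow l n).1| <= s ^+ n /\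
  `|sgnb R (b n) * (cpow l n).2| <= s ^+ n.
Proof.
have nb : `|sgnb R (b n)| = 1 by rewrite /sgnb; case: (b n); rewrite ?normrN normr1.
rewrite !normrM nb !mul1r; split; apply: le_trans (norm_cpow_le l n).
  exact: norm_fst_le.
exact: norm_snd_le.
Qed.

Lemma partial_series_tail b N : `|partial_series b N - signed_series l b| <= tail N.
Proof.
rewrite partial_seriesE /signed_series prod_normE ge_max; apply/andP; split.
  exact: (geometric_series_limit (fun n => (coord_le b n).1)).2.
exact: (geometric_series_limit (fun n => (coord_le b n).2)).2.
Qed.

Definition unit_itv : set R := [set t | 0 <= t < 1].

Lemma unit_itvE : unit_itv = dyadic 0 0.
Proof.
by rewrite /unit_itv /dyadic; apply/seteqP; split => t /=; rewrite in_itv/= expr0 mul0r divr1.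
Qed.

Lemma partial_series_law N (B : set (R * R)) :
  let E := unit_itv `&` [set t | B (partial_series (digit t) N)] in
  measurable E /\ lebesgue_measure E = (avg (mkseq (cpow l) N) \1_B)%:E.
Proof.
have [mE lE] := dyadic_law (cpow l) N 0 0 0 B.
have -> : unit_itv `&` [set t | B (partial_series (digit t) N)] =
    dyadic 0 0 `&` [set t | B (0 + signed_sum (cpow l) (digit t) 0 N)].
  rewrite unit_itvE; congr (_ `&` _); apply/funext => t /=.
  by rewrite add0r.
split=> //; rewrite lE expr0 invr1 mul1r; congr EFin.
by apply: eq_avg => x; rewrite add0r.
Qed.

Lemma measurable_series_coord :
  measurable_fun unit_itv (fun t => (signed_series l (digit t)).1) /\
  measurable_fun unit_itv (fun t => (signed_series l (digit t)).2).
Proof.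
split.
  apply: (@measurable_fun_cvg _ _ _ _ (fun N t => (partial_series (digit t) N).1)).
    move=> N _ Y mY; exact: (partial_series_law N (fst @^-1` Y)).1.
  move=> t _; rewrite /signed_series/=.
  have [cv _] := geometric_series_limit (fun n => (coord_le (digit t) n).1).
  by under eq_fun do rewrite partial_seriesE/=.
apply: (@measurable_fun_cvg _ _ _ _ (fun N t => (partial_series (digit t) N).2)).
  move=> N _ Y mY; exact: (partial_series_law N (snd @^-1` Y)).1.
move=> t _; rewrite /signed_series/=.
have [cv _] := geometric_series_limit (fun n => (coord_le (digit t) n).2).
by under eq_fun do rewrite partial_seriesE/=.
Qed.

End Law.

(** * Open boxes determine a finite measure *)

Section Boxes.
Variable R : realType.

Definition box (a b c d : R) : set (R * R) := `]a, b[%classic `*` `]c, d[%classic.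

Lemma measurable_box a b c d : measurable (box a b c d).
Proof. exact: measurableX. Qed.

Lemma boxE a b c d z : box a b c d z <-> a < z.1 < b /\ c < z.2 < d.
Proof. by rewrite /box /setX /= !in_itv. Qed.

Lemma setTX_bigcup_box (A : set R) :
  A `*` setT = \bigcup_(n in setT) (A `*` `](- n%:R)%R, n%:R[%classic) :> set (R * R).
Proof.
apply/seteqP; split => [[x y] [/= Ax _]|[x y] [n _ [/= Ax _]]]; last by split.
exists (Num.truncn `|y|).+1 => //; split => //=; rewrite in_itv/= -ltr_norml.
by have /andP[] := truncn_itv (normr_ge0 y).
Qed.

Lemma XsetT_bigcup_box (B : set R) :
  setT `*` B = \bigcup_(n in setT) (`](- n%:R)%R, n%:R[%classic `*` B) :> set (R * R).
Proof.
apply/seteqP; split => [[x y] [/= _ By]|[x y] [n _ [/= _ By]]]; last by split.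
exists (Num.truncn `|x|).+1 => //; split => //=; rewrite in_itv/= -ltr_norml.
by have /andP[] := truncn_itv (normr_ge0 x).
Qed.

Definition boxes : set (set (R * R)) :=
  [set B | exists a b c d, B = box a b c d].

(** Cylinders over open intervals are countable unions of boxes, and forming cylinders commutes with
    complements and countable unions, so all measurable cylinders are generated. A product set is
    the intersection of two cylinders. *)
Lemma measurable_gen_boxes : @measurable _ (R * R)%type = <<s boxes >>.
Proof.
apply/seteqP; split; last first.
  apply: smallest_sub; first exact: sigma_algebra_measurable.
  by move=> _ [a [b [c [d ->]]]]; exact: measurable_box.
have [s0 sC sU] := smallest_sigma_algebra [set: R * R] boxes.
have lift (f : set R -> set (R * R)) : f set0 = set0 ->
    (forall A, f (~` A) = setT `\` f A) ->
    (forall F : (set R)^nat, f (\bigcup_n F n) = \bigcup_n f (F n)) ->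
    (forall x y, <<s boxes >> (f `]x, y[%classic)) ->
    forall A, measurable A -> <<s boxes >> (f A).
  move=> f0 fC fU fG; rewrite [measurable](RGenOpens.measurableE R).
  apply: smallest_sub; last by move=> _ [x [y ->]]; exact: fG.
  split; first by rewrite /= f0.
    by move=> A /= sA; rewrite setTD fC; exact: sC.
  by move=> F /= sF; rewrite fU; exact: sU.
have m1 A : measurable A -> <<s boxes >> (A `*` setT).
  apply: (lift (fun A => A `*` setT)); first by rewrite set0X.
  - by move=> B; apply/seteqP; split => -[x y]; rewrite /setX /setC /setD /=; tauto.
  - move=> F; apply/seteqP; split => [[x y] [[n _ Fx] _]|[x y] [n _ [Fx _]]].
      by exists n.
    by split => //; exists n.
  - move=> x y; rewrite setTX_bigcup_box; apply: sU => n.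
    by apply: sub_sigma_algebra; exists x, y, (- n%:R), n%:R.
have m2 A : measurable A -> <<s boxes >> (setT `*` A).
  apply: (lift (fun A => setT `*` A)); first by rewrite setX0.
  - by move=> B; apply/seteqP; split => -[x y]; rewrite /setX /setC /setD /=; tauto.
  - move=> F; apply/seteqP; split => [[x y] [_ [n _ Fx]]|[x y] [n _ [_ Fx]]].
      by exists n.
    by split => //; exists n.
  - move=> x y; rewrite XsetT_bigcup_box; apply: sU => n.
    by apply: sub_sigma_algebra; exists (- n%:R), n%:R, x, y.
rewrite measurable_prod_measurableType; apply: smallest_sub => //.
move=> _ [A mA [B mB <-]].
have -> : A `*` B = ~` ((~` (A `*` setT)) `|` ~` (setT `*` B)).
  rewrite setCU !setCK; apply/seteqP; split => [[x y] [/= ? ?]|[x y] [[/= ? _] [/= _ ?]]];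
    by split.
rewrite -setTD; apply: (sC).
rewrite -bigcup2E; apply: (sU) => -[|[|n]] /=.
- by rewrite -setTD; apply: (sC); exact: m1.
- by rewrite -setTD; apply: (sC); exact: m2.
- exact: s0.
Qed.

Lemma measure_eq_boxes (m1 m2 : {measure set (R * R)%type -> \bar R}) :
  (m1 setT < +oo)%E ->
  (forall a b c d, m1 (box a b c d) = m2 (box a b c d)) ->
  forall B, measurable B -> m1 B = m2 B.
Proof.
move=> m1oo m12.
apply: (@measure_unique _ _ _ boxes (fun n => box (- n%:R) n%:R (- n%:R) n%:R)).
- exact: measurable_gen_boxes.
- move=> _ _ [a [b [c [d ->]]]] [a' [b' [c' [d' ->]]]].
  exists (Num.max a a'), (Num.min b b'), (Num.max c c'), (Num.min d d').
  apply/seteqP; split => z.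
    move=> [/boxE[/andP[? ?] /andP[? ?]] /boxE[/andP[? ?] /andP[? ?]]].
    by apply/boxE; split; rewrite gt_max lt_min; do ! (apply/andP; split).
  move=> /boxE; rewrite !gt_max !lt_min.
  move=> -[/andP[/andP[? ?] /andP[? ?]] /andP[/andP[? ?] /andP[? ?]]].
  by split; apply/boxE; split; apply/andP; split.
- by move=> n; exists (- n%:R), n%:R, (- n%:R), n%:R.
- apply/seteqP; split => // z _.
  exists (Num.truncn (Num.max `|z.1| `|z.2|)).+1 => //=; apply/boxE.
  have m0 : 0 <= Num.max `|z.1| `|z.2| by rewrite le_max normr_ge0.
  have /andP[_] := truncn_itv m0; rewrite gt_max => /andP[].
  by rewrite !ltr_norml.
- by move=> _ [a [b [c [d ->]]]].
- move=> n; apply: le_lt_trans m1oo; apply: le_measure; rewrite ?inE//.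
  exact: measurable_box.
Qed.

End Boxes.

(** * The tent as a probability density *)

Section TentIntegral.
Variable R : realType.
Notation leb := (@lebesgue_measure R).

Lemma measurable_tri : measurable_fun [set: R] (@tri R).
Proof.
by apply: measurable_maxr => //; exact: measurable_funB.
Qed.

Lemma measurable_tent n (x : R) : measurable_fun [set: R] (fun z => tent n (z - x)).
Proof.
apply: measurable_funM => //.
apply: (measurableT_comp measurable_tri); apply: measurable_funM => //.
exact: measurable_funB.
Qed.

Lemma length_itv_cc (a b : R) : a <= b -> leb `[a, b]%classic = (b - a)%:E.
Proof.
move=> ab; rewrite lebesgue_measure_itv/= lte_fin; case: ltP => [_|ba].
  by rewrite -EFinB.
by congr EFin; apply/esym/eqP; rewrite subr_eq0 eq_le ba ab.
Qed.

Definition overlap n (x z : R) : set R :=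
  `[x, x + 2 ^- n]%classic `&` `[z, z + 2 ^- n]%classic.

(* The tent is the convolution of two normalised indicators of intervals. *)
Lemma tent_overlap n (x z : R) : (tent n (z - x))%:E =
  ((4 ^+ n)%:E * leb (overlap n x z))%E.
Proof.
have h0 : 0 < 2 ^- n :> R by rewrite invr_gt0 exprn_gt0.
have p0 : 0 < 2 ^+ n :> R by rewrite exprn_gt0.
wlog xz : x z / x <= z => [hw|].
  have [/hw//|/ltW zx] := leP x z.
  by rewrite -tentN opprB /overlap setIC -/(overlap n z x) hw.
have -> : overlap n x z = `[z, x + 2 ^- n]%classic.
  rewrite /overlap.
  apply/seteqP; split => y /=; rewrite !in_itv/=.
    by move=> [/andP[? ?] /andP[? ?]]; apply/andP; split.
  by move=> /andP[? ?]; split; apply/andP; split => //; lra.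
have d0 : 0 <= z - x by rewrite subr_ge0.
rewrite lebesgue_measure_itv/= lte_fin; case: ltP => [zx|zx].
  rewrite -EFinB -EFinM; congr EFin; rewrite /tent /tri.
  rewrite ger0_norm ?mulr_ge0 ?(ltW p0)// exprn4.
  rewrite (max_idPr _); first by field; rewrite gt_eqF.
  by rewrite subr_ge0 mulrC -ler_pdivlMr// div1r; lra.
rewrite mule0; congr EFin; apply: tent_eq0.
by rewrite ger0_norm//; lra.
Qed.

(** By Tonelli the overlap lengths integrate to the area of the parallelogram [A], whose sections at
    fixed second coordinate in [[x, x + 2^-n]] have length [2^-n]. *)
Lemma integral_tent n (x : R) : (\int[leb]_z (tent n (z - x))%:E = 1)%E.
Proof.
have h0 : 0 < 2 ^- n :> R by rewrite invr_gt0 exprn_gt0.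
pose A : set (R * R) := [set p | [/\ x <= p.2, p.2 <= x + 2 ^- n, p.1 <= p.2 &
   p.2 <= p.1 + 2 ^- n]].
have mle (f g : R * R -> R) : measurable_fun setT f -> measurable_fun setT g ->
    measurable [set l | f l <= g l].
  by move=> mf mg; rewrite -[X in measurable X]setTI; exact: measurable_fun_le.
have mA : measurable A.
  have -> : A = [set p | x <= p.2] `&` [set p | p.2 <= x + 2 ^- n] `&`
      [set p | p.1 <= p.2] `&` [set p | p.2 <= p.1 + 2 ^- n].
    apply/seteqP; split => p /=; first by move=> [].
    by move=> [[[]]].
  have m1 := @measurable_fst _ _ R R; have m2 := @measurable_snd _ _ R R.
  do ! apply: measurableI; apply: mle => //.
  exact: measurable_funD.
under eq_integral do rewrite tent_overlap.
have xsecE z : xsection A z = overlap n x z.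
  rewrite /overlap.
  apply/seteqP; split => s; first by move=> /xsectionP[/= ? ? ? ?]; split;
    rewrite /= in_itv/=; apply/andP; split.
  move=> [] /=; rewrite !in_itv/= => /andP[? ?] /andP[? ?].
  by apply/xsectionP; split.
have ysecE s : ysection A s = if x <= s <= x + 2 ^- n then `[s - 2 ^- n, s]%classic else set0.
  case: ifPn => hs; apply/seteqP; split => z //.
  - move=> /ysectionP[/= ? ? ? ?]; rewrite /= in_itv/=; apply/andP; split; lra.
  - rewrite /= in_itv/= => /andP[? ?]; case/andP: hs => ? ?.
    by apply/ysectionP; split => //=; lra.
  - by move=> /ysectionP[/= h1 h2 _ _]; move: hs; rewrite h1 h2.
rewrite ge0_integralZl//; last 1 first.
  under eq_fun do rewrite -xsecE.
  exact: measurable_fun_xsection.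
under eq_integral do rewrite -xsecE.
have := indic_fubini_tonelli leb leb mA.
rewrite indic_fubini_tonelli_FE// indic_fubini_tonelli_GE// => -> /=.
have -> : (\int[leb]_s leb (ysection A s) =
    \int[leb]_s ((2 ^- n)%:E * (\1_(`[x, (x + 2 ^- n)%R]%classic : set R) s)%:E))%E.
  apply: eq_integral => s _; rewrite ysecE indicE.
  have -> : (s \in (`[x, x + 2 ^- n]%classic : set R)) = (x <= s <= x + 2 ^- n).
    by apply/idP/idP => [/set_mem|?]; [|apply/mem_set]; rewrite /= in_itv.
  case: ifPn => _; last by rewrite measure0 mule0.
  by rewrite length_itv_cc ?gerBl ?(ltW h0)// mule1 subKr.
rewrite ge0_integralZl//; last first.
  by apply/measurable_EFinP; exact: measurable_indic.
rewrite integral_indic// setIT.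
transitivity ((4 ^+ n : R)%:E * ((2 ^- n)%:E * (2 ^- n)%:E))%E.
  congr (_ * (_ * _))%E; apply: etrans (length_itv_cc _) _; first by rewrite lerDl ltW.
  by rewrite addrAC subrr add0r.
by rewrite -!EFinM exprn4; congr EFin; field; rewrite expf_neq0.
Qed.

End TentIntegral.

(** * Mollified laws on boxes, and the law as a measure *)

Section LawMeasure.
Variable R : realType.
Notation leb := (@lebesgue_measure R).
Notation leb2 := ((@lebesgue_measure R) \x (@lebesgue_measure R))%E.

Lemma measurable_sq_tent n (x : R * R) :
  measurable_fun [set: R * R] (fun z => @sq_tent R n (z - x)).
Proof.
apply: measurable_funM.
  exact: (measurableT_comp (measurable_tent n x.1) measurable_fst).
exact: (measurableT_comp (measurable_tent n x.2) measurable_snd).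
Qed.

Lemma integral_sq_tent n (x : R * R) : (\int[leb2]_z (sq_tent n (z - x))%:E = 1)%E.
Proof.
rewrite fubini_tonelli1//=; last 2 first.
- by apply/measurable_EFinP; exact: measurable_sq_tent.
- by move=> z; rewrite lee_fin sq_tent_ge0.
rewrite /fubini_F -[RHS](integral_tent n x.1); apply: eq_integral => u _ /=.
rewrite -[RHS]mule1 -(integral_tent n x.2) -ge0_integralZl//; last 3 first.
- by apply/measurable_EFinP; exact: measurable_tent.
- by move=> v _; rewrite lee_fin tent_ge0.
- by rewrite lee_fin tent_ge0.
Qed.

Lemma sq_tent_supp n (z x : R * R) :
  sq_tent n (z - x) != 0 -> `|z.1 - x.1| < 2 ^- n /\ `|z.2 - x.2| < 2 ^- n.
Proof.
rewrite /sq_tent /tent_prod mulf_eq0 negb_or => /andP[h1 h2]; split.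
  by rewrite ltNge; apply: contraNN h1 => h; rewrite tent_eq0.
by rewrite ltNge; apply: contraNN h2 => h; rewrite tent_eq0.
Qed.

(** A tent of scale at most [e] spreads mass by at most [e] in each coordinate, so a point at depth
    [e] in the box loses nothing. *)
Lemma integral_sq_tent_box_ge n (x : R * R) (a b c d e : R) : 2 ^- n <= e ->
  ((\1_(box (a + e) (b - e) (c + e) (d - e)) x)%:E <=
   \int[leb2]_(z in box a b c d) (sq_tent n (z - x))%:E)%E.
Proof.
move=> ne; rewrite indicE; have [xB|_] := boolP (x \in _); last first.
  by apply: integral_ge0 => z _; rewrite lee_fin sq_tent_ge0.
have /boxE[/andP[? ?] /andP[? ?]] := set_mem xB.
rewrite -(integral_sq_tent n x) [leRHS]integral_mkcond le_eqVlt; apply/orP; left; apply/eqP.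
apply: eq_integral => z _; rewrite patchE; case: ifPn => // /negP zB.
apply/eqP; rewrite eqe; apply: contraT => /sq_tent_supp.
rewrite !ltr_norml => -[/andP[? ?] /andP[? ?]].
exfalso; apply: zB; apply: mem_set; apply/boxE; split; apply/andP; split; lra.
Qed.

Lemma integral_sq_tent_box_le n (x : R * R) (a b c d e : R) : 2 ^- n <= e ->
  (\int[leb2]_(z in box a b c d) (sq_tent n (z - x))%:E <=
   (\1_(box (a - e) (b + e) (c - e) (d + e)) x)%:E)%E.
Proof.
move=> ne; rewrite indicE; have [xB|/negP xB] := boolP (x \in _).
  rewrite -[leRHS](integral_sq_tent n x); apply: ge0_subset_integral => //.
  - exact: measurable_box.
  - by apply/measurable_EFinP; exact: measurable_sq_tent.
  - by move=> z _; rewrite lee_fin sq_tent_ge0.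
rewrite integral0_eq// => z /boxE[/andP[? ?] /andP[? ?]].
apply/eqP; rewrite eqe; apply: contraT => /sq_tent_supp.
rewrite !ltr_norml => -[/andP[? ?] /andP[? ?]].
exfalso; apply: xB; apply: mem_set; apply/boxE; split; apply/andP; split; lra.
Qed.

Variable l : R * R.

Lemma measurable_smoothed n N : measurable_fun [set: R * R] (smoothed l n N).
Proof.
apply: measurable_funM => //; apply: measurable_sum => x; exact: measurable_sq_tent.
Qed.

Lemma smoothed_ge0 n N z : 0 <= smoothed l n N z.
Proof.
rewrite /smoothed -(avg_cst (mkseq (cpow l) N) 0); apply: avg_le => x.
exact: sq_tent_ge0.
Qed.

Lemma integral_smoothed n N (B : set (R * R)) : measurable B ->
  (\int[leb2]_(z in B) (smoothed l n N z)%:E =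
   \sum_(x <- sign_sums (mkseq (cpow l) N))
     (2 ^- N)%:E * \int[leb2]_(z in B) (sq_tent n (z - x))%:E)%E.
Proof.
move=> mB; rewrite /smoothed /avg size_mkseq.
under eq_integral do rewrite mulrC mulr_sumr -sumEFin.
rewrite ge0_integral_sum//; last first.
- by move=> x z _; rewrite lee_fin mulr_ge0 ?sq_tent_ge0 ?invr_ge0 ?exprn_ge0.
- move=> x; apply/measurable_EFinP; apply: measurable_funM => //.
  by apply: measurable_funTS; exact: measurable_sq_tent.
apply: eq_bigr => x _; under eq_integral do rewrite EFinM.
rewrite ge0_integralZl//.
- by apply/measurable_EFinP; apply: measurable_funTS; exact: measurable_sq_tent.
- by move=> z _; rewrite lee_fin sq_tent_ge0.
Qed.

Lemma avg_indicE N (B : set (R * R)) : ((avg (mkseq (cpow l) N) \1_B)%:E =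
  \sum_(x <- sign_sums (mkseq (cpow l) N)) (2 ^- N)%:E * (\1_B x)%:E)%E.
Proof.
rewrite /avg size_mkseq mulrC mulr_sumr -sumEFin.
by apply: eq_bigr => x _; rewrite EFinM.
Qed.

Hypothesis l1 : n2 l < 1.

Lemma measurable_law_preimage (B : set (R * R)) : measurable B ->
  measurable ((@unit_itv R) `&` [set t | B (signed_series l (digit t))]).
Proof.
move=> mB; have [m1 m2] := measurable_series_coord l1.
have mD : measurable (@unit_itv R) by rewrite unit_itvE; exact: measurable_itv.
have p1 := (measurable_restrictT _ mD).1 m1; have p2 := (measurable_restrictT _ mD).1 m2.
have mp := measurable_fun_pair p1 p2.
have -> : (@unit_itv R) `&` [set t | B (signed_series l (digit t))] = (@unit_itv R) `&`
   ((fun t : R => (((fun t => (signed_series l (digit t)).1) \_ (@unit_itv R)) t,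
     ((fun t => (signed_series l (digit t)).2) \_ (@unit_itv R)) t)) @^-1` B).
  apply/seteqP; split => t [Dt Bt]; split => //; move: Bt;
    by rewrite /= !patchE mem_set// -surjective_pairing.
by apply: measurableI => //; rewrite -[X in measurable X]setTI; exact: mp.
Qed.

(** The convergence hypothesis is an argument, so that the measure instance below, whose
    sigma-additivity rests on it, can be attached to this constant. *)
Definition law_measure of n2 l < 1 := @nu R l.

Let law0 : law_measure l1 set0 = 0%E.
Proof. by rewrite /law_measure /nu [X in _ `&` X](_ : _ = set0) ?setI0 ?measure0. Qed.

Let law_ge0 B : (0 <= law_measure l1 B)%E.
Proof. exact: measure_ge0. Qed.

Let law_sigma_additive : semi_sigma_additive (law_measure l1).
Proof.
move=> F mF tF mUF; rewrite /law_measure /nu.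
have -> : [set t : R | 0 <= t < 1] `&` [set t | (\bigcup_n F n) (signed_series l (digit t))] =
   \bigcup_n ((@unit_itv R) `&` [set t | F n (signed_series l (digit t))]).
  apply/seteqP; split => [t [Dt [n _ Fn]]|t [n _ [Dt Fn]]]; first by exists n.
  by split => //; exists n.
apply: measure_semi_sigma_additive.
- by move=> n; exact: measurable_law_preimage.
- apply/trivIsetP => i j _ _ ij; rewrite -subset0 => t [[_ Fi] [_ Fj]].
  have /trivIsetP/(_ i j I I ij) E := tF.
  have : (F i `&` F j) (signed_series l (digit t)) by split.
  by rewrite E.
- by apply: bigcupT_measurable => n; exact: measurable_law_preimage.
Qed.

HB.instance Definition _ := isMeasure.Build _ _ _ (law_measure l1)
  law0 law_ge0 law_sigma_additive.

End LawMeasure.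

(** * Identifying the law with the limit density *)

Section Identification.
Variables (R : realType) (l : R * R) (g : R * R -> R).
Notation leb := (@lebesgue_measure R).
Notation leb2 := ((@lebesgue_measure R) \x (@lebesgue_measure R))%E.
Hypothesis l1 : n2 l < 1.
Hypothesis glim : forall e : R, 0 < e -> exists n0, forall n, (n0 <= n)%N ->
  exists N0, forall N z, (N0 <= N)%N -> `|smoothed l n N z - g z| <= e.

Lemma limit_ge0 z : 0 <= g z.
Proof.
apply/ler_addgt0Pr => e e0; have [n0 H] := glim e0.
have [N0 H0] := H n0 (leqnn _); have := H0 N0 z (leqnn _).
by have := smoothed_ge0 l n0 N0 z; rewrite ler_norml => ? /andP[? ?]; lra.
Qed.

Lemma limit_sequence : exists p : nat -> nat * nat,
  forall i z, `|smoothed l (p i).1 (p i).2 z - g z| <= i.+1%:R^-1.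
Proof.
suff h : forall i : nat, exists q : nat * nat,
    forall z, `|smoothed l q.1 q.2 z - g z| <= i.+1%:R^-1.
  by have [p pP] := choice h; exists p.
move=> i; have i0 : 0 < i.+1%:R^-1 :> R by rewrite invr_gt0.
have [n0 H] := glim i0; have [N0 H0] := H n0 (leqnn _).
by exists (n0, N0) => z; exact: H0.
Qed.

Lemma measurable_limit : measurable_fun [set: R * R] g.
Proof.
have [p pP] := limit_sequence.
apply: (@measurable_fun_cvg _ _ _ _ (fun i => smoothed l (p i).1 (p i).2)).
  by move=> i; exact: measurable_smoothed.
move=> z _; apply/cvgrPdist_le => e e0.
exists (Num.truncn e^-1) => // i /= ei; rewrite distrC (le_trans (pP i z))//.
rewrite invf_ple ?posrE//; apply: ltW.
have e1 : 0 <= e^-1 by rewrite invr_ge0 ltW.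
have /andP[_ h] := truncn_itv e1.
by apply: lt_le_trans h _; rewrite ler_nat ltnS.
Qed.

Lemma smoothed_lip n N : lip (2 * 8 ^+ n) (smoothed l n N).
Proof.
move=> x y; rewrite /smoothed -avgB; apply: avg_norm_le => u _.
apply: (le_trans (sq_tent_lip _ _ _)).
by rewrite opprB addrA subrK.
Qed.

Lemma limit_continuous : continuous g.
Proof.
move=> z; apply/cvgrPdist_le => e e0.
have e4 : 0 < e / 4 by rewrite divr_gt0.
have [n H] := glim e4; have [N HN] := H n (leqnn _).
have L0 : 0 < 2 * 8 ^+ n :> R by rewrite mulr_gt0// exprn_gt0.
have d0 : 0 < e / 4 / (2 * 8 ^+ n) by rewrite divr_gt0.
near=> y.
have zy : `|z - y| <= e / 4 / (2 * 8 ^+ n).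
  by near: y; apply: cvgr_dist_le => //; exact: cvg_id.
have := HN N z (leqnn _); have := HN N y (leqnn _).
have : `|smoothed l n N z - smoothed l n N y| <= e / 4.
  by apply: (le_trans (smoothed_lip _ _ _ _)); rewrite mulrC -ler_pdivlMr.
rewrite !ler_norml => /andP[? ?] /andP[? ?] /andP[? ?].
by apply/andP; split; lra.
Unshelve. all: by end_near.
Qed.

(** Partial sum and series are functions of the same [t], at distance at most [tail l N]; the
    comparison is an inclusion of events. *)
Lemma law_avg_le N (B B' : set (R * R)) : measurable B ->
  (forall x y, B x -> `|x - y| <= tail l N -> B' y) ->
  (nu l B <= (avg (mkseq (cpow l) N) \1_B')%:E)%E.
Proof.
move=> mB BB'; have [mE <-] := partial_series_law l N B'.
apply: le_measure; rewrite ?inE//; first exact: (measurable_law_preimage l1 mB).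
move=> t [Dt Bt]; split => //=; apply: BB' Bt _.
by rewrite distrC; exact: partial_series_tail.
Qed.

Lemma avg_le_law N (B B' : set (R * R)) : measurable B' ->
  (forall x y, B x -> `|x - y| <= tail l N -> B' y) ->
  ((avg (mkseq (cpow l) N) \1_B)%:E <= nu l B')%E.
Proof.
move=> mB BB'; have [mE <-] := partial_series_law l N B.
apply: le_measure; rewrite ?inE//; first exact: (measurable_law_preimage l1 mB).
move=> t [Dt Bt]; split => //=; apply: BB' Bt _; exact: partial_series_tail.
Qed.

Lemma box_shift (a b c d e f : R) x y : box a b c d x -> `|x - y| <= e ->
  e <= f -> box (a - f) (b + f) (c - f) (d + f) y.
Proof.
move=> /boxE[/andP[? ?] /andP[? ?]] xy ef.
have := le_trans (norm_fst_le (x - y)) xy; have := le_trans (norm_snd_le (x - y)) xy.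
rewrite !ler_norml => /andP[/= ? ?] /andP[/= ? ?].
by apply/boxE; split; apply/andP; split; lra.
Qed.

Lemma law_le_integral_smoothed n N (a b c d e : R) : 0 < e -> 2 ^- n <= e / 2 ->
  tail l N <= e / 2 ->
  (nu l (box (a + e) (b - e) (c + e) (d - e)) <=
   \int[leb2]_(z in box a b c d) (smoothed l n N z)%:E)%E.
Proof.
move=> e0 ne te; rewrite integral_smoothed; last exact: measurable_box.
(* Half of the margin absorbs the tail of the series, the other half the width of the tent. *)
pose B' := box (a + e / 2) (b - e / 2) (c + e / 2) (d - e / 2).
apply: (@le_trans _ _ (avg (mkseq (cpow l) N) \1_B')%:E).
  apply: law_avg_le; first exact: measurable_box.
  move=> x y Bx xy; have := box_shift Bx xy te.
  by rewrite /B'; congr (box _ _ _ _ _); lra.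
rewrite avg_indicE; apply: lee_sum => x _; apply: lee_wpmul2l.
  by rewrite lee_fin invr_ge0 exprn_ge0.
exact: integral_sq_tent_box_ge.
Qed.

Lemma integral_smoothed_le_law n N (a b c d e : R) : 0 < e -> 2 ^- n <= e / 2 ->
  tail l N <= e / 2 ->
  (\int[leb2]_(z in box a b c d) (smoothed l n N z)%:E <=
   nu l (box (a - e) (b + e) (c - e) (d + e)))%E.
Proof.
move=> e0 ne te; rewrite integral_smoothed; last exact: measurable_box.
pose B' := box (a - e / 2) (b + e / 2) (c - e / 2) (d + e / 2).
apply: (@le_trans _ _ (avg (mkseq (cpow l) N) \1_B')%:E).
  rewrite avg_indicE; apply: lee_sum => x _; apply: lee_wpmul2l.
    by rewrite lee_fin invr_ge0 exprn_ge0.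
  exact: integral_sq_tent_box_le.
apply: avg_le_law; first exact: measurable_box.
move=> x y Bx xy; have := box_shift Bx xy te.
by congr (box _ _ _ _ _); lra.
Qed.

Lemma leb2_box (a b c d : R) : exists2 A : R, 0 <= A & leb2 (box a b c d) = A%:E.
Proof.
rewrite product_measure1E// /box.
have itv (x y : R) : exists2 A : R, 0 <= A & leb `]x, y[%classic = A%:E.
  rewrite lebesgue_measure_itv/= lte_fin; case: ltP => xy; last by exists 0.
  by exists (y - x); rewrite ?subr_ge0 ?ltW// EFinB.
have [A A0 EA] := itv a b; have [B B0 EB] := itv c d.
exists (A * B); first exact: mulr_ge0.
by rewrite EFinM -EA -EB.
Qed.

Lemma integral_perturb (f h : R * R -> R) (a b c d e : R) :
  measurable_fun setT f -> measurable_fun setT h -> 0 <= e ->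
  (forall z, 0 <= f z) -> (forall z, 0 <= h z) -> (forall z, f z <= h z + e) ->
  (\int[leb2]_(z in box a b c d) (f z)%:E <=
   \int[leb2]_(z in box a b c d) (h z)%:E + e%:E * leb2 (box a b c d))%E.
Proof.
move=> mf mh e0 f0 h0 fh; have mB := measurable_box a b c d.
rewrite -integral_cst// -ge0_integralD//; last 2 first.
- by move=> z _; rewrite lee_fin.
- by apply/measurable_EFinP; exact: measurable_funTS.
apply: ge0_le_integral => //.
- by move=> z _; rewrite lee_fin.
- by apply/measurable_EFinP; exact: measurable_funTS.
- by apply/measurable_EFinP; apply: measurable_funD => //; exact: measurable_funTS.
- by move=> z _; rewrite -EFinD lee_fin.
Qed.

Lemma margin_small e : 0 < e -> exists n0, forall n, (n0 <= n)%N -> 2 ^- n <= e :> R.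
Proof.
move=> e0; have h0 : 0 <= 2^-1 :> R by rewrite invr_ge0.
have h1 : 2^-1 < 1 :> R by lra.
have [n0 H] := geometric_small h0 h1 ler01 e0.
by exists n0 => n /H; rewrite mul1r exprVn.
Qed.

Lemma good_indices e q : 0 < e -> 0 < q -> exists n N, [/\ 2 ^- n <= e,
  tail l N <= e & forall z, `|smoothed l n N z - g z| <= q].
Proof.
move=> e0 q0; have [n1 H1] := margin_small e0; have [N1 H2] := tail_small l1 e0.
have [n2' H3] := glim q0; have [N2 H4] := H3 _ (leq_maxr n1 n2').
exists (maxn n1 n2'), (maxn N1 N2); split.
- by apply: H1; exact: leq_maxl.
- by apply: H2; exact: leq_maxl.
- by move=> z; apply: H4; exact: leq_maxr.
Qed.

Lemma law_le_integral_limit (a b c d e : R) : 0 < e ->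
  (nu l (box (a + e) (b - e) (c + e) (d - e)) <=
   \int[leb2]_(z in box a b c d) (g z)%:E)%E.
Proof.
move=> e0; have [A A0 EA] := leb2_box a b c d.
apply/lee_addgt0Pr => q q0.
have e2 : 0 < e / 2 by rewrite divr_gt0.
have q2 : 0 < q / (A + 1) by rewrite divr_gt0// ltr_wpDl.
have [n [N [h1 h2 h3]]] := good_indices e2 q2.
apply: (le_trans (law_le_integral_smoothed _ _ _ _ e0 h1 h2)).
apply: (@le_trans _ _ (\int[leb2]_(z in box a b c d) (g z)%:E +
    (q / (A + 1))%:E * leb2 (box a b c d))%E).
  apply: integral_perturb.
  - exact: measurable_smoothed.
  - exact: measurable_limit.
  - exact: ltW.
  - exact: smoothed_ge0.
  - exact: limit_ge0.
  - by move=> z; have := h3 z; rewrite ler_norml => /andP[? ?]; lra.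
rewrite EA -EFinM leeD2l// lee_fin mulrAC ler_pdivrMr ?ltr_wpDl//.
by rewrite ler_pM2l// lerDl.
Qed.

Lemma integral_limit_le_law (a b c d e : R) : 0 < e ->
  (\int[leb2]_(z in box a b c d) (g z)%:E <=
   nu l (box (a - e) (b + e) (c - e) (d + e)))%E.
Proof.
move=> e0; have [A A0 EA] := leb2_box a b c d.
apply/lee_addgt0Pr => q q0.
have e2 : 0 < e / 2 by rewrite divr_gt0.
have q2 : 0 < q / (A + 1) by rewrite divr_gt0// ltr_wpDl.
have [n [N [h1 h2 h3]]] := good_indices e2 q2.
apply: (@le_trans _ _ (\int[leb2]_(z in box a b c d) (smoothed l n N z)%:E +
    (q / (A + 1))%:E * leb2 (box a b c d))%E).
  apply: integral_perturb.
  - exact: measurable_limit.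
  - exact: measurable_smoothed.
  - exact: ltW.
  - exact: limit_ge0.
  - exact: smoothed_ge0.
  - by move=> z; have := h3 z; rewrite ler_norml => /andP[? ?]; lra.
apply: leeD; first exact: integral_smoothed_le_law.
rewrite EA -EFinM lee_fin mulrAC ler_pdivrMr ?ltr_wpDl//.
by rewrite ler_pM2l// lerDl.
Qed.

Lemma box_exhaustion (a b c d : R) :
  let F (i : nat) := box (a + i.+1%:R^-1) (b - i.+1%:R^-1) (c + i.+1%:R^-1) (d - i.+1%:R^-1) in
  nondecreasing_seq F /\ \bigcup_i F i = box a b c d.
Proof.
move=> F; have inv0 (i : nat) : 0 < i.+1%:R^-1 :> R by rewrite invr_gt0.
split.
  move=> i j ij; apply/subsetPset => z; rewrite /F.
  have h : j.+1%:R^-1 <= i.+1%:R^-1 :> R by rewrite lef_pV2 ?posrE// ler_nat.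
  move: h; move: (i.+1%:R^-1) (j.+1%:R^-1) => u v vu /boxE[/andP[? ?] /andP[? ?]].
  by apply/boxE; split; apply/andP; split; lra.
apply/seteqP; split => z.
  move=> [i _]; rewrite /F; move: (inv0 i); move: (i.+1%:R^-1) => u u0.
  move=> /boxE[/andP[? ?] /andP[? ?]].
  by apply/boxE; split; apply/andP; split; lra.
move=> /boxE[/andP[h1 h2] /andP[h3 h4]].
pose m := Num.min (Num.min (z.1 - a) (b - z.1)) (Num.min (z.2 - c) (d - z.2)).
have m0 : 0 < m by rewrite !lt_min !subr_gt0 h1 h2 h3 h4.
exists (Num.truncn m^-1) => //.
have hm : (Num.truncn m^-1).+1%:R^-1 < m.
  rewrite invf_plt ?posrE//.
  have m1 : 0 <= m^-1 by rewrite invr_ge0 ltW.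
  by have /andP[_] := truncn_itv m1.
rewrite /F; move: hm; move: (_^-1) => u; rewrite !lt_min.
move=> /andP[/andP[? ?] /andP[? ?]].
by apply/boxE; split; apply/andP; split; lra.
Qed.

Definition density_measure (mg : measurable_fun [set: R * R] g)
    (g0 : forall z, 0 <= g z) (B : set (R * R)) : \bar R :=
  (\int[leb2]_(z in B) (g z)%:E)%E.

Let mgl := measurable_limit.
Let g0l := limit_ge0.

Let dens0 : density_measure mgl g0l set0 = 0%E.
Proof. by rewrite /density_measure integral_set0. Qed.

Let dens_ge0 B : (0 <= density_measure mgl g0l B)%E.
Proof. by apply: integral_ge0 => z _; rewrite lee_fin limit_ge0. Qed.

Let dens_sigma_additive : semi_sigma_additive (density_measure mgl g0l).
Proof.
have mge : measurable_fun setT (fun z : R * R => (g z)%:E).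
  by apply/measurable_EFinP; exact: measurable_limit.
have ge0 z : (0 <= (g z)%:E)%E by rewrite lee_fin limit_ge0.
exact: (@semi_sigma_additive_nng_induced _ _ _ leb2 _ mge ge0).
Qed.

HB.instance Definition _ := isMeasure.Build _ _ _ (density_measure mgl g0l)
  dens0 dens_ge0 dens_sigma_additive.

Lemma measure_box_le (m : {measure set (R * R)%type -> \bar R}) (a b c d : R) (y : \bar R) :
  (forall e : R, 0 < e -> (m (box (a + e) (b - e) (c + e) (d - e)) <= y)%E) ->
  (m (box a b c d) <= y)%E.
Proof.
move=> my; have [ndF <-] := box_exhaustion a b c d.
set F := fun i : nat => _ in ndF *.
have mF i : measurable (F i) by exact: measurable_box.
have cv := nondecreasing_cvg_mu (mu := m) mF (bigcupT_measurable _ mF) ndF.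
rewrite -(cvg_lim _ cv)//; apply: lime_le; first by apply/cvg_ex; eexists; exact: cv.
by apply: nearW => i; apply: my; rewrite invr_gt0.
Qed.

Lemma law_eq_density (B : set (R * R)) : measurable B ->
  nu l B = (\int[leb2]_(z in B) (g z)%:E)%E.
Proof.
apply: (@measure_eq_boxes R (law_measure l1) (density_measure mgl g0l)).
  apply: (@le_lt_trans _ _ (leb (@unit_itv R))).
    apply: le_measure; rewrite ?inE.
    - exact: (measurable_law_preimage l1).
    - by rewrite unit_itvE; exact: measurable_itv.
    - by move=> t [].
  by rewrite unit_itvE lebesgue_measure_itv/=; case: ifP => _; rewrite ?ltry// -EFinB ltry.
move=> a b c d; apply/eqP; rewrite eq_le; apply/andP; split.
  apply: measure_box_le => e e0; exact: law_le_integral_limit.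
apply: measure_box_le => e e0.
(* The box shrunk by [e] is enlarged by [e] in the comparison, which restores it. *)
have := integral_limit_le_law (a + e) (b - e) (c + e) (d - e) e0.
by rewrite !addrK !subrK.
Qed.

Lemma limit_density : has_continuous_density l.
Proof.
exists g; split; first exact: limit_continuous.
split; first exact: limit_ge0.
exact: law_eq_density.
Qed.

End Identification.

Lemma leb2_box_gt0 (R : realType) (a b c d : R) : a < b -> c < d ->
  (0 < ((@lebesgue_measure R) \x (@lebesgue_measure R)) (box a b c d))%E.
Proof.
move=> ab cd; rewrite product_measure1E//.
have itv (x y : R) : x < y -> (0 < (@lebesgue_measure R) `]x, y[%classic)%E.
  by move=> xy; rewrite lebesgue_measure_itv/= lte_fin xy -EFinB lte_fin subr_gt0.
by apply: mule_gt0; exact: itv.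
Qed.

(** * Interior of the support *)

Section Support.
Variables (R : realType) (l : R * R).
Hypothesis l1 : n2 l < 1.

Lemma signed_sum_prefix (a : nat -> R * R) (b b' : nat -> bool) N :
  (forall i, (i < N)%N -> b i = b' i) -> signed_sum a b 0 N = signed_sum a b' 0 N.
Proof.
move=> bb'; rewrite /signed_sum add0n; apply: eq_big_nat => i /andP[_ iN].
by rewrite bb'.
Qed.

(** Compactness of sign sequences, as in Koenig's lemma: a prefix is [good] if its extensions come
    arbitrarily close to [z], each good prefix extends by one good bit, and the series of the
    resulting branch [b] is [z]. *)
Lemma Aset_closed z :
  (forall e : R, 0 < e -> exists a, `|signed_series l a - z| <= e) -> Aset l z.
Proof.
move=> zA.
pose good (p : seq bool) := forall e : R, 0 < e -> exists2 a : nat -> bool,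
  (forall i, (i < size p)%N -> a i = nth false p i) & `|signed_series l a - z| <= e.
have good0 : good [::] by move=> e /zA[a za]; exists a.
have good_step p : good p -> good (rcons p true) \/ good (rcons p false).
  move=> gp; apply: contrapT => /not_orP[/existsNP[e1 /not_implyP[e10 h1]]
     /existsNP[e2 /not_implyP[e20 h2]]].
  have e0 : 0 < Num.min e1 e2 by rewrite lt_min e10 e20.
  have [a ap] := gp _ e0; rewrite le_min => /andP[ae1 ae2].
  have agree : forall i, (i < size (rcons p (a (size p))))%N ->
      a i = nth false (rcons p (a (size p))) i.
    move=> i; rewrite size_rcons ltnS nth_rcons => ip.
    by case: ltngtP ip => // [/ap->|->].
  by case: (a (size p)) agree => agree; [apply: h1|apply: h2]; exists a.
pose next p := if pselect (good (rcons p true)) then rcons p true else rcons p false.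
pose P n := iter n next [::].
have goodP n : good (P n).
  elim: n => // n IH; rewrite /P iterS -/(P n) /next; case: pselect => // ng.
  by have [] := good_step _ IH.
have sizeP n : size (P n) = n.
  elim: n => // n IH; rewrite /P iterS -/(P n) /next; case: pselect => ?;
    by rewrite size_rcons IH.
pose b n := nth false (P n.+1) n.
have nthP N i : (i < N)%N -> nth false (P N) i = b i.
  elim: N => // N IH; rewrite ltnS leq_eqVlt => /orP[/eqP ->//|iN].
  rewrite -IH// /P iterS -/(P N) /next; case: pselect => ?;
    by rewrite nth_rcons sizeP iN.
exists b => //; apply/eqP; rewrite -subr_eq0 -normr_le0; apply/ler_addgt0Pr => e e0.
rewrite add0r; have e3 : 0 < e / 3 by rewrite divr_gt0.
have [N0 HN] := tail_small l1 e3; have tN := HN _ (leqnn _).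
have [a ab az] := goodP N0 _ e3; rewrite sizeP in ab.
have Sab : partial_series l b N0 = partial_series l a N0.
  by apply: signed_sum_prefix => i iN; rewrite ab// nthP.
have h1 := partial_series_tail l1 b N0; have h2 := partial_series_tail l1 a N0.
have -> : signed_series l b - z = - (partial_series l b N0 - signed_series l b) +
    (partial_series l a N0 - signed_series l a) + (signed_series l a - z).
  by rewrite Sab opprB !subrKA.
apply: (le_trans (ler_normD _ _)); apply: (@le_trans _ _ (e / 3 + e / 3 + e / 3)).
  apply: lerD => //; apply: (le_trans (ler_normD _ _)); rewrite normrN.
  by apply: lerD; [exact: le_trans h1 tN|exact: le_trans h2 tN].
by lra.
Qed.

(** Total mass 1 makes [g] positive somewhere, hence at least [c] on a ball. Small boxes around a
    point of the ball of half the radius have positive law, so they contain values of the series,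
    and closedness applies. *)
Lemma density_interior (g : R * R -> R) : continuous g ->
  measurable_fun [set: R * R] g -> (forall z, 0 <= g z) ->
  (forall B, measurable B -> nu l B = (\int[@L2 R]_(z in B) (g z)%:E)%E) ->
  interior (Aset l) !=set0.
Proof.
move=> gc mg g0 gE.
have [z0 gz0] : exists z0, 0 < g z0.
  apply: contrapT => /forallNP ng.
  have gz z : g z = 0.
    by apply/eqP; rewrite eq_le g0 andbT leNgt; apply/negP; exact: ng.
  have := gE setT measurableT; rewrite /L2 integral0_eq => [|z _]; last by rewrite gz.
  rewrite /nu [X in lebesgue_measure X](_ : _ = @unit_itv R); last first.
    by apply/seteqP; split => t //= [].
  rewrite unit_itvE lebesgue_measure_itv/= lte_fin expr0 mul0r divr1 ltr01 -EFinB subr0.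
  by move=> /eqP; rewrite eqe oner_eq0.
pose c := g z0 / 2; have c0 : 0 < c by rewrite divr_gt0.
have [d /= d0 dP] : exists2 d : R, 0 < d & forall y, `|z0 - y| < d -> c <= g y.
  have /cvgrPdist_lt/(_ c c0)/nbhs_normP[d /= d0 dP] := gc z0.
  exists d => // y /dP /=; rewrite ltr_norml => /andP[_]; rewrite /c; lra.
suff : nbhs z0 (Aset l) by exists z0.
have d2 : 0 < d / 2 by rewrite divr_gt0.
exists (ball z0.1 (d / 2), ball z0.2 (d / 2)); first by split; exact: nbhsx_ballx.
move=> z1 [/= z011 z012]; apply: Aset_closed => e e0.
have z01 : `|z0 - z1| < d / 2 by rewrite prod_normE gt_max; apply/andP; split.
pose r := Num.min e (d / 2).
have r0 : 0 < r by rewrite lt_min e0 divr_gt0.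
pose B := box (z1.1 - r) (z1.1 + r) (z1.2 - r) (z1.2 + r).
have Bnorm y : B y -> `|y - z1| < r.
  move=> /boxE[/andP[? ?] /andP[? ?]]; rewrite prod_normE gt_max /= !ltr_norml.
  by apply/andP; split; apply/andP; split; lra.
have mB : measurable B by exact: measurable_box.
have nuB : (0 < nu l B)%E.
  rewrite gE//; apply: (@lt_le_trans _ _ (\int[L2 (R:=R)]_(z in B) c%:E)%E).
    rewrite /L2 integral_cst//; apply: mule_gt0; first by rewrite lte_fin.
    by apply: leb2_box_gt0; lra.
  apply: ge0_le_integral => //.
  - by move=> z _; rewrite lee_fin ltW.
  - by apply/measurable_EFinP; exact: measurable_funTS.
  - move=> z /Bnorm Bz; rewrite lee_fin; apply: dP.
    have := ler_normD (z0 - z1) (z1 - z); rewrite addrA subrK => /le_lt_trans; apply.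
    move: Bz; rewrite distrC lt_min => /andP[_ ?]; lra.
have [t [Dt Bt]] : exists t : R, ([set t | 0 <= t < 1] `&`
    [set t | B (signed_series l (digit t))]) t.
  apply: contrapT => /forallNP nt; move: nuB; rewrite /nu.
  rewrite [X in lebesgue_measure X](_ : _ = set0) ?measure0 ?ltxx//.
  by rewrite -subset0 => t /nt.
exists (digit t); have := Bnorm _ Bt; rewrite lt_min => /andP[h _]; exact: ltW.
Qed.

End Support.

(** * From the radii to polynomial inequalities *)

Section Numerics.
Variable R : realType.

Lemma cabs_pow (l : R * R) m : cabs l ^+ (2 * m) = n2 l ^+ m.
Proof. by rewrite exprM /cabs sqr_sqrtr ?n2_ge0. Qed.

Lemma cabs_ge0 (l : R * R) : 0 <= cabs l.
Proof. exact: sqrtr_ge0. Qed.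

Lemma cabs_lower (l : R * R) k : (0 < k)%N ->
  (2 : R) `^ (- (1 / (2 * k%:R))) < cabs l -> 1 / 2 < n2 l ^+ k.
Proof.
move=> k0 h; rewrite -cabs_pow.
have k0R : k%:R != 0 :> R by rewrite pnatr_eq0 -lt0n.
have -> : 1 / 2 = ((2 : R) `^ (- (1 / (2 * k%:R)))) ^+ (2 * k).
  rewrite -powR_mulrn ?powR_ge0// -powRrM natrM.
  have -> : - (1 / (2 * k%:R)) * (2 * k%:R) = -1 :> R by field.
  by rewrite powR_inv1// div1r.
by rewrite ltr_pXn2r ?nnegrE ?powR_ge0 ?cabs_ge0// muln_gt0.
Qed.

Lemma cabs_upper (l : R * R) k : (0 < k)%N ->
  cabs l < (2 * (5 : R) `^ (- (5 / 8))) `^ (1 / k%:R) ->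
  5 * n2 l ^+ (4 * k) < (4 / 5) ^+ 4.
Proof.
move=> k0 h.
have k0R : k%:R != 0 :> R by rewrite pnatr_eq0 -lt0n.
have v0 : 0 <= 2 * (5 : R) `^ (- (5 / 8)) by rewrite mulr_ge0 ?powR_ge0.
have E : (5 : R) `^ (- (5 / 8)) ^+ 8 = (5 ^+ 5)^-1.
  rewrite -powR_mulrn ?powR_ge0// -powRrM.
  have -> : - (5 / 8) * 8%:R = - 5%:R :> R by field.
  by rewrite powRN powR_mulrn.
have : cabs l ^+ (8 * k) < ((2 * (5 : R) `^ (- (5 / 8))) `^ (1 / k%:R)) ^+ (8 * k).
  by rewrite ltr_pXn2r ?nnegrE ?powR_ge0 ?cabs_ge0// muln_gt0.
(* The power [8 * k] clears both fractional exponents, and [2^8 / 5^5] is [(4/5)^4 / 5]. *)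
have -> : ((2 * (5 : R) `^ (- (5 / 8))) `^ (1 / k%:R)) ^+ (8 * k) = 2 ^+ 8 * (5 ^+ 5)^-1.
  rewrite [(8 * k)%N]mulnC exprM -(powR_mulrn k (powR_ge0 _ _)) -powRrM.
  by rewrite mul1r mulVf// powRr1// exprMn E.
have -> : (8 * k = 2 * (4 * k))%N by rewrite mulnA.
rewrite cabs_pow => h'.
have -> : (4 / 5) ^+ 4 = 5 * (2 ^+ 8 * (5 ^+ 5)^-1) :> R by field.
by rewrite ltr_pM2l.
Qed.

Lemma five_pow_lt : 5 ^+ 55 < 2 ^+ 128 :> R.
Proof. lra. Qed.

(* Consecutive annuli overlap as soon as [k >= 10], because [5^55 < 2^128]. *)
Lemma annuli_cover (x : R) : 0 <= x -> 1 / 2 < x ^+ 10 -> x < 1 ->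
  exists2 k, (2 <= k)%N & 1 / 2 < x ^+ k /\ 5 * x ^+ (4 * k) < (4 / 5) ^+ 4.
Proof.
move=> x0 x10 x1.
have exm : exists m, x ^+ m <= 1 / 2.
  have h : 0 < 1 / 2 :> R by rewrite divr_gt0.
  have [N0 H] := geometric_small x0 x1 ler01 h.
  by exists N0; have := H _ (leqnn _); rewrite (mul1r (x ^+ N0)).
(* The witness is [m - 1], the last exponent at which the power of [x] exceeds 1/2. *)
have [m xm mmin] := ex_minnP exm.
have m10 : (10 < m)%N.
  rewrite ltnNge; apply/negP => m10; move: x10; apply/negP; rewrite -leNgt.
  apply: le_trans xm; rewrite -(subnK m10) exprD ler_piMl ?exprn_ge0//.
  by rewrite exprn_ile1 // ltW.
case: m m10 xm mmin => // k; rewrite ltnS => k10 xk kmin.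
exists k; first exact: leq_trans k10.
split.
  by rewrite ltNge; apply/negP => /kmin; rewrite ltnn.
rewrite ltNge; apply/negP => h.
have q0 : 0 <= (4 / 5) ^+ 4 / 5 :> R by rewrite divr_ge0// exprn_ge0.
have h1 : (4 / 5) ^+ 4 / 5 <= x ^+ (4 * k) by rewrite ler_pdivrMr// [leRHS]mulrC.
(* The powers 11 and 40 fit because [44 * k >= 40 * (k + 1)] for [k >= 10]; a failure of the bound
   would give [5^55 >= 2^128]. *)
have h2 : ((4 / 5) ^+ 4 / 5) ^+ 11 <= (x ^+ (4 * k)) ^+ 11.
  by rewrite lerXn2r ?nnegrE ?exprn_ge0// ltW.
have h3 : (x ^+ (4 * k)) ^+ 11 <= (1 / 2) ^+ 40.
  apply: (@le_trans _ _ ((x ^+ k.+1) ^+ 40)); last first.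
    by rewrite lerXn2r ?nnegrE ?exprn_ge0.
  rewrite -!exprM.
  have kk : (k.+1 * 40 <= 4 * k * 11)%N by lia.
  rewrite -(subnK kk) exprD ler_piMl ?exprn_ge0//.
  by rewrite exprn_ile1// ltW.
have := le_trans h2 h3.
have -> : ((4 / 5) ^+ 4 / 5) ^+ 11 = 2 ^+ 88 / 5 ^+ 55 :> R by field.
have -> : (1 / 2) ^+ 40 = 2 ^+ 88 / 2 ^+ 128 :> R by field.
rewrite ler_pM2l ?exprn_gt0// lef_pV2 ?posrE ?exprn_gt0//.
by rewrite leNgt five_pow_lt.
Qed.

End Numerics.

(** * From bounded energy to the theorem *)

Section Main.
Variable R : realType.
Notation leb2 := ((@lebesgue_measure R) \x (@lebesgue_measure R))%E.

Lemma density_of_bounded_energy (l : R * R) k :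
  1 / 2 < n2 l ^+ k.+2 -> 5 * n2 l ^+ (4 * k.+2) < (4 / 5) ^+ 4 ->
  bounded_energy (cpow l k.+2) ->
  has_continuous_density l /\ interior (Aset l) !=set0.
Proof.
move=> h1 h2 be.
have l1 : n2 l < 1.
  rewrite ltNge; apply/negP => l1; have : 1 <= n2 l ^+ (4 * k.+2) by rewrite exprn_ege1.
  by lra.
have l2 : 1 / 2 <= n2 l.
  by apply: (le_trans (ltW h1)); rewrite exprS ler_piMr ?n2_ge0// exprn_ile1 ?n2_ge0// ltW.
have [g glim] := smoothed_limit l1 l2 be.
split; first exact: (limit_density l1 glim).
apply: (density_interior l1 (g := g)).
- exact: limit_continuous glim.
- exact: measurable_limit glim.
- exact: limit_ge0 glim.
- exact: (law_eq_density l1 glim).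
Qed.

(** With [k] quantified inside, the exponent may depend on [l]; the exceptional sets form a
    countable union of null sets. *)
Lemma ae_density : {ae @L2 R, forall l : R * R, forall k,
  1 / 2 < n2 l ^+ k.+2 -> 5 * n2 l ^+ (4 * k.+2) < (4 / 5) ^+ 4 ->
  has_continuous_density l /\ interior (Aset l) !=set0}.
Proof.
rewrite /L2; have N := negligible_bigcup
  (fun k => ae_bounded_energy_annulus R k.+1 : leb2.-negligible _).
apply: negligibleS N => l /= /existsNP[k /not_implyP[h1 /not_implyP[h2 nd]]].
exists k => //= be; apply: nd; exact: density_of_bounded_energy (be h1 h2).
Qed.

End Main.

Theorem mainTheorem17 (R : realType) :
  {ae @L2 R, forall l : R * R,
     (exists k : nat, (2 <= k)%N /\
        (2 : R) `^ (- (1 / (2 * k%:R))) < cabs l /\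
        cabs l < (2 * (5 : R) `^ (- (5 / 8))) `^ (1 / k%:R)) ->
     has_continuous_density l /\ interior (Aset l) !=set0}
  /\
  {ae @L2 R, forall l : R * R,
     (2 : R) `^ (- (1 / 20)) < cabs l < 1 ->
     has_continuous_density l /\ interior (Aset l) !=set0}.
Proof.
have := ae_density R; rewrite /L2 => ae.
split.
  apply: negligibleS ae => l /= + H; apply => -[[|[|k]]] [//= k2 [h1 h2]].
  by apply: (H k); [exact: cabs_lower|exact: cabs_upper].
apply: negligibleS ae => l /= + H; apply => /andP[h1 h2].
(* [20 = 2 * 10]: the bound is the lower radius for exponent 10, from which on the annuli
   overlap. *)
have x10 : 1 / 2 < n2 l ^+ 10.
  apply: cabs_lower => //.
  by have -> : 2 * 10%:R = 20 :> R by ring.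
have x1 : n2 l < 1.
  have := @cabs_pow R l 1; rewrite expr1 => <-.
  by rewrite exprn_ilt1 ?cabs_ge0.
have [[|[|k]] // _ [y1 y2]] := annuli_cover (n2_ge0 l) x10 x1.
exact: (H k).
Qed.
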